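(* For the realization of $\mathfrak{osp}(1|2)$ in $A_\kappa=H_\kappa\otimes\mathcal C$ given by $\mathrm{span}\{F^+,F^-,H,E^+,E^-\}$, the supercentralizer $$\mathrm{Cent}_{A_\kappa}(\mathfrak{osp}(1|2))=\{a\in A_\kappa\mid [a,b]=0\ \text{for all } b\in \mathrm{span}\{F^\pm,H,E^\pm\}\}$$ is generated, as an associative algebra, by $\rho(\widetilde G)$ and the elements $O_{uv}$ and $O_{uvw}$ for $u,v,w\in V^*$.
   Context: Everything is over $\mathbb C$. $V\cong\mathbb C^d$ ($d\ge1$) carries a non-degenerate symmetric bilinear form $B$; $\mathrm O=\mathrm O(V,B)$ is the orthogonal group, acting also on $V^*$ by the contragredient action. $\langle\cdot,\cdot\rangle$ is the pairing between a space and its dual. $\beta:V\to V^*$ is defined by $\langle\beta(u_1),u_2\rangle=B(u_1,u_2)$, and $\beta$ also denotes the inverse map $V^*\to V$; $B$ also denotes the form on $V^*$ given by $B(u,v)=B(\beta(u),\beta(v))$. $G\subset\mathrm O$ is a finite real reflection group with set of reflections $\mathcal S$; for $s\in\mathcal S$ fix a $-1$ eigenvector $\alpha_s\in V^*$ of $s$ and put $\alpha_s^\vee=2\beta(\alpha_s)/B(\alpha_s,\alpha_s)\in V$. $\kappa:\mathcal S\to\mathbb C$ is invariant under conjugation by $G$. Rational Cherednik algebra: $H_\kappa$ is the quotient of $T(V\oplus V^* )\rtimes G$ by $[x,u]=0=[y,v]$ and $[y,x]=\langle y,x\rangle+\sum_{s\in\mathcal S}\langle y,\alpha_s\rangle\langle\alpha_s^\vee,x\rangle\kappa(s)s$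 for $x,u\in V^*$, $y,v\in V$. Clifford algebra: $\mathcal C$ is the unital associative algebra generated by $\gamma_u$ ($u\in V^*$, linear in $u$) with $\gamma_u\gamma_v+\gamma_v\gamma_u=2B(u,v)$; it is $\mathbb Z_2$-graded with each $\gamma_u$ odd. $A_\kappa=H_\kappa\otimes\mathcal C$ is the superalgebra in which $H_\kappa$ is even (so $H_\kappa$ and $\mathcal C$ commute). Supercommutator: $[a,b]=ab-(-1)^{|a||b|}ba$ for homogeneous $a,b$, extended bilinearly. Let $x_1,\dots,x_d$ be a $B$-orthonormal basis of $V^*$ with dual basis $y_1,\dots,y_d$ of $V$, and $e_j=\gamma_{x_j}$. The elements $F^+=\frac1{\sqrt2}\sum_j x_je_j$, $F^-=\frac1{\sqrt2}\sum_j y_je_j$, $H=\sum_j x_jy_j+\frac d2+\sum_{s\in\mathcal S}\kappa(s)s$, $E^+=\frac12\sum_j x_j^2$, $E^-=-\frac12\sum_j y_j^2$ of $A_\kappa$ (independent of the choice of basis) span a realization of the Lie superalgebra $\mathfrak{osp}(1|2)$. $P_\pm:A_\kappa\to A_\kappa$ is $P_\pm(a)=a\mp[F^\mp,[F^\pm,a]]$. For $u_1,\dots,u_n\in V^*$ let $\mathcal A(\gamma_{u_1\cdots u_n})=\frac1{n!}\sum_{\sigma\in S_n}\mathrm{sign}(\sigma)\gamma_{u_{\sigma(1)}}\cdots\gamma_{u_{\sigma(n)}}$ and $O_{u_1\cdots u_n}=-\frac12P_\pm(\mathcal A(\gamma_{u_1\cdots u_n}))$ ($P_+$ and $P_-$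 agree on $\mathcal C$). Pin cover: $\mathrm{Pin}\subset\mathcal C$ is the group of products $\gamma_{u_1}\cdots\gamma_{u_k}$ with $u_j\in V^*$, $B(u_j,u_j)=1$; $p:\mathrm{Pin}\to\mathrm O$ is the double cover sending $\gamma_u$ to the reflection with $-1$ eigenvector $u$. $\widetilde G=p^{-1}(G)$, and $\rho:\widetilde G\to A_\kappa$ is the group homomorphism $\rho(\tilde g)=p(\tilde g)\,\tilde g$, where $p(\tilde g)\in G\subset H_\kappa$ and $\tilde g\in\mathcal C$. *)

(* Defs.v *)
From HB Require Import structures.
From mathcomp Require Import all_boot all_order all_algebra.
From mathcomp Require Import perm finmap.
From mathcomp Require Import boolp classical_sets reals.
From mathcomp Require Import complex.
From mathcomp.multinomials Require Import monalg.

Set Implicit Arguments.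
Unset Strict Implicit.
Unset Printing Implicit Defensive.

Import GRing.Theory Num.Theory.
Local Open Scope ring_scope.
Local Open Scope quotient_scope.

(* Algebras presented by generators and relations: the quotient of the free  *)
(* algebra K<T> by the two-sided ideal generated by a set R of relators.     *)

Notation freeAlg K T := {malg K[{fmonom T}]}.

Definition fgen (K : fieldType) (T : choiceType) (t : T) : freeAlg K T :=
  mkmalgU (fmu t) 1.

Inductive two_sided_ideal (K : fieldType) (T : choiceType)
    (R : freeAlg K T -> Prop) : freeAlg K T -> Prop :=
| ideal_rel r : R r -> two_sided_ideal R r
| ideal_0 : two_sided_ideal R 0
| ideal_D a b :
    two_sided_ideal R a -> two_sided_ideal R b -> two_sided_ideal R (a + b)
| ideal_Ml a b : two_sided_ideal R b -> two_sided_ideal R (a * b)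
| ideal_Mr a b : two_sided_ideal R a -> two_sided_ideal R (a * b).

Lemma malg_scalerAr (K : fieldType) (T : choiceType) (k : K)
    (a b : freeAlg K T) : k *: (a * b) = a * (k *: b).
Proof.
apply/malgP=> m; rewrite mcoeffZ [in LHS]mcoeffMl.
rewrite (mcoeffMlw m (fsubset_refl (msupp a)) (msuppZ_le k b)) mulr_sumr.
apply: eq_bigr => m1 _; rewrite mulr_sumr; apply: eq_bigr => m2 _.
by rewrite mcoeffZ mulrnAr mulrCA.
Qed.

Section PresentedAlgebra.
Context (K : fieldType) (T : choiceType) (R : freeAlg K T -> Prop).
Local Notation F := (freeAlg K T).
Local Notation I := (two_sided_ideal R).
Implicit Types (a b c : F).

Lemma ideal_Z (k : K) a : I a -> I (k *: a).
Proof. by move=> Ia; rewrite -[a]mul1r scalerAl; apply: ideal_Ml. Qed.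

Lemma ideal_N a : I a -> I (- a).
Proof. by rewrite -scaleN1r; apply: ideal_Z. Qed.

Definition pres_equiv a b : bool := `[< I (a - b) >].

Lemma pres_equiv_refl : reflexive pres_equiv.
Proof. by move=> a; apply/asboolP; rewrite subrr; apply: ideal_0. Qed.

Lemma pres_equiv_sym : symmetric pres_equiv.
Proof.
by move=> a b; apply/asboolP/asboolP => /ideal_N; rewrite opprB.
Qed.

Lemma pres_equiv_trans : transitive pres_equiv.
Proof.
move=> b a c /asboolP Iab /asboolP Ibc; apply/asboolP.
by rewrite -(subrKA b); apply: ideal_D.
Qed.

Canonical pres_equivRel :=
  EquivRel pres_equiv pres_equiv_refl pres_equiv_sym pres_equiv_trans.

Definition presAlg := {eq_quot pres_equivRel}.
HB.instance Definition _ := Choice.on presAlg.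
HB.instance Definition _ := EqQuotient.on presAlg.

Definition pres_pi (a : F) : presAlg := \pi_presAlg a.

Lemma pres_piP a b : pres_pi a = pres_pi b <-> I (a - b).
Proof.
split; first by move/eqP; rewrite eqmodE => /asboolP.
by move=> Iab; apply/eqP; rewrite eqmodE; apply/asboolP.
Qed.

Lemma pres_reprK (x : presAlg) : pres_pi (repr x) = x.
Proof. by rewrite /pres_pi reprK. Qed.

Lemma pres_repr_pi a : I (repr (pres_pi a) - a).
Proof. by apply/pres_piP; rewrite pres_reprK. Qed.

End PresentedAlgebra.

(* The operations are locked to keep unification from unfolding them.        *)
HB.lock Definition pres_opp (K : fieldType) (T : choiceType)
    (R : freeAlg K T -> Prop) (x : presAlg R) : presAlg R :=
  pres_pi R (- repr x).
HB.lock Definition pres_add (K : fieldType) (T : choiceType)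
    (R : freeAlg K T -> Prop) (x y : presAlg R) : presAlg R :=
  pres_pi R (repr x + repr y).
HB.lock Definition pres_mul (K : fieldType) (T : choiceType)
    (R : freeAlg K T -> Prop) (x y : presAlg R) : presAlg R :=
  pres_pi R (repr x * repr y).
HB.lock Definition pres_scale (K : fieldType) (T : choiceType)
    (R : freeAlg K T -> Prop) (k : K) (x : presAlg R) : presAlg R :=
  pres_pi R (k *: repr x).

Section PresentedAlgebraTheory.
Context (K : fieldType) (T : choiceType) (R : freeAlg K T -> Prop).
Local Notation F := (freeAlg K T).
Local Notation presAlg := (presAlg R).
Local Notation pres_pi := (pres_pi R).
Local Notation pres_opp := (@pres_opp K T R).
Local Notation pres_add := (@pres_add K T R).
Local Notation pres_mul := (@pres_mul K T R).
Local Notation pres_scale := (@pres_scale K T R).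
Implicit Types (a b c : F).

Definition pres_zero : presAlg := pres_pi 0.
Definition pres_one : presAlg := pres_pi 1.

Lemma pres_oppE a : pres_opp (pres_pi a) = pres_pi (- a).
Proof.
rewrite pres_opp.unlock; apply/pres_piP; rewrite -opprD.
exact/ideal_N/pres_repr_pi.
Qed.

Lemma pres_addE a b : pres_add (pres_pi a) (pres_pi b) = pres_pi (a + b).
Proof.
rewrite pres_add.unlock; apply/pres_piP; rewrite opprD addrACA.
by apply: ideal_D; apply: pres_repr_pi.
Qed.

Lemma pres_mulE a b : pres_mul (pres_pi a) (pres_pi b) = pres_pi (a * b).
Proof.
rewrite pres_mul.unlock; apply/pres_piP; set a' := repr _; set b' := repr _.
have ->: a' * b' - a * b = (a' - a) * b' + a * (b' - b).
  by rewrite mulrBl mulrBr addrA subrK.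
by apply: ideal_D; [apply: ideal_Mr | apply: ideal_Ml]; apply: pres_repr_pi.
Qed.

Lemma pres_scaleE k a : pres_scale k (pres_pi a) = pres_pi (k *: a).
Proof.
rewrite pres_scale.unlock; apply/pres_piP; rewrite -scalerBr.
exact/ideal_Z/pres_repr_pi.
Qed.

Lemma presAlg_ind (P : presAlg -> Prop) :
  (forall a, P (pres_pi a)) -> forall x, P x.
Proof. by move=> Ppi x; rewrite -(pres_reprK x). Qed.

Fact pres_addA : associative pres_add.
Proof. by do 3!elim/presAlg_ind=> ?; rewrite !pres_addE addrA. Qed.
Fact pres_addC : commutative pres_add.
Proof. by do 2!elim/presAlg_ind=> ?; rewrite !pres_addE addrC. Qed.
Fact pres_add0 : left_id pres_zero pres_add.
Proof. by elim/presAlg_ind=> ?; rewrite pres_addE add0r. Qed.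
Fact pres_addN : left_inverse pres_zero pres_opp pres_add.
Proof. by elim/presAlg_ind=> ?; rewrite pres_oppE pres_addE addNr. Qed.
HB.instance Definition _ :=
  GRing.isZmodule.Build presAlg pres_addA pres_addC pres_add0 pres_addN.

Fact pres_mulA : associative pres_mul.
Proof. by do 3!elim/presAlg_ind=> ?; rewrite !pres_mulE mulrA. Qed.
Fact pres_mul1 : left_id pres_one pres_mul.
Proof. by elim/presAlg_ind=> ?; rewrite pres_mulE mul1r. Qed.
Fact pres_mulr1 : right_id pres_one pres_mul.
Proof. by elim/presAlg_ind=> ?; rewrite pres_mulE mulr1. Qed.
Fact pres_mulDl : left_distributive pres_mul pres_add.
Proof.
by do 3!elim/presAlg_ind=> ?; rewrite !(pres_addE, pres_mulE) mulrDl.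
Qed.
Fact pres_mulDr : right_distributive pres_mul pres_add.
Proof.
by do 3!elim/presAlg_ind=> ?; rewrite !(pres_addE, pres_mulE) mulrDr.
Qed.
HB.instance Definition _ := GRing.Zmodule_isPzRing.Build presAlg
  pres_mulA pres_mul1 pres_mulr1 pres_mulDl pres_mulDr.

Fact pres_scaleA k l x : pres_scale k (pres_scale l x) = pres_scale (k * l) x.
Proof. by elim/presAlg_ind: x => ?; rewrite !pres_scaleE scalerA. Qed.
Fact pres_scale1 : left_id 1 pres_scale.
Proof. by elim/presAlg_ind=> ?; rewrite pres_scaleE scale1r. Qed.
Fact pres_scaleDr : right_distributive pres_scale pres_add.
Proof.
by move=> k; do 2!elim/presAlg_ind=> ?; rewrite !(pres_addE, pres_scaleE) scalerDr.
Qed.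
Fact pres_scaleDl x : {morph pres_scale^~ x : k l / k + l >-> pres_add k l}.
Proof.
by move=> k l; elim/presAlg_ind: x => ?; rewrite !pres_scaleE pres_addE scalerDl.
Qed.
HB.instance Definition _ := GRing.Zmodule_isLmodule.Build K presAlg
  pres_scaleA pres_scale1 pres_scaleDr pres_scaleDl.

Lemma pres_piD a b : pres_pi (a + b) = pres_pi a + pres_pi b.
Proof. exact/esym/pres_addE. Qed.
Lemma pres_piM a b : pres_pi (a * b) = pres_pi a * pres_pi b.
Proof. exact/esym/pres_mulE. Qed.
Lemma pres_piZ k a : pres_pi (k *: a) = k *: pres_pi a.
Proof. exact/esym/pres_scaleE. Qed.
Lemma pres_piN a : pres_pi (- a) = - pres_pi a.
Proof. exact/esym/pres_oppE. Qed.
Lemma pres_pi0 : pres_pi 0 = 0. Proof. by []. Qed.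
Lemma pres_pi1 : pres_pi 1 = 1. Proof. by []. Qed.

Lemma pres_scalerAl (k : K) (x y : presAlg) : k *: (x * y) = (k *: x) * y.
Proof.
elim/presAlg_ind: x => a; elim/presAlg_ind: y => b.
rewrite /GRing.scale /GRing.mul /= !(pres_mulE, pres_scaleE).
by rewrite scalerAl.
Qed.

Lemma pres_scalerAr (k : K) (x y : presAlg) : k *: (x * y) = x * (k *: y).
Proof.
elim/presAlg_ind: x => a; elim/presAlg_ind: y => b.
rewrite /GRing.scale /GRing.mul /= !(pres_mulE, pres_scaleE).
by rewrite malg_scalerAr.
Qed.

Definition pres_gen (t : T) : presAlg := pres_pi (fgen K t).

End PresentedAlgebraTheory.

(* The algebra morphism K<T>/(R) -> K<T'>/(R') sending each generator t to   *)
(* the class of f t. It is meaningful when f maps R into the ideal of R'.    *)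
Section PresentedMorphism.
Context (K : fieldType) (T T' : choiceType).
Context (R : freeAlg K T -> Prop) (R' : freeAlg K T' -> Prop).
Context (f : T -> freeAlg K T').

Definition mon_eval (m : {fmonom T}) : freeAlg K T' :=
  \prod_(t <- (m : seq T)) f t.

Lemma mon_eval_mmorphism : mmorphism mon_eval.
Proof.
split=> [m1 m2|]; rewrite /mon_eval; first by rewrite fmM big_cat.
by rewrite fm1 big_nil.
Qed.
HB.instance Definition _ :=
  isMultiplicative.Build {fmonom T} (freeAlg K T') mon_eval mon_eval_mmorphism.

Definition free_hom (a : freeAlg K T) : freeAlg K T' :=
  mmap (@malgC _ K) mon_eval a.

Definition pres_hom (x : presAlg R) : presAlg R' :=
  pres_pi R' (free_hom (repr x)).

Lemma free_homD a b : free_hom (a + b) = free_hom a + free_hom b.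
Proof. exact: raddfD. Qed.

Lemma free_homN a : free_hom (- a) = - free_hom a.
Proof. exact: raddfN. Qed.

Lemma free_homZ k a : free_hom (k *: a) = k *: free_hom a.
Proof. by rewrite /free_hom mmapZ mul_malgC. Qed.

Lemma free_hom1 : free_hom 1 = 1.
Proof. exact: mmap1. Qed.

Lemma free_homC (k : K) : free_hom k%:MP = k%:MP.
Proof. exact: mmapC. Qed.

Lemma free_homM a b : free_hom (a * b) = free_hom a * free_hom b.
Proof.
apply: (commr_mmap_is_multiplicative _).1 => g m m' /=.
have ->: (g@_m)%:MP = g@_m *: 1 :> freeAlg K T' by rewrite -mul_malgC mulr1.
by rewrite /GRing.comm -scalerAl -malg_scalerAr mul1r mulr1.
Qed.

Lemma free_hom_gen t : free_hom (fgen K t) = f t.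
Proof.
by rewrite /free_hom /fgen mmapU mul1r /= /mon_eval fmU big_seq1.
Qed.

Lemma free_hom_lin k p q r :
  free_hom (fgen K p - (k *: fgen K q + fgen K r)) = f p - (k *: f q + f r).
Proof.
by rewrite free_homD free_homN free_homD free_homZ !free_hom_gen.
Qed.

Lemma free_hom_mul p q r :
  free_hom (fgen K p * fgen K q - fgen K r) = f p * f q - f r.
Proof. by rewrite free_homD free_homN free_homM !free_hom_gen. Qed.

Lemma free_hom_sym p q k :
  free_hom (fgen K p * fgen K q + fgen K q * fgen K p - k%:MP)
    = f p * f q + f q * f p - k%:MP.
Proof.
have E r r' : free_hom (fgen K r * fgen K r') = f r * f r'.
  exact: etrans (free_homM _ _) (congr2 _ (free_hom_gen r) (free_hom_gen r')).
have -> := free_homD (fgen K p * fgen K q + fgen K q * fgen K p) (- k%:MP).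
apply: congr2; last by rewrite free_homN free_homC.
exact: etrans (free_homD _ _) (congr2 _ (E p q) (E q p)).
Qed.

Lemma free_hom_one p : free_hom (fgen K p - 1) = f p - 1.
Proof. by rewrite free_homD free_homN free_hom1 free_hom_gen. Qed.

Hypothesis fP : forall r, R r -> two_sided_ideal R' (free_hom r).

Lemma free_hom_ideal a :
  two_sided_ideal R a -> two_sided_ideal R' (free_hom a).
Proof.
elim=> [r /fP //||a1 b1 _ Ia _ Ib|a1 b1 _ Ib|a1 b1 _ Ia].
- by rewrite -(scale0r 0) free_homZ scale0r; apply: ideal_0.
- by rewrite free_homD; apply: ideal_D.
- by rewrite free_homM; apply: ideal_Ml.
- by rewrite free_homM; apply: ideal_Mr.
Qed.

Lemma pres_hom_pi a : pres_hom (pres_pi R a) = pres_pi R' (free_hom a).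
Proof.
apply/pres_piP; rewrite -free_homN -free_homD.
exact/free_hom_ideal/pres_repr_pi.
Qed.

Lemma pres_hom_gen t : pres_hom (pres_gen R t) = pres_pi R' (f t).
Proof. by rewrite pres_hom_pi free_hom_gen. Qed.

Lemma pres_homD x y : pres_hom (x + y) = pres_hom x + pres_hom y.
Proof.
elim/presAlg_ind: x => a; elim/presAlg_ind: y => b.
by rewrite -pres_piD !pres_hom_pi free_homD pres_piD.
Qed.

Lemma pres_homZ k x : pres_hom (k *: x) = k *: pres_hom x.
Proof.
by elim/presAlg_ind: x => a; rewrite -pres_piZ !pres_hom_pi free_homZ pres_piZ.
Qed.

Lemma pres_homM x y : pres_hom (x * y) = pres_hom x * pres_hom y.
Proof.
elim/presAlg_ind: x => a; elim/presAlg_ind: y => b.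
by rewrite -pres_piM !pres_hom_pi free_homM pres_piM.
Qed.

Lemma pres_hom1 : pres_hom 1 = 1.
Proof. by rewrite -pres_pi1 pres_hom_pi free_hom1. Qed.

End PresentedMorphism.

(* Subalgebra generated by X (presAlg may be the zero ring, so that it is   *)
(* not an lalgType and subalg_closed does not apply).                       *)
Definition generated_subalgebra (K : fieldType) (T : choiceType)
    (R : freeAlg K T -> Prop) (X : set (presAlg R)) : set (presAlg R) :=
  [set a | forall S : {pred presAlg R},
     mulr_closed S -> linear_closed S -> (forall b, X b -> b \in S) -> a \in S].

(* Tensor product of algebras, presented by the pure tensors a (x) b, their  *)
(* bilinearity, and (a (x) b) (a' (x) b') = aa' (x) bb', 1 (x) 1 = 1.        *)

Section TensorProduct.
Context (K : fieldType) (T1 T2 : choiceType).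
Context (R1 : freeAlg K T1 -> Prop) (R2 : freeAlg K T2 -> Prop).
Local Notation P := (presAlg R1 * presAlg R2)%type.
Local Notation X a b := (fgen K ((a, b) : P)).

Inductive tensor_rel : freeAlg K P -> Prop :=
| tensor_linl k a a' b :
    tensor_rel (X (k *: a + a') b - (k *: X a b + X a' b))
| tensor_linr k a b b' :
    tensor_rel (X a (k *: b + b') - (k *: X a b + X a b'))
| tensor_mul a a' b b' :
    tensor_rel (X a b * X a' b' - X (a * a') (b * b'))
| tensor_one : tensor_rel (X 1 1 - 1).

Definition tensorAlg := presAlg tensor_rel.
Definition tensor (a : presAlg R1) (b : presAlg R2) : tensorAlg :=
  pres_gen tensor_rel (a, b).

(* id (x) theta, for an algebra endomorphism theta of the right factor       *)
Definition tensor_mapr (theta : presAlg R2 -> presAlg R2) :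
    tensorAlg -> tensorAlg :=
  pres_hom (R := tensor_rel) tensor_rel (fun p => X p.1 (theta p.2)).

Lemma tensor_maprP (theta : presAlg R2 -> presAlg R2) :
  (forall k a b, theta (k *: a + b) = k *: theta a + theta b) ->
  (forall a b, theta (a * b) = theta a * theta b) -> theta 1 = 1 ->
  forall r, tensor_rel r ->
    two_sided_ideal tensor_rel (free_hom (fun p => X p.1 (theta p.2)) r).
Proof.
move=> thL thM th1 r [k a a' b|k a b b'|a a' b b'|].
- by rewrite free_hom_lin; apply/ideal_rel/tensor_linl.
- by rewrite free_hom_lin /= thL; apply/ideal_rel/tensor_linr.
- by rewrite free_hom_mul /= thM; apply/ideal_rel/tensor_mul.
- by rewrite free_hom_one /= th1; apply/ideal_rel/tensor_one.
Qed.

End TensorProduct.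

Section OrthogonalSpace.
Context (C : numClosedFieldType) (V : vectType C) (B : {symmetric V}).
Local Notation V' := 'Hom(V, C^o).
Implicit Types (u v : V) (x : V') (g s : 'End(V)).

Definition beta : 'Hom(V, V') := linfun (fun u : V => linfun (B u : V -> C^o)).

(* (_^-1)%VF is the two-sided inverse of beta when B is non-degenerate.      *)
Definition beta_inv x : V := (beta^-1)%VF x.

Definition dual_form (x1 x2 : V') : C := B (beta_inv x1) (beta_inv x2).

Definition coroot x : V := (2 / dual_form x x) *: beta_inv x.

Definition contragredient g x : V' := (x \o g^-1)%VF.

Definition orthogonal_map g : Prop := forall u v, B (g u) (g v) = B u v.

(* g fixes a hyperplane pointwise; for g in O(V, B) it is then -1 on a line. *)
Definition is_reflection g : bool :=
  (\dim (fixedSpace g)).+1 == \dim {:V}.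

(* The last field says that G preserves a real form of V: in some basis of V *)
(* all its elements have real matrices.                                      *)
Record real_reflection_group (G : {fset 'End(V)}) : Prop :=
  RealReflectionGroup {
    refl_group_orthogonal : {in G, forall g, orthogonal_map g};
    refl_group_id : \1%VF \in G;
    refl_group_comp : {in G &, forall g h, (g \o h)%VF \in G};
    refl_group_inv : {in G, forall g, (g^-1)%VF \in G};
    refl_group_generated : {in G, forall g, exists2 ss : seq 'End(V),
      {in ss, forall s, s \in G /\ is_reflection s} &
      g = foldr (fun s h => (s \o h)%VF) \1%VF ss};
    refl_group_real : exists2 b : (\dim {:V}).-tuple V, basis_of fullv b &
      {in G, forall g i j, coord b i (g b`_j) \is Num.real} }.

Lemma betaE u v : beta u v = B u v.
Proof.
pose f u : V -> C^o := B u.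
have linf w : linear (f w) by move=> k a b; rewrite /f linearPr.
have E w a : linfun (f w) a = B w a.
  pose M := GRing.isLinear.Build _ _ _ _ (f w) (linf w).
  pose L : {linear V -> C^o} := HB.pack (f w) M.
  exact: (lfunE L a).
have linE : linear (fun w => linfun (f w)).
  move=> k a b; apply/lfunP=> c.
  by rewrite add_lfunE scale_lfunE !E linearPl.
pose M := GRing.isLinear.Build _ _ _ _ (fun w => linfun (f w)) linE.
pose L : {linear V -> V'} := HB.pack (fun w => linfun (f w)) M.
by rewrite /beta; have -> := lfunE L u; apply: E.
Qed.

Hypothesis ndB : nondegenerate B.

Lemma beta_inj : lker beta == 0%VS.
Proof.
rewrite -subv0; apply/subvP=> u; rewrite memv_ker => /eqP bu0.
rewrite -(eqP ndB); apply/mem_orthovP=> v _.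
by rewrite -betaE bu0 zero_lfunE.
Qed.

Lemma betaK u : beta_inv (beta u) = u.
Proof. exact: lker0_lfunK beta_inj u. Qed.

Lemma beta_invK x : beta (beta_inv x) = x.
Proof.
apply: limg_lfunVK; suff -> : limg beta = fullv by apply: memvf.
apply/eqP; rewrite eqEdim subvf /= limg_dim_eq; last first.
  by rewrite (eqP beta_inj) capv0.
by rewrite !dimvf /dim /= muln1.
Qed.

End OrthogonalSpace.

Section CherednikClifford.
Context (C : numClosedFieldType) (V : vectType C) (B : {symmetric V}).
Context (G : {fset 'End(V)}) (kappa : 'End(V) -> C).
Context (alpha : 'End(V) -> 'Hom(V, C^o)).
Local Notation V' := 'Hom(V, C^o).
Implicit Types (x u v : V') (y z : V) (g h : G).

Definition cherednik_index := (V + V' + G)%type.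
Local Notation genV y := (fgen C (inl (inl y) : cherednik_index)).
Local Notation genV' x := (fgen C (inl (inr x) : cherednik_index)).
Local Notation genG g := (fgen C (inr g : cherednik_index)).

(* The first six families present T(V (+) V* ) x| G.                         *)
Inductive cherednik_rel : freeAlg C cherednik_index -> Prop :=
| cherednik_linV (k : C) y z :
    cherednik_rel (genV (k *: y + z) - (k *: genV y + genV z))
| cherednik_linV' (k : C) x u :
    cherednik_rel (genV' (k *: x + u) - (k *: genV' x + genV' u))
| cherednik_one g : val g = \1%VF -> cherednik_rel (genG g - 1)
| cherednik_mul (g h gh : G) : val gh = (val g \o val h)%VF ->
    cherednik_rel (genG g * genG h - genG gh)
| cherednik_actV g y :
    cherednik_rel (genG g * genV y - genV (val g y) * genG g)
| cherednik_actV' g x :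
    cherednik_rel (genG g * genV' x - genV' (contragredient (val g) x) * genG g)
| cherednik_commV y z : cherednik_rel (genV y * genV z - genV z * genV y)
| cherednik_commV' x u : cherednik_rel (genV' x * genV' u - genV' u * genV' x)
| cherednik_comm y x :
    cherednik_rel (genV y * genV' x - genV' x * genV y -
      ((x y : C)%:MP + \sum_(s : G | is_reflection (val s))
         (alpha (val s) y * x (coroot B (alpha (val s))) * kappa (val s))
           *: genG s)).

Definition cherednikAlg := presAlg cherednik_rel.
Definition cherednik_V y : cherednikAlg :=
  pres_gen cherednik_rel (inl (inl y)).
Definition cherednik_V' x : cherednikAlg :=
  pres_gen cherednik_rel (inl (inr x)).
Definition cherednik_G g : cherednikAlg := pres_gen cherednik_rel (inr g).

Inductive clifford_rel : freeAlg C V' -> Prop :=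
| clifford_lin (k : C) u v :
    clifford_rel (fgen C (k *: u + v) - (k *: fgen C u + fgen C v))
| clifford_sq u v :
    clifford_rel (fgen C u * fgen C v + fgen C v * fgen C u
                  - (2 * dual_form B u v)%:MP).

Definition cliffordAlg := presAlg clifford_rel.
Definition gamma u : cliffordAlg := pres_gen clifford_rel u.

(* The grading automorphism: the algebra morphism with gamma u |-> - gamma u. *)
Definition clifford_parity : cliffordAlg -> cliffordAlg :=
  pres_hom (R := clifford_rel) clifford_rel (fun u => - fgen C u).

Lemma clifford_parityP r : clifford_rel r ->
  two_sided_ideal clifford_rel (free_hom (fun u => - fgen C u) r).
Proof.
case=> [k u v|u v]; first rewrite free_hom_lin.
  rewrite scalerN -!opprD; apply/ideal_N/ideal_rel; exact: clifford_lin.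
rewrite free_hom_sym.
have E : (- fgen C u) * (- fgen C v) + (- fgen C v) * (- fgen C u)
    = fgen C u * fgen C v + fgen C v * fgen C u.
  exact: congr2 (mulrNN _ _) (mulrNN _ _).
pose Q (z : freeAlg C V') :=
  two_sided_ideal clifford_rel (z - (2 * dual_form B u v)%:MP).
exact: (@eq_ind_r _ _ Q (ideal_rel (clifford_sq u v)) _ E).
Qed.

Lemma clifford_parity_gamma u : clifford_parity (gamma u) = - gamma u.
Proof. by rewrite /clifford_parity (pres_hom_gen clifford_parityP) pres_piN. Qed.

Definition A_kappa := tensorAlg cherednik_rel clifford_rel.
Definition tens (h : cherednikAlg) (c : cliffordAlg) : A_kappa := tensor h c.

(* The grading automorphism of A_kappa, with H_kappa even.                   *)
Definition parity : A_kappa -> A_kappa := tensor_mapr clifford_parity.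

Lemma parityP r : tensor_rel r ->
  two_sided_ideal (tensor_rel (R1 := cherednik_rel) (R2 := clifford_rel))
    (free_hom (fun p => fgen C (p.1, clifford_parity p.2)) r).
Proof.
apply: tensor_maprP => [k a b|a b|]; rewrite /clifford_parity.
- by rewrite (pres_homD clifford_parityP) (pres_homZ clifford_parityP).
- exact: (pres_homM clifford_parityP).
- exact: (pres_hom1 clifford_parityP).
Qed.

Lemma parity_tens (h : cherednikAlg) (c : cliffordAlg) :
   parity (tens h c) = tens h (clifford_parity c).
Proof. exact: (pres_hom_gen parityP). Qed.

Lemma parityD a b : parity (a + b) = parity a + parity b.
Proof. exact: (pres_homD parityP). Qed.

Lemma parityZ k a : parity (k *: a) = k *: parity a.
Proof. exact: (pres_homZ parityP). Qed.

Lemma parityM a b : parity (a * b) = parity a * parity b.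
Proof. exact: (pres_homM parityP). Qed.

(* The component of degree i, with true for odd: the projection onto the     *)
(* (-1)^i-eigenspace of parity.                                              *)
Definition hcomp (i : bool) (a : A_kappa) : A_kappa :=
  2^-1 *: (a + (-1) ^+ i *: parity a).

(* The bilinear extension of [a, b] = ab - (-1)^(|a||b|) ba; see scomm_homog. *)
Definition scomm (a b : A_kappa) : A_kappa :=
  \sum_(i : bool) \sum_(j : bool)
    (hcomp i a * hcomp j b - (-1) ^+ (i * j)%N *: (hcomp j b * hcomp i a)).

Lemma scomm_homog i j a b :
  parity a = (-1) ^+ nat_of_bool i *: a ->
  parity b = (-1) ^+ nat_of_bool j *: b ->
  scomm a b = a * b - (-1) ^+ (i * j)%N *: (b * a).
Proof.
have hcE (l m : bool) c : parity c = (-1) ^+ nat_of_bool l *: c ->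
    hcomp m c = if l == m then c else 0.
  move=> Ec; rewrite /hcomp Ec scalerA -{1}[c]scale1r -scalerDl scalerA -signr_addb.
  case: l m {Ec} => [] [] /=; rewrite ?expr0 ?expr1 ?subrr ?mulr0 ?scale0r //.
    by rewrite mulVf ?scale1r // pnatr_eq0.
  by rewrite mulVf ?scale1r // pnatr_eq0.
move=> Ea Eb; rewrite /scomm.
rewrite (bigD1 i) //= [X in _ + X]big1 => [|i' ni]; last first.
  rewrite big1 // => j' _; rewrite (hcE i) // eq_sym (negPf ni).
  by rewrite mul0r mulr0 scaler0 subr0.
rewrite addr0 (bigD1 j) //= [X in _ + X]big1 => [|j' nj]; last first.
  by rewrite (hcE j j') // eq_sym (negPf nj) mul0r mulr0 scaler0 subr0.
by rewrite addr0 (hcE i i a Ea) (hcE j j b Eb) !eqxx.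
Qed.

Section Realization.
Context (d : nat) (xb : 'I_d -> V') (yb : 'I_d -> V).
Local Notation e j := (gamma (xb j)).

Definition Fplus : A_kappa :=
  (sqrtC 2)^-1 *: \sum_(j < d) tens (cherednik_V' (xb j)) (e j).
Definition Fminus : A_kappa :=
  (sqrtC 2)^-1 *: \sum_(j < d) tens (cherednik_V (yb j)) (e j).
Definition Hcartan : A_kappa :=
  tens (\sum_(j < d) cherednik_V' (xb j) * cherednik_V (yb j)
        + (d%:R / 2) *: (1 : cherednikAlg)
        + \sum_(s : G | is_reflection (val s)) kappa (val s) *: cherednik_G s) 1.
Definition Eplus : A_kappa :=
  tens (2^-1 *: \sum_(j < d) cherednik_V' (xb j) ^+ 2) 1.
Definition Eminus : A_kappa :=
  tens (- 2^-1 *: \sum_(j < d) cherednik_V (yb j) ^+ 2) 1.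

Definition osp12 : set A_kappa :=
  [set b | exists k1 k2 k3 k4 k5 : C, b = k1 *: Fplus + k2 *: Fminus
     + k3 *: Hcartan + k4 *: Eplus + k5 *: Eminus].

Definition supercentralizer (S : set A_kappa) : set A_kappa :=
  [set a | forall b, S b -> scomm a b = 0].

Definition Pplus (a : A_kappa) : A_kappa := a - scomm Fminus (scomm Fplus a).
Definition Pminus (a : A_kappa) : A_kappa := a + scomm Fplus (scomm Fminus a).

Definition antisym (n : nat) (u : n.-tuple V') : cliffordAlg :=
  (n`!%:R)^-1 *: \sum_(sigma : 'S_n)
     (-1) ^+ sigma *: \prod_(i < n) gamma (tnth u (sigma i)).

(* Pminus would give the same element: since [H, c] = 0 for c in the Clifford *)
(* algebra, Pplus and Pminus agree there.                                    *)
Definition Osym (n : nat) (u : n.-tuple V') : A_kappa :=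
  - 2^-1 *: Pplus (tens 1 (antisym u)).

End Realization.

Definition reflection_along (u : V') : 'End(V) :=
  linfun (fun v : V => v - (u v : C) *: coroot B u).

(* The graph of the double cover p : Pin -> O, that is, of the homomorphism   *)
(* sending gamma u to the reflection along u when B(u, u) = 1.                *)
Definition pin_cover (c : cliffordAlg) (g : 'End(V)) : Prop :=
  exists us : seq V', [/\ {in us, forall u, dual_form B u u = 1},
    c = \prod_(u <- us) gamma u &
    g = foldr (fun u f => (reflection_along u \o f)%VF) \1%VF us].

(* rho(G~), where G~ = p^-1(G) and rho(c) = p(c) (x) c.                       *)
Definition rho_Gtilde : set A_kappa :=
  [set a | exists (c : cliffordAlg) (g : G),
     pin_cover c (val g) /\ a = tens (cherednik_G g) c].

End CherednikClifford.

Arguments osp12 {C V} B {G} kappa alpha {d} xb yb.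
Arguments Osym {C V} B {G} kappa alpha {d} xb yb {n} u.
Arguments rho_Gtilde {C V} B {G} kappa alpha.

(* Main.v *)
(* The commutator action of sl_2 = <E+, E-> on A_kappa is by derivations, and each   *)
(* pair x_u, y_u spans a copy of its two-dimensional representation, while G and the *)
(* Clifford algebra are fixed. On words of length n in these letters the Casimir is  *)
(* n(n+2), up to shorter words and left multiples of the 2 x 2 minors                *)
(* M_uv = x_u y_v - x_v y_u. Hence the product of the operators Casimir - j(j+2),    *)
(* 0 < j <= n, maps words of length n to the span of the products of minors with     *)
(* elements of G and of the Clifford algebra, and it is a nonzero scalar on the      *)
(* invariants: this describes the centralizer of sl_2, without a PBW theorem.        *)
(*                                                                                   *)
(* The map P_+ is the identity on the supercentralizer of osp(1|2), is left linear   *)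
(* over it, and maps the Clifford algebra into it. Let S be generated by rho(G~) and *)
(* the O_uv and O_uvw. Since P_+(gamma_u gamma_v) is -2 M_uv up to Clifford elements *)
(* and products of elements of rho(G~) with Clifford elements, the centralizer of    *)
(* sl_2 lies in S times the Clifford algebra, so it remains to see that P_+ maps the *)
(* Clifford algebra into S. For c of degree N, expanding P_+(P_+(c)) = P_+(c) gives  *)
(* N (N - 3) P_+(c) in terms of S and of P_+ in lower degree, which is an induction  *)
(* for N > 3; for N = 2 and N = 3 these are the given generators.                    *)

From HB Require Import structures.
Require Import Defs.
From mathcomp Require Import all_boot all_order all_algebra.
From mathcomp Require Import fingroup perm ring.
From mathcomp Require Import finmap boolp classical_sets reals complex.
From mathcomp.multinomials Require Import monalg.

Set Implicit Arguments.
Unset Strict Implicit.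
Unset Printing Implicit Defensive.

Import GRing.Theory Num.Theory.
Local Open Scope classical_set_scope.
Local Open Scope ring_scope.

(** Write S for the subalgebra generated by rho(G~) and the O_uv, O_uvw, Cl for the Clifford algebra
    and P = P_+ ([proj]). That S lies in the supercentralizer is checked on generators: [cent_lift]
    for pin lifts, [cent_proj] for P of Clifford elements.

    Conversely, an element a of the supercentralizer commutes with E^+ and E^- ([cent_raise2],
    [cent_lower2]), satisfies P(a) = a ([proj_cent]), and P is left linear over the supercentralizer
    ([projM]). So it is enough to show that (1) the centralizer of E^+, E^- lies in S Cl, and (2)
    P(Cl) lies in S; then a = P(a) lies in S P(Cl), hence in S.

    For (1), filter the algebra by the number of letters x_u, y_u. The Casimir of sl_2 acts on words
    of length n as n(n+2), modulo shorter words and left multiples of the minors M_uv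
    ([casimir_wfilt]). A product of shifted Casimirs therefore sends everything to products of
    minors with coefficients, and it rescales each invariant by a nonzero number
    ([sl2_invariant_span]). Finally [proj_gam2] expresses M_uv through P(gamma_u gamma_v), Clifford
    elements and reflections, and a group element is a pin lift times a Clifford element, which
    gives [cl_span_minor].

    For (2), [proj_cl] computes P(c) through Clifford contractions, and [gen_proj_cl] is an
    induction on the degree N of c. Degree 1 gives only reflection terms; degrees 2 and 3 are the
    generators O_uv and O_uvw modulo lower degree; for N > 3 the identity P(P(c)) = P(c) determines
    4 N (N - 3) P(c) modulo S ([gen_proj_step]).

    All this takes place in an algebra given only by its relations. The last part checks the
    relations in A_kappa, with V* identified with V through [beta] and the roots rescaled to unit
    length. *)

Inductive nc_expr (K : Type) :=
| NCvar of nat | NC0 | NC1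
| NCadd of nc_expr K & nc_expr K | NCopp of nc_expr K
| NCmul of nc_expr K & nc_expr K | NCscale of K & nc_expr K.
Arguments NC0 {K}. Arguments NC1 {K}. Arguments NCvar {K}.

(** * Normal forms in noncommutative algebras, by reflection *)

Section NoncommutativeNormalForm.
Context (K : fieldType) (T : choiceType) (R : freeAlg K T -> Prop).
Local Notation A := (presAlg R).
Implicit Types (e : nc_expr K) (env : seq A) (l : seq (K * seq nat)).

Fixpoint nc_eval env e : A :=
  match e with
  | NCvar i => nth 0 env i
  | NC0 => 0
  | NC1 => 1
  | NCadd a b => nc_eval env a + nc_eval env b
  | NCopp a => - nc_eval env a
  | NCmul a b => nc_eval env a * nc_eval env b
  | NCscale k a => k *: nc_eval env a
  end.

Fixpoint nc_catmap (c : K * seq nat -> seq (K * seq nat)) l :=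
  if l is p :: l' then c p ++ nc_catmap c l' else [::].

Fixpoint nc_norm e : seq (K * seq nat) :=
  match e with
  | NCvar i => [:: (1, [:: i])]
  | NC0 => [::]
  | NC1 => [:: (1, [::])]
  | NCadd a b => nc_norm a ++ nc_norm b
  | NCopp a => map (fun p => (- p.1, p.2)) (nc_norm a)
  | NCmul a b => let lb := nc_norm b in
      nc_catmap (fun p => map (fun q => (p.1 * q.1, p.2 ++ q.2)) lb) (nc_norm a)
  | NCscale k a => map (fun p => (k * p.1, p.2)) (nc_norm a)
  end.

(** Dedicated comparison functions let the tactic unfold the bookkeeping with [cbv] while the
    coefficient arithmetic in K stays folded for [ring]. *)
Fixpoint nc_eqn m n :=
  match m, n with 0, 0 => true | S m', S n' => nc_eqn m' n' | _, _ => false end.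

Fixpoint nc_eqs s t :=
  match s, t with
  | [::], [::] => true
  | m :: s', n :: t' => if nc_eqn m n then nc_eqs s' t' else false
  | _, _ => false
  end.

Fixpoint nc_insert (k : K) (w : seq nat) l :=
  if l is (k', w') :: l' then
    if nc_eqs w w' then (k + k', w') :: l' else (k', w') :: nc_insert k w l'
  else [:: (k, w)].

Fixpoint nc_collect l :=
  if l is (k, w) :: l' then nc_insert k w (nc_collect l') else [::].

Fixpoint nc_all0 l : Prop :=
  match l with
  | [::] => True
  | [:: (k, _)] => k = 0
  | (k, _) :: l' => k = 0 /\ nc_all0 l'
  end.

Definition nc_word env (w : seq nat) : A := \prod_(i <- w) nth 0 env i.
Definition nc_sum env l : A := \sum_(p <- l) p.1 *: nc_word env p.2.

Lemma nc_eqsP s t : nc_eqs s t -> s = t.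
Proof.
have eqnP m n : nc_eqn m n -> m = n.
  by elim: m n => [|m IH] [|n] //= /IH ->.
elim: s t => [|m s IH] [|n t] //=.
by case: ifP => // /eqnP -> /IH ->.
Qed.

Lemma nc_normE env e : nc_eval env e = nc_sum env (nc_norm e).
Proof.
rewrite /nc_sum; elim: e => [i|||a IHa b IHb|a IHa|a IHa b IHb|k a IHa] /=;
  rewrite ?IHa ?IHb.
- by rewrite big_seq1 /nc_word /= big_seq1 scale1r.
- by rewrite big_nil.
- by rewrite big_seq1 /nc_word /= big_nil scale1r.
- by rewrite big_cat.
- rewrite -sumrN big_map; apply: eq_bigr => p _ /=; by rewrite scaleNr.
- elim: (nc_norm a) => [|p l IH] /=; first by rewrite !big_nil mul0r.
  rewrite big_cons big_cat mulrDl IH big_map; congr (_ + _).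
  rewrite mulr_sumr; apply: eq_bigr => q _ /=.
  by rewrite -pres_scalerAl -pres_scalerAr scalerA /nc_word big_cat.
- rewrite scaler_sumr big_map; apply: eq_bigr => p _ /=; by rewrite scalerA.
Qed.

Lemma nc_collectE env l : nc_sum env (nc_collect l) = nc_sum env l.
Proof.
rewrite /nc_sum; elim: l => [|[k w] l IH] //=; rewrite big_cons -IH.
elim: (nc_collect l) => [|[k' w'] l' IH'] /=; first by rewrite big_seq1 big_nil addr0.
case: ifP => [/nc_eqsP ->|_]; rewrite !big_cons /=; first by rewrite scalerDl addrA.
by rewrite IH' addrCA.
Qed.

Lemma nc_all0P env l : nc_all0 l -> nc_sum env l = 0.
Proof.
rewrite /nc_sum; elim: l => [|[k w] l IH]; first by rewrite big_nil.
rewrite big_cons /=; case: l IH => [_ ->|p l IH [-> /IH ->]].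
  by rewrite big_nil scale0r addr0.
by rewrite scale0r addr0.
Qed.

Lemma nc_reflect env e1 e2 :
  nc_all0 (nc_collect (nc_norm (NCadd e1 (NCopp e2)))) ->
  nc_eval env e1 = nc_eval env e2.
Proof.
move=> /(nc_all0P env); rewrite nc_collectE -nc_normE /=.
by move/eqP; rewrite subr_eq0 => /eqP.
Qed.

Lemma natmul_scale (a : A) n : a *+ n = n%:R *: a.
Proof. by rewrite scaler_nat. Qed.

End NoncommutativeNormalForm.

Ltac nc_index x l :=
  match l with
  | x :: _ => constr:(O)
  | _ :: ?l' => let n := nc_index x l' in constr:(S n)
  end.

Ltac nc_has x l :=
  match l with
  | x :: _ => constr:(true)
  | _ :: ?l' => nc_has x l'
  | _ => constr:(false)
  end.

Ltac nc_atoms t l :=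
  match t with
  | GRing.add ?a ?b => let l := nc_atoms a l in nc_atoms b l
  | GRing.mul ?a ?b => let l := nc_atoms a l in nc_atoms b l
  | GRing.opp ?a => nc_atoms a l
  | GRing.scale _ ?a => nc_atoms a l
  | @GRing.zero _ => l
  | @GRing.one _ => l
  | _ => match nc_has t l with
         | true => l
         | false => constr:(t :: l)
         end
  end.

Ltac nc_reify K t l :=
  match t with
  | GRing.add ?a ?b =>
      let a := nc_reify K a l in let b := nc_reify K b l in constr:(NCadd a b)
  | GRing.mul ?a ?b =>
      let a := nc_reify K a l in let b := nc_reify K b l in constr:(NCmul a b)
  | GRing.opp ?a => let a := nc_reify K a l in constr:(NCopp a)
  | GRing.scale ?k ?a => let a := nc_reify K a l in constr:(NCscale (k : K) a)
  | @GRing.zero _ => constr:(@NC0 K)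
  | @GRing.one _ => constr:(@NC1 K)
  | _ => let n := nc_index t l in constr:(@NCvar K n)
  end.

(* Equalities in a noncommutative algebra over K, by expansion into words;    *)
(* the coefficients are compared by ring.                                    *)
Ltac ncring :=
  rewrite ?natmul_scale;
  lazymatch goal with
  | |- @eq _ ?a ?b =>
    let a := eval cbv beta in a in let b := eval cbv beta in b in
    change (@eq (presAlg _) a b)
  end;
  lazymatch goal with
  | |- @eq ?A ?a ?b =>
    lazymatch A with
    | @presAlg ?K ?T ?R =>
      let l := nc_atoms a (@nil A) in
      let l := nc_atoms b l in
      let e1 := nc_reify (GRing.Field.sort K) a l in
      let e2 := nc_reify (GRing.Field.sort K) b l in
      apply: (@nc_reflect K T R l e1 e2);
      cbv [nc_norm nc_collect nc_insert nc_catmap nc_eqs nc_eqn nc_all0 cat map fst snd];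
      repeat match goal with |- _ /\ _ => split end; try exact I; ring
    end
  end.

(** * Linear subspaces and linear maps, as predicates and unbundled functions *)

Section Subspace.
Context (K : fieldType) (T : choiceType) (R : freeAlg K T -> Prop).
Local Notation A := (presAlg R).

(** Kept in [Prop], so that inductively defined filtrations and spans are instances. *)
Definition subspace (P : A -> Prop) : Prop :=
  P 0 /\ forall k a b, P a -> P b -> P (k *: a + b).

Context (P : A -> Prop) (sP : subspace P).

Lemma subspace0 : P 0. Proof. by case: sP. Qed.
Lemma subspaceZ k a : P a -> P (k *: a).
Proof. by case: sP => P0 PL Pa; rewrite -[_ *: _]addr0; apply: PL. Qed.
Lemma subspaceD a b : P a -> P b -> P (a + b).
Proof. by case: sP => _ PL Pa Pb; rewrite -[a]scale1r; apply: PL. Qed.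
Lemma subspaceN a : P a -> P (- a).
Proof. by move=> Pa; rewrite -scaleN1r; apply: subspaceZ. Qed.
Lemma subspaceB a b : P a -> P b -> P (a - b).
Proof. by move=> Pa Pb; apply/subspaceD/subspaceN. Qed.
Lemma subspace_sum (I : Type) (r : seq I) (Q : pred I) (F : I -> A) :
  (forall i, Q i -> P (F i)) -> P (\sum_(i <- r | Q i) F i).
Proof.
move=> PF; elim/big_ind: _ => //; [exact: subspace0 | exact: subspaceD].
Qed.
End Subspace.

Section LinearMaps.
Context (K : fieldType) (T : choiceType) (R : freeAlg K T -> Prop).
Local Notation A := (presAlg R).

Lemma lin0 (W : lmodType K) (f : W -> A) :
  (forall k u v, f (k *: u + v) = k *: f u + f v) -> f 0 = 0.
Proof.
by move=> fL; have := fL (-1) 0 0; rewrite scaler0 addr0 scaleN1r addNr.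
Qed.

Lemma linZ (W : lmodType K) (f : W -> A) :
  (forall k u v, f (k *: u + v) = k *: f u + f v) ->
  forall k u, f (k *: u) = k *: f u.
Proof. by move=> fL k u; rewrite -[k *: u]addr0 fL lin0 // addr0. Qed.

Lemma linD (W : lmodType K) (f : W -> A) :
  (forall k u v, f (k *: u + v) = k *: f u + f v) ->
  forall u v, f (u + v) = f u + f v.
Proof. by move=> fL u v; rewrite -[u]scale1r fL !scale1r. Qed.

Lemma linN (W : lmodType K) (f : W -> A) :
  (forall k u v, f (k *: u + v) = k *: f u + f v) ->
  forall u, f (- u) = - f u.
Proof. by move=> fL u; rewrite -scaleN1r linZ // scaleN1r. Qed.

Lemma lin_sum (W : lmodType K) (f : W -> A) (J : Type) (s : seq J) (Q : pred J) (F : J -> W) :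
  (forall k u v, f (k *: u + v) = k *: f u + f v) ->
  f (\sum_(j <- s | Q j) F j) = \sum_(j <- s | Q j) f (F j).
Proof.
by move=> fL; elim/big_rec2: _ => [|j u v _ <-]; rewrite ?lin0 ?linD.
Qed.

Lemma fixed_sqr_sub (th : A -> A) : (forall k a b, th (k *: a + b) = k *: th a + th b) ->
  subspace (fun a => th (th a) = a).
Proof.
move=> thL; split=> [|k a b ea eb]; first by rewrite !(lin0 thL).
by rewrite !thL ea eb.
Qed.

Lemma fixed_sqrM (th : A -> A) a b : (forall a b, th (a * b) = th a * th b) ->
  th (th a) = a -> th (th b) = b -> th (th (a * b)) = a * b.
Proof. by move=> thM ea eb; rewrite !thM ea eb. Qed.

Lemma fixed_sqr_odd (th : A -> A) a : (forall k a b, th (k *: a + b) = k *: th a + th b) ->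
  th a = - a -> th (th a) = a.
Proof. by move=> thL ea; rewrite ea (linN thL) ea opprK. Qed.

Lemma fixed_sqr_even (th : A -> A) a : th a = a -> th (th a) = a.
Proof. by move=> ea; rewrite !ea. Qed.
End LinearMaps.

(** * Invariants of sl_2 *)

Section Sl2Invariants.
Context (K : numFieldType) (T : choiceType) (R : freeAlg K T -> Prop).
Local Notation A := (presAlg R).
Context (V : Type) (X Y : V -> A) (I : finType) (Tg : I -> A) (act : I -> V -> V).
Context (Ep Em : A) (Coef : A -> Prop).
Context (CoefL : subspace Coef).
Context (CoefT : forall i a, Coef a -> Coef (Tg i * a)).
Context (CoefE : forall a, Coef a -> a * Ep = Ep * a).
Context (CoefF : forall a, Coef a -> a * Em = Em * a).
Context (TX : forall i v, Tg i * X v = X (act i v) * Tg i).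
Context (TY : forall i v, Tg i * Y v = Y (act i v) * Tg i).
Context (XX : forall u v, X u * X v = X v * X u).
Context (YY : forall u v, Y u * Y v = Y v * Y u).
Context (YX : forall u v, exists c : I -> K,
  Y u * X v - X v * Y u = \sum_i c i *: Tg i).
Context (XE : forall v, X v * Ep = Ep * X v).
Context (YE : forall v, Y v * Ep = Ep * Y v + X v).
Context (FX : forall v, Em * X v = X v * Em + Y v).
Context (FY : forall v, Em * Y v = Y v * Em).

(** The signs are such that e sends y_v to x_v and f sends x_v to y_v: each pair is the standard
    two-dimensional representation, with weights 1 and -1. *)
Definition sl2e (a : A) := a * Ep - Ep * a.
Definition sl2f (a : A) := Em * a - a * Em.
Definition sl2h (a : A) := sl2e (sl2f a) - sl2f (sl2e a).
Definition casimir (a : A) :=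
  sl2h (sl2h a) + 2%:R *: (sl2e (sl2f a) + sl2f (sl2e a)).
(* On the symbols these are the 2 x 2 minors of the matrix with columns (x_u, y_u); *)
(* in H_kappa they are the Dunkl angular momentum operators.                       *)
Definition minor (u v : V) : A := X u * Y v - X v * Y u.

Local Notation e := sl2e.
Local Notation f := sl2f.
Local Notation h := sl2h.
Local Notation Om := casimir.
Local Notation M := minor.

Inductive wfilt : nat -> A -> Prop :=
| wfilt_coef a : Coef a -> wfilt 0 a
| wfilt0 n : wfilt n 0
| wfiltL n k a b : wfilt n a -> wfilt n b -> wfilt n (k *: a + b)
| wfiltX n v a : wfilt n a -> wfilt n.+1 (X v * a)
| wfiltY n v a : wfilt n a -> wfilt n.+1 (Y v * a)
| wfiltS n a : wfilt n a -> wfilt n.+1 a.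

(** The error terms allowed in degree n: left multiples of minors, and words shorter than n. *)
Inductive minor_part : nat -> A -> Prop :=
| minor_partM n u v a : wfilt n a -> minor_part n.+2 (M u v * a)
| minor_partS n a : wfilt n a -> minor_part n.+1 a
| minor_part0 n : minor_part n 0
| minor_partL n k a b : minor_part n a -> minor_part n b ->
    minor_part n (k *: a + b).

Inductive minor_span : A -> Prop :=
| minor_span_coef a : Coef a -> minor_span a
| minor_spanL k a b : minor_span a -> minor_span b -> minor_span (k *: a + b)
| minor_spanM u v a : minor_span a -> minor_span (M u v * a).

Lemma wfilt_sub n : subspace (wfilt n).
Proof. by split; [apply: wfilt0 | move=> *; apply: wfiltL]. Qed.
Lemma minor_part_sub n : subspace (minor_part n).
Proof. by split; [apply: minor_part0 | move=> *; apply: minor_partL]. Qed.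
Lemma minor_span_sub : subspace minor_span.
Proof.
by split; [apply/minor_span_coef/(subspace0 CoefL) | move=> *; apply: minor_spanL].
Qed.

Lemma sl2eL k a b : e (k *: a + b) = k *: e a + e b.
Proof. rewrite /sl2e; ncring. Qed.
Lemma sl2fL k a b : f (k *: a + b) = k *: f a + f b.
Proof. rewrite /sl2f; ncring. Qed.
Lemma sl2e0 : e 0 = 0. Proof. rewrite /sl2e; ncring. Qed.
Lemma sl2f0 : f 0 = 0. Proof. rewrite /sl2f; ncring. Qed.
Lemma sl2hL k a b : h (k *: a + b) = k *: h a + h b.
Proof. rewrite /sl2h !(sl2eL, sl2fL); ncring. Qed.
Lemma casimirL k a b : Om (k *: a + b) = k *: Om a + Om b.
Proof. rewrite /casimir !(sl2eL, sl2fL, sl2hL); ncring. Qed.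
Lemma sl2eM a b : e (a * b) = e a * b + a * e b.
Proof. rewrite /sl2e; ncring. Qed.
Lemma sl2fM a b : f (a * b) = f a * b + a * f b.
Proof. rewrite /sl2f; ncring. Qed.
Lemma sl2eD a b : e (a + b) = e a + e b.
Proof. rewrite /sl2e; ncring. Qed.
Lemma sl2fD a b : f (a + b) = f a + f b.
Proof. rewrite /sl2f; ncring. Qed.

Lemma sl2eX v : e (X v) = 0. Proof. by rewrite /sl2e XE subrr. Qed.
Lemma sl2eY v : e (Y v) = X v. Proof. rewrite /sl2e YE; ncring. Qed.
Lemma sl2fX v : f (X v) = Y v. Proof. rewrite /sl2f FX; ncring. Qed.
Lemma sl2fY v : f (Y v) = 0. Proof. by rewrite /sl2f FY subrr. Qed.

Lemma sl2e_coef a : Coef a -> e a = 0.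
Proof. by move=> Ca; rewrite /sl2e CoefE // subrr. Qed.
Lemma sl2f_coef a : Coef a -> f a = 0.
Proof. by move=> Ca; rewrite /sl2f CoefF // subrr. Qed.

Definition sl2_letter := (sl2eM, sl2fM, sl2eX, sl2eY, sl2fX, sl2fY, sl2eD, sl2fD).

Lemma sl2eXM v a : e (X v * a) = X v * e a.
Proof. rewrite !sl2_letter; ncring. Qed.
Lemma sl2fYM v a : f (Y v * a) = Y v * f a.
Proof. rewrite !sl2_letter; ncring. Qed.
Lemma sl2hX v a : h (X v * a) = X v * a + X v * h a.
Proof. rewrite /sl2h sl2eXM !sl2_letter; ncring. Qed.
Lemma sl2hY v a : h (Y v * a) = - (Y v * a) + Y v * h a.
Proof. rewrite /sl2h sl2fYM !sl2_letter; ncring. Qed.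

(** Casimir of a tensor product: 3 from the letter, the Casimir of [a], and twice the split Casimir
    h (x) h + 2 (e (x) f + f (x) e), where e kills x_v. *)
Lemma casimirX v a :
  Om (X v * a) = 3%:R *: (X v * a) + X v * Om a
    + 2%:R *: (X v * h a + 2%:R *: (Y v * e a)).
Proof.
have hD b c : h (b + c) = h b + h c by rewrite -[b]scale1r sl2hL !scale1r.
rewrite /casimir sl2hX hD !sl2hX sl2eXM !sl2_letter.
rewrite /sl2h; ncring.
Qed.

Lemma casimirY v a :
  Om (Y v * a) = 3%:R *: (Y v * a) + Y v * Om a
    + 2%:R *: (- (Y v * h a) + 2%:R *: (X v * f a)).
Proof.
have hL b c : h (- b + c) = - h b + h c by rewrite -scaleN1r sl2hL scaleN1r.
rewrite /casimir sl2hY hL !sl2hY sl2fYM !sl2_letter.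
rewrite /sl2h; ncring.
Qed.

Lemma sl2e_minor u v a : e (M u v * a) = M u v * e a.
Proof.
rewrite sl2eM; suff -> : e (M u v) = 0 by rewrite mul0r add0r.
by rewrite /minor sl2eD -scaleN1r -[_ *: _]addr0 sl2eL sl2e0 !sl2_letter
  XX !mul0r !add0r addr0 scaleN1r subrr.
Qed.

Lemma sl2f_minor u v a : f (M u v * a) = M u v * f a.
Proof.
rewrite sl2fM; suff -> : f (M u v) = 0 by rewrite mul0r add0r.
by rewrite /minor sl2fD -scaleN1r -[_ *: _]addr0 sl2fL sl2f0 !sl2_letter
  YY !mulr0 !addr0 scaleN1r subrr.
Qed.

Lemma casimir_minor u v a : Om (M u v * a) = M u v * Om a.
Proof.
have hM b : h (M u v * b) = M u v * h b.
  by rewrite /sl2h !(sl2e_minor, sl2f_minor); ncring.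
rewrite /casimir !hM !(sl2e_minor, sl2f_minor); ncring.
Qed.

Lemma wfilt_T n i a : wfilt n a -> wfilt n (Tg i * a).
Proof.
move=> Fa; elim: Fa i => {n a} [a Ca|n|n k a b _ IHa _ IHb|n v a _ IH|n v a _ IH|n a _ IH] i.
- exact/wfilt_coef/CoefT.
- rewrite mulr0; exact: wfilt0.
- by rewrite mulrDr -pres_scalerAr; apply: wfiltL.
- by rewrite mulrA TX -mulrA; apply: wfiltX.
- by rewrite mulrA TY -mulrA; apply: wfiltY.
- exact/wfiltS.
Qed.

Lemma wfilt_comm n u v a : wfilt n a -> wfilt n ((Y u * X v - X v * Y u) * a).
Proof.
move=> Fa; have [c ->] := YX u v; rewrite mulr_suml.
apply: (subspace_sum (wfilt_sub n)) => i _; rewrite -pres_scalerAl.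
exact/(subspaceZ (wfilt_sub n))/wfilt_T.
Qed.

Lemma wfilt_e n a : wfilt n a -> wfilt n (e a).
Proof.
elim=> {n a} [a Ca|n|n k a b _ IHa _ IHb|n v a Fa IH|n v a Fa IH|n a _ IH].
- rewrite sl2e_coef //; exact: wfilt0.
- rewrite sl2e0; exact: wfilt0.
- by rewrite sl2eL; apply: wfiltL.
- by rewrite sl2eXM; apply: wfiltX.
- rewrite !sl2_letter; apply: (subspaceD (wfilt_sub _)).
    exact: wfiltX. exact: wfiltY.
- exact/wfiltS.
Qed.

Lemma wfilt_f n a : wfilt n a -> wfilt n (f a).
Proof.
elim=> {n a} [a Ca|n|n k a b _ IHa _ IHb|n v a Fa IH|n v a Fa IH|n a _ IH].
- rewrite sl2f_coef //; exact: wfilt0.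
- rewrite sl2f0; exact: wfilt0.
- by rewrite sl2fL; apply: wfiltL.
- rewrite !sl2_letter; apply: (subspaceD (wfilt_sub _)).
    exact: wfiltY. exact: wfiltX.
- by rewrite sl2fYM; apply: wfiltY.
- exact/wfiltS.
Qed.

Lemma wfilt_h n a : wfilt n a -> wfilt n (h a).
Proof.
by move=> Fa; apply: (subspaceB (wfilt_sub n)); [apply/wfilt_e/wfilt_f | apply/wfilt_f/wfilt_e].
Qed.

(** The letter passes the minor at the cost of commutators [y, x]. These lie in the span of the
    group, so each correction is short enough to count as an error term. *)
Lemma minor_partX n v a : minor_part n a -> minor_part n.+1 (X v * a).
Proof.
elim=> {n a} [n u w a Fa|n a Fa|n|n k a b _ IHa _ IHb].
- have -> : X v * (M u w * a) = M u w * (X v * a)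
      + (X w * ((Y u * X v - X v * Y u) * a) - X u * ((Y w * X v - X v * Y w) * a))
      + (X v * X u - X u * X v) * (Y w * a) - (X v * X w - X w * X v) * (Y u * a).
    rewrite /minor; ncring.
  rewrite (XX v u) (XX v w) !subrr !mul0r subr0 addr0.
  apply: (subspaceD (minor_part_sub _)); first exact/minor_partM/wfiltX.
  apply/minor_partS/wfiltS.
  by apply: (subspaceB (wfilt_sub _)); apply/wfiltX/wfilt_comm.
- exact/minor_partS/wfiltX.
- rewrite mulr0; exact: minor_part0.
- by rewrite mulrDr -pres_scalerAr; apply: minor_partL.
Qed.

Lemma minor_partY n v a : minor_part n a -> minor_part n.+1 (Y v * a).
Proof.
elim=> {n a} [n u w a Fa|n a Fa|n|n k a b _ IHa _ IHb].
- have -> : Y v * (M u w * a) = M u w * (Y v * a)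
      + ((Y v * X u - X u * Y v) * (Y w * a) - (Y v * X w - X w * Y v) * (Y u * a))
      + X u * ((Y v * Y w - Y w * Y v) * a) - X w * ((Y v * Y u - Y u * Y v) * a).
    rewrite /minor; ncring.
  rewrite (YY v u) (YY v w) !subrr !mul0r !mulr0 subr0 addr0.
  apply: (subspaceD (minor_part_sub _)); first exact/minor_partM/wfiltY.
  apply/minor_partS/wfiltS.
  by apply: (subspaceB (wfilt_sub _)); apply/wfilt_comm/wfiltY.
- exact/minor_partS/wfiltY.
- rewrite mulr0; exact: minor_part0.
- by rewrite mulrDr -pres_scalerAr; apply: minor_partL.
Qed.

(* On C^2 (x) C^2 the split Casimir of sl_2 is 1 on the symmetric and -3 on the *)
(* antisymmetric square; the letters of a minor span the latter.               *)
Lemma split_casimirX n v a : wfilt n a ->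
  minor_part n.+1 (X v * h a + 2%:R *: (Y v * e a) - n%:R *: (X v * a)).
Proof.
elim=> {n a} [a Ca|n|n k a b _ IHa _ IHb|n u a Fa IH|n u a Fa IH|n a Fa IH].
- rewrite /sl2h (sl2e_coef Ca) (sl2f_coef Ca) !(sl2e0, sl2f0) subr0 !mulr0 scale0r scaler0 addr0 subr0.
  exact: minor_part0.
- rewrite /sl2h !(sl2e0, sl2f0) subr0 !mulr0 !scaler0 addr0 subr0.
  exact: minor_part0.
- have -> : X v * h (k *: a + b) + 2%:R *: (Y v * e (k *: a + b)) - n%:R *: (X v * (k *: a + b))
     = k *: (X v * h a + 2%:R *: (Y v * e a) - n%:R *: (X v * a))
       + (X v * h b + 2%:R *: (Y v * e b) - n%:R *: (X v * b)).
    rewrite sl2hL sl2eL; ncring.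
  exact: minor_partL.
- rewrite sl2hX sl2eXM.
  have -> : X v * (X u * a + X u * h a) + 2%:R *: (Y v * (X u * e a)) - n.+1%:R *: (X v * (X u * a))
    = X u * (X v * h a + 2%:R *: (Y v * e a) - n%:R *: (X v * a))
      + 2%:R *: ((Y v * X u - X u * Y v) * e a)
      + (X v * X u - X u * X v) * (h a - n%:R *: a).
    rewrite -addn1 natrD; ncring.
  rewrite (XX v u) subrr mul0r addr0.
  apply: (subspaceD (minor_part_sub _)); first exact: minor_partX.
  by apply/(subspaceZ (minor_part_sub _))/minor_partS/wfiltS/wfilt_comm/wfilt_e.
- rewrite sl2hY sl2eM sl2eY.
  have -> : X v * (- (Y u * a) + Y u * h a) + 2%:R *: (Y v * (X u * a + Y u * e a))
        - n.+1%:R *: (X v * (Y u * a))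
    = Y u * (X v * h a + 2%:R *: (Y v * e a) - n%:R *: (X v * a))
      + - 2%:R *: (M v u * a)
      + ((Y u * X v - X v * Y u) * (n%:R *: a - h a)
        + 2%:R *: ((Y v * X u - X u * Y v) * a))
      + 2%:R *: ((Y v * Y u - Y u * Y v) * e a).
    rewrite /minor -addn1 natrD; ncring.
  rewrite (YY v u) subrr mul0r scaler0 addr0.
  apply: (subspaceD (minor_part_sub _)); first apply: (subspaceD (minor_part_sub _)).
  + exact: minor_partY.
  + exact/(subspaceZ (minor_part_sub _))/minor_partM.
  + apply/minor_partS/wfiltS/(subspaceD (wfilt_sub _)).
      apply/wfilt_comm/(subspaceB (wfilt_sub _)); last exact: wfilt_h.
      exact/(subspaceZ (wfilt_sub _)).
    exact/(subspaceZ (wfilt_sub _))/wfilt_comm.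
- apply: minor_partS; apply: (subspaceB (wfilt_sub _)); last first.
    exact/(subspaceZ (wfilt_sub _))/wfiltX.
  apply: (subspaceD (wfilt_sub _)); first exact/wfiltX/wfilt_h.
  exact/(subspaceZ (wfilt_sub _))/wfiltY/wfilt_e.
Qed.

Lemma split_casimirY n v a : wfilt n a ->
  minor_part n.+1 (- (Y v * h a) + 2%:R *: (X v * f a) - n%:R *: (Y v * a)).
Proof.
elim=> {n a} [a Ca|n|n k a b _ IHa _ IHb|n u a Fa IH|n u a Fa IH|n a Fa IH].
- rewrite /sl2h (sl2e_coef Ca) (sl2f_coef Ca) !(sl2e0, sl2f0) subr0 !mulr0 scale0r scaler0 addr0 subr0 oppr0.
  exact: minor_part0.
- rewrite /sl2h !(sl2e0, sl2f0) subr0 !mulr0 !scaler0 addr0 subr0 oppr0.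
  exact: minor_part0.
- have -> : - (Y v * h (k *: a + b)) + 2%:R *: (X v * f (k *: a + b)) - n%:R *: (Y v * (k *: a + b))
     = k *: (- (Y v * h a) + 2%:R *: (X v * f a) - n%:R *: (Y v * a))
       + (- (Y v * h b) + 2%:R *: (X v * f b) - n%:R *: (Y v * b)).
    rewrite sl2hL sl2fL; ncring.
  exact: minor_partL.
- rewrite sl2hX sl2fM sl2fX.
  have -> : - (Y v * (X u * a + X u * h a)) + 2%:R *: (X v * (Y u * a + X u * f a))
        - n.+1%:R *: (Y v * (X u * a))
    = X u * (- (Y v * h a) + 2%:R *: (X v * f a) - n%:R *: (Y v * a))
      + 2%:R *: (M v u * a)
      - (Y v * X u - X u * Y v) * (2%:R *: a + h a + n%:R *: a)
      + 2%:R *: ((X v * X u - X u * X v) * f a).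
    rewrite /minor -addn1 natrD; ncring.
  rewrite (XX v u) subrr mul0r scaler0 addr0.
  apply: (subspaceB (minor_part_sub _)); first apply: (subspaceD (minor_part_sub _)).
  + exact: minor_partX.
  + exact/(subspaceZ (minor_part_sub _))/minor_partM.
  + apply/minor_partS/wfiltS/wfilt_comm/(subspaceD (wfilt_sub _)).
      apply/(subspaceD (wfilt_sub _)); last exact: wfilt_h.
      exact/(subspaceZ (wfilt_sub _)).
    exact/(subspaceZ (wfilt_sub _)).
- rewrite sl2hY sl2fYM.
  have -> : - (Y v * (- (Y u * a) + Y u * h a)) + 2%:R *: (X v * (Y u * f a)) - n.+1%:R *: (Y v * (Y u * a))
    = Y u * (- (Y v * h a) + 2%:R *: (X v * f a) - n%:R *: (Y v * a))
      - 2%:R *: ((Y u * X v - X v * Y u) * f a)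
      - (Y v * Y u - Y u * Y v) * (h a + n%:R *: a).
    rewrite -addn1 natrD; ncring.
  rewrite (YY v u) subrr mul0r subr0.
  apply: (subspaceB (minor_part_sub _)); first exact: minor_partY.
  by apply/(subspaceZ (minor_part_sub _))/minor_partS/wfiltS/wfilt_comm/wfilt_f.
- apply: minor_partS; apply: (subspaceB (wfilt_sub _)); last first.
    exact/(subspaceZ (wfilt_sub _))/wfiltY.
  apply: (subspaceD (wfilt_sub _)); first exact/(subspaceN (wfilt_sub _))/wfiltY/wfilt_h.
  exact/(subspaceZ (wfilt_sub _))/wfiltX/wfilt_f.
Qed.

(** A letter put in front of a word of length n adds 3 for itself and 2n through the split Casimir,
    and n(n+2) + 3 + 2n = (n+1)(n+3). *)
Lemma casimir_wfilt n a : wfilt n a -> minor_part n (Om a - (n * n.+2)%:R *: a).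
Proof.
elim=> {n a} [a Ca|n|n k a b _ IHa _ IHb|n v a Fa IH|n v a Fa IH|n a Fa IH].
- rewrite /casimir /sl2h (sl2e_coef Ca) (sl2f_coef Ca) !(sl2e0, sl2f0, subr0, mul0n, scale0r, addr0, scaler0).
  exact: minor_part0.
- rewrite /casimir /sl2h !(sl2e0, sl2f0, subr0, addr0, scaler0); exact: minor_part0.
- have -> : Om (k *: a + b) - (n * n.+2)%:R *: (k *: a + b)
     = k *: (Om a - (n * n.+2)%:R *: a) + (Om b - (n * n.+2)%:R *: b).
    rewrite casimirL; ncring.
  exact: minor_partL.
- have -> : Om (X v * a) - (n.+1 * n.+3)%:R *: (X v * a)
     = X v * (Om a - (n * n.+2)%:R *: a)
       + 2%:R *: (X v * h a + 2%:R *: (Y v * e a) - n%:R *: (X v * a)).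
    rewrite casimirX -[n.+3]addn3 -[n.+2]addn2 -[n.+1]addn1 !natrM !natrD; ncring.
  apply: (subspaceD (minor_part_sub _)); first exact: minor_partX.
  exact/(subspaceZ (minor_part_sub _))/split_casimirX.
- have -> : Om (Y v * a) - (n.+1 * n.+3)%:R *: (Y v * a)
     = Y v * (Om a - (n * n.+2)%:R *: a)
       + 2%:R *: (- (Y v * h a) + 2%:R *: (X v * f a) - n%:R *: (Y v * a)).
    rewrite casimirY -[n.+3]addn3 -[n.+2]addn2 -[n.+1]addn1 !natrM !natrD; ncring.
  apply: (subspaceD (minor_part_sub _)); first exact: minor_partY.
  exact/(subspaceZ (minor_part_sub _))/split_casimirY.
- apply: minor_partS; apply: (subspaceB (wfilt_sub _)); last exact/(subspaceZ (wfilt_sub _)).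
  apply: (subspaceD (wfilt_sub _)); first exact/wfilt_h/wfilt_h.
  apply/(subspaceZ (wfilt_sub _))/(subspaceD (wfilt_sub _)).
    exact/wfilt_e/wfilt_f.
  exact/wfilt_f/wfilt_e.
Qed.

(** The factor with the largest j acts first, since it is the one adapted to the full word
    length. *)
Fixpoint casimir_iter (n : nat) (a : A) : A :=
  if n is m.+1 then casimir_iter m (Om a - (n * n.+2)%:R *: a) else a.

Lemma casimir_iterL n k a b :
  casimir_iter n (k *: a + b) = k *: casimir_iter n a + casimir_iter n b.
Proof.
elim: n a b => [|n IH] a b //; rewrite /= -IH; congr casimir_iter.
rewrite casimirL; ncring.
Qed.

Lemma casimir_iter_minor n u v a :
  casimir_iter n (M u v * a) = M u v * casimir_iter n a.
Proof.
elim: n a => [|n IH] a //; rewrite /= -IH; congr casimir_iter.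
rewrite casimir_minor; ncring.
Qed.

(** After the first factor only shorter words and minors times shorter words remain. Minors are
    invariant, so the other factors pass through them and the induction applies to the cofactor. *)
Lemma casimir_iter_span n a : wfilt n a -> minor_span (casimir_iter n a).
Proof.
elim: n a => [|n IH] a Fa.
  suff H m b : wfilt m b -> m = 0%N -> minor_span b by apply: H Fa _.
  elim=> {m b} [b Cb|m|m k b c _ IHb _ IHc|//|//|//] m0.
  + exact: minor_span_coef.
  + exact: (subspace0 minor_span_sub).
  + by apply: minor_spanL; [apply: IHb | apply: IHc].
suff H m b : minor_part m b -> m = n.+1 -> minor_span (casimir_iter n b).
  exact: (H _ _ (casimir_wfilt Fa)).
elim=> {m b a Fa} [m u v a Fa|m a Fa|m|m k a b _ IHa _ IHb] mn.
- rewrite casimir_iter_minor; apply/minor_spanM/IH.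
  by case: mn => <-; apply: wfiltS.
- by apply: IH; case: mn => <-.
- exact/IH/wfilt0.
- by rewrite casimir_iterL; apply: minor_spanL; [apply: IHa | apply: IHb].
Qed.

(* The first fundamental theorem for SL_2, without complete reducibility: the *)
(* operators Om - j(j+2), 0 < j <= n, map F_n to the span of the minors, and  *)
(* they are nonzero scalars on the invariants.                               *)
Lemma sl2_invariant_span n a : wfilt n a ->
  a * Ep = Ep * a -> a * Em = Em * a -> minor_span a.
Proof.
move=> Fa aE aF.
have Oma : Om a = 0.
  have ea : e a = 0 by rewrite /sl2e aE subrr.
  have fa : f a = 0 by rewrite /sl2f aF subrr.
  by rewrite /casimir /sl2h ea fa !(sl2e0, sl2f0, subr0, addr0, scaler0).
have Om0 k : Om (k *: a) = 0.
  by rewrite -[k *: a]addr0 casimirL Oma scaler0 add0r /casimir /sl2h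
   !(sl2e0, sl2f0, subr0, addr0, scaler0).
have [k k0 E] : exists2 k : K, k != 0 & casimir_iter n a = k *: a.
  have IHk m (l : K) : exists2 k : K, k != 0 & casimir_iter m (l *: a) = (k * l) *: a.
    elim: m l => [|m IHm] l; first by exists 1; rewrite ?oner_neq0 ?mul1r.
    have [k k0 Ek] := IHm (- (m.+1 * m.+3)%:R * l).
    exists (k * - (m.+1 * m.+3)%:R); first by rewrite mulf_neq0 // oppr_eq0 pnatr_eq0.
    by rewrite /= Om0 sub0r scalerA -scaleNr -mulNr Ek mulrA.
  by have [k k0 Ek] := IHk n 1; exists k; rewrite // -{1}[a]scale1r Ek mulr1.
rewrite -[a](scalerK k0) -E; apply/(subspaceZ minor_span_sub)/casimir_iter_span; exact: Fa.
Qed.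

End Sl2Invariants.

(** * The supercentralizer of osp(1|2) *)

(* The presentation of A_kappa enters only through the relations between x_u, y_u, *)
(* gamma_u (u in V) and T_g; the roots r_s are normalised by B(r_s, r_s) = 1.      *)
Section OspSupercentralizer.
Context (K : numFieldType) (T : choiceType) (R : freeAlg K T -> Prop).
Local Notation A := (presAlg R).
Context (V : lmodType K) (B : V -> V -> K) (X Y Gam : V -> A).
Context (I : finType) (Tg : I -> A) (act : I -> V -> V) (th : A -> A).
Context (refl : pred I) (r : I -> V) (kap : I -> K).
Context (d : nat) (yb : 'I_d -> V).
Context (Bsym : forall u v, B u v = B v u).
Context (ybE : forall v, v = \sum_j B (yb j) v *: yb j).
Context (yb_on : forall i j, B (yb i) (yb j) = (i == j)%:R).
Context (XL : forall k u v, X (k *: u + v) = k *: X u + X v).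
Context (YL : forall k u v, Y (k *: u + v) = k *: Y u + Y v).
Context (GL : forall k u v, Gam (k *: u + v) = k *: Gam u + Gam v).
Context (XX : forall u v, X u * X v = X v * X u).
Context (YY : forall u v, Y u * Y v = Y v * Y u).
Context (YX : forall u v, Y u * X v - X v * Y u = B u v *: (1 : A) +
  \sum_(s | refl s) (2%:R * kap s * B (r s) u * B (r s) v) *: Tg s).
Context (GG : forall u v, Gam u * Gam v + Gam v * Gam u = (2%:R * B u v) *: (1 : A)).
Context (XG : forall u v, X u * Gam v = Gam v * X u).
Context (YG : forall u v, Y u * Gam v = Gam v * Y u).
Context (TG : forall i v, Tg i * Gam v = Gam v * Tg i).
Context (TX : forall i v, Tg i * X v = X (act i v) * Tg i).
Context (TY : forall i v, Tg i * Y v = Y (act i v) * Tg i).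
Context (TT : forall i j, exists k, Tg i * Tg j = Tg k).
Context (T1 : exists i, Tg i = 1).
Context (act_orth : forall i u v, B (act i u) (act i v) = B u v).
Context (actL : forall i k u v, act i (k *: u + v) = k *: act i u + act i v).
Context (act_surj : forall i u, exists v, act i v = u).
Context (r_unit : forall s, refl s -> B (r s) (r s) = 1).
Context (act_r : forall s, refl s -> act s (r s) = - r s).
Context (thL : forall k a b, th (k *: a + b) = k *: th a + th b).
Context (thM : forall a b, th (a * b) = th a * th b).
Context (th1 : th 1 = 1).
Context (thX : forall v, th (X v) = X v) (thY : forall v, th (Y v) = Y v).
Context (thT : forall i, th (Tg i) = Tg i).
Context (thG : forall v, th (Gam v) = - Gam v).
Context (thK : forall a, th (th a) = a).

Lemma lin_frame (f : V -> A) : (forall k u v, f (k *: u + v) = k *: f u + f v) ->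
  forall v, \sum_j B (yb j) v *: f (yb j) = f v.
Proof.
move=> fL v; rewrite [in RHS](ybE v) lin_sum //.
by apply: eq_bigr => j _; rewrite linZ.
Qed.

Lemma lin_frame' (f : V -> A) : (forall k u v, f (k *: u + v) = k *: f u + f v) ->
  forall v, \sum_j B v (yb j) *: f (yb j) = f v.
Proof. by move=> fL v; rewrite -[RHS](lin_frame fL); apply: eq_bigr => j _; rewrite Bsym. Qed.

(** The tensor sum_j y_j (x) y_j is invariant under orthogonal maps. *)
Lemma act_frame i (phi : V -> V -> A) :
  (forall w k u v, phi (k *: u + v) w = k *: phi u w + phi v w) ->
  (forall w k u v, phi w (k *: u + v) = k *: phi w u + phi w v) ->
  \sum_j phi (act i (yb j)) (act i (yb j)) = \sum_j phi (yb j) (yb j).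
Proof.
move=> phiL phiR.
have E j : phi (act i (yb j)) (act i (yb j)) =
    \sum_k B (yb k) (act i (yb j)) *: phi (yb k) (act i (yb j)).
  by rewrite (lin_frame (phiL _)).
under eq_bigr do rewrite E.
rewrite exchange_big; apply: eq_bigr => k _ /=.
have [v <-] := act_surj i (yb k).
rewrite (eq_bigr (fun j => B (yb j) v *: phi (act i v) (act i (yb j)))) => [|j _].
  by rewrite (lin_frame (f := fun u => phi (act i v) (act i u))) // => *; rewrite actL phiR.
by rewrite act_orth Bsym.
Qed.

(** * The degree filtration of the Clifford algebra *)

Inductive cl : nat -> A -> Prop :=
| cl1 : cl 0 1
| cl0 n : cl n 0
| clL n k a b : cl n a -> cl n b -> cl n (k *: a + b)
| clG n v a : cl n a -> cl n.+1 (Gam v * a)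
| clS n a : cl n a -> cl n.+1 a.

Lemma cl_sub n : subspace (cl n).
Proof. by split; [apply: cl0 | move=> *; apply: clL]. Qed.

Lemma clW m n a : (m <= n)%N -> cl m a -> cl n a.
Proof.
by move=> /subnK <-; elim: (n - m)%N => // k IH /IH; rewrite addSn; apply: clS.
Qed.

Lemma cl_gam v : cl 1 (Gam v).
Proof. by rewrite -[Gam v]mulr1; apply/clG/cl1. Qed.

Lemma clM m n a b : cl m a -> cl n b -> cl (m + n) (a * b).
Proof.
move=> Ca Cb; elim: Ca => {m a} [|m|m k a a' _ IHa _ IHa'|m v a _ IH|m a _ IH].
- by rewrite mul1r.
- rewrite mul0r; exact: cl0.
- by rewrite mulrDl -pres_scalerAl; apply: clL.
- by rewrite -mulrA addSn; apply: clG.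
- by rewrite addSn; apply: clS.
Qed.

Lemma cl_th n a : cl n a -> cl n (th a).
Proof.
elim=> {n a} [|n|n k a b _ IHa _ IHb|n v a _ IH|n a _ IH].
- rewrite th1; exact: cl1.
- rewrite lin0 //; exact: cl0.
- by rewrite thL; apply: clL.
- by rewrite thM thG mulNr; apply/(subspaceN (cl_sub _))/clG.
- exact: clS.
Qed.

Lemma cl_commute z : (forall v, z * Gam v = Gam v * z) ->
  forall n a, cl n a -> z * a = a * z.
Proof.
move=> zG n a; elim=> {n a} [|n|n k a b _ IHa _ IHb|n v a _ IH|//].
- by rewrite mulr1 mul1r.
- by rewrite mulr0 mul0r.
- by rewrite mulrDr mulrDl -pres_scalerAr -pres_scalerAl IHa IHb.
- by rewrite mulrA zG -!mulrA IH.
Qed.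

Lemma Xcl n a v : cl n a -> X v * a = a * X v.
Proof. exact: cl_commute. Qed.
Lemma Ycl n a v : cl n a -> Y v * a = a * Y v.
Proof. exact: cl_commute. Qed.
Lemma Tcl n a i : cl n a -> Tg i * a = a * Tg i.
Proof. exact: cl_commute. Qed.

(** * The relations of osp(1|2) *)

Definition raise2 : A := 2%:R^-1 *: \sum_j X (yb j) * X (yb j).
Definition lower2 : A := 2%:R^-1 *: \sum_j Y (yb j) * Y (yb j).
(** Normalisation: [raise] and [lower] are sqrt 2 times F^+ and F^-, [raise2] is E^+, [lower2] is
    -E^-, and [cartan2] below is 2H. No square root appears until the translation to A_kappa. *)
Definition raise : A := \sum_j X (yb j) * Gam (yb j).
Definition lower : A := \sum_j Y (yb j) * Gam (yb j).

Local Notation Ep := raise2.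
Local Notation Em := lower2.
Local Notation Fp := raise.
Local Notation Fm := lower.

Let two0 : 2%:R != 0 :> K. Proof. by rewrite pnatr_eq0. Qed.

(** As the Z commute, exchanging the summation indices replaces gamma_i gamma_j by half its
    anticommutator, which is the Kronecker delta. *)
Lemma dirac_sqr (Z : V -> A) : (forall u v, Z u * Z v = Z v * Z u) ->
  (forall u v, Z u * Gam v = Gam v * Z u) ->
  (\sum_j Z (yb j) * Gam (yb j)) * (\sum_j Z (yb j) * Gam (yb j))
  = \sum_j Z (yb j) * Z (yb j).
Proof.
move=> ZZ ZG; set S := LHS.
have E : S = \sum_i \sum_j Z (yb i) * Z (yb j) * (Gam (yb i) * Gam (yb j)).
  rewrite /S mulr_suml; apply: eq_bigr => i _; rewrite mulr_sumr.
  by apply: eq_bigr => j _; rewrite mulrA -(mulrA (Z _)) -ZG !mulrA.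
have E' : S = \sum_i \sum_j Z (yb i) * Z (yb j) * (Gam (yb j) * Gam (yb i)).
  by rewrite E exchange_big; do 2!apply: eq_bigr => ? _; rewrite ZZ.
apply: (scalerI two0); rewrite [LHS]scaler_nat mulr2n {1}E E' -big_split scaler_sumr /=.
apply: eq_bigr => i _; rewrite -big_split /= (bigD1 i) //= big1 => [|j ji].
  rewrite -mulrDr GG -pres_scalerAr mulr1 yb_on eqxx mulr1 addr0; ncring.
by rewrite -mulrDr GG yb_on eq_sym (negPf ji) mulr0 scale0r mulr0.
Qed.

Lemma raise_sqr : Fp * Fp = 2%:R *: Ep.
Proof. by rewrite dirac_sqr // scalerA divff // scale1r. Qed.
Lemma lower_sqr : Fm * Fm = 2%:R *: Em.
Proof. by rewrite dirac_sqr // scalerA divff // scale1r. Qed.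

Lemma refl_sum_swap (J : Type) (s : seq J) (F : J -> I -> A) :
  \sum_(j <- s) \sum_(i | refl i) F j i = \sum_(i | refl i) \sum_(j <- s) F j i.
Proof. exact: exchange_big. Qed.

Lemma X_raise2 v : X v * Ep = Ep * X v.
Proof.
rewrite -pres_scalerAr -pres_scalerAl mulr_sumr mulr_suml; congr (_ *: _).
by apply: eq_bigr => j _; rewrite mulrA XX -mulrA XX mulrA.
Qed.

Lemma Y_lower2 v : Em * Y v = Y v * Em.
Proof.
rewrite -pres_scalerAr -pres_scalerAl mulr_sumr mulr_suml; congr (_ *: _).
by apply: eq_bigr => j _; rewrite -mulrA YY mulrA YY mulrA.
Qed.

(** The reflection part of [y_v, x_j] sums to multiples of T_s x_r + x_r T_s with r = r_s, which
    vanish because s negates r. *)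
Lemma Y_raise2 v : Y v * Ep = Ep * Y v + X v.
Proof.
apply/eqP; rewrite addrC -subr_eq; apply/eqP.
rewrite /raise2 -pres_scalerAr -pres_scalerAl -scalerBr mulr_sumr mulr_suml -sumrB.
apply: (scalerI two0); rewrite scalerA divff // scale1r.
rewrite (eq_bigr (fun j => 2%:R *: (B v (yb j) *: X (yb j)) +
   \sum_(s | refl s) (2%:R * kap s * B (r s) v) *:
     (B (r s) (yb j) *: (Tg s * X (yb j) + X (yb j) * Tg s)))) => [|j _].
  rewrite big_split /= -scaler_sumr lin_frame' // refl_sum_swap big1 ?addr0 // => s rs.
  rewrite -scaler_sumr (lin_frame' (f := fun u => Tg s * X u + X u * Tg s)).
    by rewrite TX act_r // linN // mulNr addNr scaler0.
  by move=> k u w; rewrite XL; ncring.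
rewrite (_ : _ - _ = (Y v * X (yb j) - X (yb j) * Y v) * X (yb j)
   + X (yb j) * (Y v * X (yb j) - X (yb j) * Y v)); last ncring.
rewrite YX mulrDl mulrDr addrACA mulr_suml mulr_sumr -big_split /=; congr (_ + _); first ncring.
apply: eq_bigr => s _; ncring.
Qed.

Lemma lower2_X v : Em * X v = X v * Em + Y v.
Proof.
apply/eqP; rewrite addrC -subr_eq; apply/eqP.
rewrite /lower2 -pres_scalerAr -pres_scalerAl -scalerBr mulr_sumr mulr_suml -sumrB.
apply: (scalerI two0); rewrite scalerA divff // scale1r.
rewrite (eq_bigr (fun j => 2%:R *: (B (yb j) v *: Y (yb j)) +
   \sum_(s | refl s) (2%:R * kap s * B (r s) v) *:
     (B (r s) (yb j) *: (Tg s * Y (yb j) + Y (yb j) * Tg s)))) => [|j _].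
  rewrite big_split /= -scaler_sumr lin_frame // refl_sum_swap big1 ?addr0 // => s rs.
  rewrite -scaler_sumr (lin_frame' (f := fun u => Tg s * Y u + Y u * Tg s)).
    by rewrite TY act_r // linN // mulNr addNr scaler0.
  by move=> k u w; rewrite YL; ncring.
rewrite (_ : _ - _ = (Y (yb j) * X v - X v * Y (yb j)) * Y (yb j)
   + Y (yb j) * (Y (yb j) * X v - X v * Y (yb j))); last ncring.
rewrite YX mulrDl mulrDr addrACA mulr_suml mulr_sumr -big_split /=; congr (_ + _); first ncring.
apply: eq_bigr => s _; ncring.
Qed.

Lemma T_raise2 i : Tg i * Ep = Ep * Tg i.
Proof.
rewrite -pres_scalerAr -pres_scalerAl; congr (_ *: _).
rewrite -[in RHS](act_frame i (phi := fun u v => X u * X v)) => [|w k u v|w k u v]; last 2 first.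
- by rewrite XL; ncring.
- by rewrite XL; ncring.
rewrite mulr_sumr mulr_suml; apply: eq_bigr => j _.
by rewrite mulrA TX -(mulrA _ (Tg i)) TX mulrA.
Qed.

Lemma T_lower2 i : Tg i * Em = Em * Tg i.
Proof.
rewrite -pres_scalerAr -pres_scalerAl; congr (_ *: _).
rewrite -[in RHS](act_frame i (phi := fun u v => Y u * Y v)) => [|w k u v|w k u v]; last 2 first.
- by rewrite YL; ncring.
- by rewrite YL; ncring.
rewrite mulr_sumr mulr_suml; apply: eq_bigr => j _.
by rewrite mulrA TY -(mulrA _ (Tg i)) TY mulrA.
Qed.

Lemma raise2_gam v : Ep * Gam v = Gam v * Ep.
Proof.
rewrite -pres_scalerAr -pres_scalerAl mulr_sumr mulr_suml; congr (_ *: _).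
by apply: eq_bigr => j _; rewrite -mulrA XG mulrA XG mulrA.
Qed.

Lemma lower2_gam v : Em * Gam v = Gam v * Em.
Proof.
rewrite -pres_scalerAr -pres_scalerAl mulr_sumr mulr_suml; congr (_ *: _).
by apply: eq_bigr => j _; rewrite -mulrA YG mulrA YG mulrA.
Qed.

Lemma raise2_lower : Fm * Ep - Ep * Fm = Fp.
Proof.
rewrite mulr_sumr mulr_suml -sumrB; apply: eq_bigr => j _.
rewrite -mulrA -raise2_gam mulrA Y_raise2; ncring.
Qed.

Lemma lower2_raise : Em * Fp - Fp * Em = Fm.
Proof.
rewrite mulr_sumr mulr_suml -sumrB; apply: eq_bigr => j _.
rewrite -(mulrA (X _)) -lower2_gam 2!mulrA lower2_X; ncring.
Qed.

Definition cartan2 : A := 2%:R *: (\sum_j X (yb j) * Y (yb j))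
  + d%:R *: (1 : A) + 2%:R *: \sum_(s | refl s) kap s *: Tg s.

Lemma gam_sqr v : Gam v * Gam v = B v v *: (1 : A).
Proof.
apply: (scalerI two0); rewrite scalerA -GG; ncring.
Qed.

(** The anticommutators of the gammas give the Euler term. The scalar part of [y, x] gives sum_j
    gamma_j^2 = d, and its reflection part gives T_s gamma_r^2 = T_s, as r = r_s has unit length. *)
Lemma anticomm_FpFm : Fp * Fm + Fm * Fp = cartan2.
Proof.
have E1 : Fp * Fm = \sum_i \sum_j X (yb i) * Y (yb j) * (Gam (yb i) * Gam (yb j)).
  rewrite mulr_suml; apply: eq_bigr => i _; rewrite mulr_sumr.
  by apply: eq_bigr => j _; rewrite mulrA -(mulrA (X _)) -YG !mulrA.
have E2 : Fm * Fp = \sum_i \sum_j Y (yb j) * X (yb i) * (Gam (yb j) * Gam (yb i)).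
  rewrite mulr_suml exchange_big; apply: eq_bigr => i _; rewrite mulr_sumr.
  by apply: eq_bigr => j _; rewrite mulrA -(mulrA (Y _)) -XG !mulrA.
rewrite E1 E2 -big_split /=.
rewrite (eq_bigr (fun i => 2%:R *: (X (yb i) * Y (yb i)) + 1
   + \sum_(s | refl s) (2%:R * kap s) *: (Tg s * (B (r s) (yb i) *: (Gam (r s) * Gam (yb i)))))).
  rewrite !big_split /= -scaler_sumr /cartan2; congr (_ + _ + _).
    by rewrite sumr_const card_ord scaler_nat.
  rewrite refl_sum_swap scaler_sumr; apply: eq_bigr => s rs.
  rewrite -scaler_sumr -mulr_sumr (lin_frame' (f := fun u => Gam (r s) * Gam u)).
    by rewrite gam_sqr r_unit // scale1r mulr1 scalerA.
  by move=> k u w; rewrite GL; ncring.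
move=> i _; rewrite -big_split /=.
rewrite (eq_bigr (fun j => (2%:R * B (yb i) (yb j)) *: (X (yb i) * Y (yb j))
   + (B (yb j) (yb i) *: Gam (yb j)) * Gam (yb i) +
   \sum_(s | refl s) (2%:R * kap s * B (r s) (yb i)) *: (Tg s * (B (r s) (yb j) *: Gam (yb j) * Gam (yb i))))).
  rewrite !big_split /=; congr (_ + _ + _).
  - rewrite (eq_bigr (fun j => 2%:R *: (X (yb i) * (B (yb i) (yb j) *: Y (yb j))))) => [|j _].
      by rewrite -scaler_sumr -mulr_sumr lin_frame'.
    ncring.
  - by rewrite -mulr_suml lin_frame // gam_sqr yb_on eqxx scale1r.
  - rewrite refl_sum_swap; apply: eq_bigr => s rs.
    rewrite -scaler_sumr -mulr_sumr -mulr_suml lin_frame' //; ncring.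
move=> j _.
have -> : X (yb i) * Y (yb j) * (Gam (yb i) * Gam (yb j)) +
    Y (yb j) * X (yb i) * (Gam (yb j) * Gam (yb i))
  = X (yb i) * Y (yb j) * (Gam (yb i) * Gam (yb j) + Gam (yb j) * Gam (yb i))
    + (Y (yb j) * X (yb i) - X (yb i) * Y (yb j)) * (Gam (yb j) * Gam (yb i)) by ncring.
rewrite GG YX (mulrDl _ (\sum_(_ | _) _)) addrA mulr_suml.
congr (_ + _); first ncring.
apply: eq_bigr => s _; ncring.
Qed.

Lemma cartan2_cl n c : cl n c -> cartan2 * c = c * cartan2.
Proof.
move=> Cc; rewrite /cartan2 !(mulrDl, mulrDr) -!(pres_scalerAl, pres_scalerAr).
congr (_ + _ + _); [congr (_ *: _)|by rewrite mul1r mulr1|congr (_ *: _)];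
  rewrite mulr_suml mulr_sumr; apply: eq_bigr => j _.
  by rewrite -mulrA (Ycl _ Cc) mulrA (Xcl _ Cc) mulrA.
by rewrite -pres_scalerAl -pres_scalerAr (Tcl _ Cc).
Qed.

Lemma raise2_cl n c : cl n c -> Ep * c = c * Ep.
Proof. exact: cl_commute raise2_gam n c. Qed.
Lemma lower2_cl n c : cl n c -> Em * c = c * Em.
Proof. exact: cl_commute lower2_gam n c. Qed.

(** * The supercentralizer and the projection P *)

Definition ad_raise (a : A) : A := Fp * a - th a * Fp.
Definition ad_lower (a : A) : A := Fm * a - th a * Fm.
(** This is P_+: the factor 1/2 compensates the two factors sqrt 2 in [raise] and [lower]. *)
Definition proj (a : A) : A := a - 2%:R^-1 *: ad_lower (ad_raise a).
Definition cent (a : A) : Prop := a * Fp = Fp * th a /\ a * Fm = Fm * th a.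

Lemma th_raise : th Fp = - Fp.
Proof.
by rewrite lin_sum // -sumrN; apply: eq_bigr => j _; rewrite thM thX thG mulrN.
Qed.
Lemma th_lower : th Fm = - Fm.
Proof.
by rewrite lin_sum // -sumrN; apply: eq_bigr => j _; rewrite thM thY thG mulrN.
Qed.

Lemma thB a b : th (a - b) = th a - th b.
Proof. by rewrite addrC -scaleN1r thL scaleN1r addrC. Qed.

Lemma ad_raiseL k a b : ad_raise (k *: a + b) = k *: ad_raise a + ad_raise b.
Proof. rewrite /ad_raise thL; ncring. Qed.
Lemma ad_lowerL k a b : ad_lower (k *: a + b) = k *: ad_lower a + ad_lower b.
Proof. rewrite /ad_lower thL; ncring. Qed.
Lemma projL k a b : proj (k *: a + b) = k *: proj a + proj b.
Proof. rewrite /proj ad_raiseL ad_lowerL; ncring. Qed.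

Lemma ad_raise0 : ad_raise 0 = 0. Proof. exact: lin0 ad_raiseL. Qed.
Lemma ad_lower0 : ad_lower 0 = 0. Proof. exact: lin0 ad_lowerL. Qed.

Lemma ad_raise_sqr a : ad_raise (ad_raise a) = 2%:R *: (Ep * a - a * Ep).
Proof.
rewrite /ad_raise thB !thM th_raise thK scalerBr pres_scalerAl -raise_sqr.
rewrite pres_scalerAr -raise_sqr; ncring.
Qed.
Lemma ad_lower_sqr a : ad_lower (ad_lower a) = 2%:R *: (Em * a - a * Em).
Proof.
rewrite /ad_lower thB !thM th_lower thK scalerBr pres_scalerAl -lower_sqr.
rewrite pres_scalerAr -lower_sqr; ncring.
Qed.

(** The super Jacobi identity for F^+, F^- and [a]. *)
Lemma ad_raise_lower a :
  ad_raise (ad_lower a) = cartan2 * a - a * cartan2 - ad_lower (ad_raise a).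
Proof.
rewrite -anticomm_FpFm /ad_raise /ad_lower !thB !thM th_raise th_lower thK; ncring.
Qed.

Lemma cent_adP a : cent a <-> ad_raise a = 0 /\ ad_lower a = 0.
Proof.
have ca F b : th F = - F -> th b * F = F * b -> b * F = F * th b.
  move=> tF /(congr1 th); rewrite !thM thK tF; rewrite mulrN mulNr.
  by move/oppr_inj.
split=> [[aP aM]|[/eqP aP /eqP aM]].
  by split; apply/eqP; rewrite subr_eq0; apply/eqP/esym;
    rewrite -{2}[a]thK ca ?thK // ?th_raise ?th_lower.
by move: aP aM; rewrite !subr_eq0 => /eqP/esym aP /eqP/esym aM; split;
  apply: ca; rewrite ?th_raise ?th_lower.
Qed.

Lemma cent_sub : subspace cent.
Proof.
split=> [|k a b [aP aM] [bP bM]]; first by split; rewrite lin0 // mul0r mulr0.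
by split; rewrite mulrDl thL mulrDr -pres_scalerAl -pres_scalerAr ?aP ?bP ?aM ?bM.
Qed.

Lemma cent1 : cent 1. Proof. by split; rewrite th1 mul1r mulr1. Qed.

Lemma centM a b : cent a -> cent b -> cent (a * b).
Proof.
move=> [aP aM] [bP bM]; split; rewrite -mulrA ?bP ?bM mulrA ?aP ?aM -mulrA thM //.
Qed.

Lemma cent_raise2 a : cent a -> a * Ep = Ep * a.
Proof.
move=> /cent_adP[aP _]; have := ad_raise_sqr a.
rewrite aP ad_raise0 => /esym/eqP.
by rewrite scaler_eq0 (negPf two0) /= subr_eq0 => /eqP.
Qed.
Lemma cent_lower2 a : cent a -> a * Em = Em * a.
Proof.
move=> /cent_adP[_ aM]; have := ad_lower_sqr a.
rewrite aM ad_lower0 => /esym/eqP.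
by rewrite scaler_eq0 (negPf two0) /= subr_eq0 => /eqP.
Qed.

Lemma proj_cent a : cent a -> proj a = a.
Proof.
case/cent_adP=> aP _; by rewrite /proj aP ad_lower0 scaler0 subr0.
Qed.

Lemma projM b a : cent b -> proj (b * a) = b * proj a.
Proof.
move=> cb; have [bP bM] := cb.
have E1 : ad_raise (b * a) = th b * ad_raise a.
  have /cent_adP[/eqP + _] := cb; rewrite /ad_raise subr_eq0 => /eqP bP'.
  rewrite thM mulrA bP'; ncring.
have E2 c : ad_lower (th b * c) = b * ad_lower c.
  rewrite /ad_lower thM thK mulrA -bM; ncring.
rewrite /proj E1 E2; ncring.
Qed.

(* On sl_2-invariants [F+, [F+, a]] and [F-, [F-, a]] vanish, so that only the *)
(* relations [F+, F-] = H, [H, F+] = F+ and [E-, F+] = - F- come in.          *)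
Lemma cent_proj n c : cl n c -> cent (proj c).
Proof.
move=> Cc; apply/cent_adP; rewrite /proj; set b := ad_raise c.
have raiseE : ad_raise (c - 2%:R^-1 *: ad_lower b) = b - 2%:R^-1 *: ad_raise (ad_lower b).
  by rewrite addrC -scaleNr ad_raiseL addrC scaleNr.
have lowerE : ad_lower (c - 2%:R^-1 *: ad_lower b) = ad_lower c - 2%:R^-1 *: ad_lower (ad_lower b).
  by rewrite addrC -scaleNr ad_lowerL addrC scaleNr.
have Cthc := cl_th Cc; have bE : b = Fp * c - th c * Fp by [].
split; rewrite ?raiseE ?lowerE; apply/eqP; rewrite subr_eq0; apply/eqP.
- rewrite ad_raise_lower ad_raise_sqr (raise2_cl Cc) subrr scaler0.
  rewrite ad_lower0 subr0; apply: (scalerI two0); rewrite scalerA divff // scale1r.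
  have HF : cartan2 * Fp - Fp * cartan2 = 2%:R *: Fp.
    have -> : cartan2 * Fp - Fp * cartan2 = Fm * (Fp * Fp) - Fp * Fp * Fm.
      by rewrite -anticomm_FpFm; ncring.
    by rewrite raise_sqr -pres_scalerAl -pres_scalerAr -scalerBr raise2_lower.
  have -> : cartan2 * b - b * cartan2 = (cartan2 * Fp - Fp * cartan2) * c
     - th c * (cartan2 * Fp - Fp * cartan2)
     + Fp * (cartan2 * c - c * cartan2) - (cartan2 * th c - th c * cartan2) * Fp
     + (cartan2 * th c - th c * cartan2) * Fp - (cartan2 * th c - th c * cartan2) * Fp.
    rewrite bE; ncring.
  rewrite HF (cartan2_cl Cc) (cartan2_cl Cthc) !subrr bE; ncring.
- rewrite ad_lower_sqr scalerA mulVf // scale1r bE.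
  have -> : Em * (Fp * c - th c * Fp) - (Fp * c - th c * Fp) * Em
     = (Em * Fp - Fp * Em) * c - th c * (Em * Fp - Fp * Em)
       + Fp * (Em * c - c * Em) - (Em * th c - th c * Em) * Fp by ncring.
  rewrite lower2_raise (lower2_cl Cc) (lower2_cl Cthc) !subrr /ad_lower; ncring.
Qed.

(** * Clifford contractions and the explicit form of P on the Clifford algebra *)

Definition sder (v : V) (c : A) : A := Gam v * c - th c * Gam v.

Lemma sderL v k a b : sder v (k *: a + b) = k *: sder v a + sder v b.
Proof. rewrite /sder thL; ncring. Qed.
Lemma sderLv c k u v : sder (k *: u + v) c = k *: sder u c + sder v c.
Proof. rewrite /sder GL; ncring. Qed.
Lemma sder1 v : sder v 1 = 0.
Proof. rewrite /sder th1; ncring. Qed.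

Lemma sderG v u c : sder v (Gam u * c) = (2%:R * B u v) *: c - Gam u * sder v c.
Proof.
have -> : (2%:R * B u v) *: c = ((2%:R * B u v) *: (1 : A)) * c by ncring.
rewrite -GG /sder thM thG; ncring.
Qed.

Lemma sder_anti u v c : sder u (sder v c) = - sder v (sder u c).
Proof.
rewrite /sder !thB !thM !thG thK.
have -> : Gam u * (Gam v * c - th c * Gam v) - (- Gam v * th c - c * - Gam v) * Gam u
  = - (Gam v * (Gam u * c - th c * Gam u) - (- Gam u * th c - c * - Gam u) * Gam v)
    + (Gam u * Gam v + Gam v * Gam u) * c - c * (Gam u * Gam v + Gam v * Gam u).
  ncring.
rewrite GG; ncring.
Qed.

Lemma cl_sder n v c : cl n c -> cl n.-1 (sder v c).
Proof.
elim=> {n c} [|n|n k a b _ IHa _ IHb|n u a Ca IH|n a _ IH].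
- rewrite sder1; exact: cl0.
- rewrite (lin0 (sderL v)); exact: cl0.
- by rewrite sderL; apply: clL.
- rewrite sderG; apply: (subspaceB (cl_sub _)); first exact: (subspaceZ (cl_sub _)).
  case: n Ca IH => [|n] Ca IH; last exact: clG.
  suff -> : sder v a = 0 by rewrite mulr0; apply: cl0.
  suff H m b : cl m b -> m = 0%N -> sder v b = 0 by apply: H Ca _.
  elim=> {a Ca IH m b} [|m|m k a b _ IHa _ IHb|//|//] m0; first exact: sder1.
    exact: (lin0 (sderL v)).
  by rewrite sderL IHa // IHb // scaler0 addr0.
- exact: clW (leq_pred n) IH.
Qed.

Lemma ad_raise_cl n c : cl n c -> ad_raise c = \sum_j X (yb j) * sder (yb j) c.
Proof.
move=> Cc; rewrite /ad_raise mulr_suml mulr_sumr -sumrB; apply: eq_bigr => j _.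
rewrite [th c * _]mulrA -(Xcl _ (cl_th Cc)) /sder; ncring.
Qed.

Lemma ad_lower_cl n c v : cl n c -> ad_lower (X v * c) =
  \sum_k ((Y (yb k) * X v - X v * Y (yb k)) * (Gam (yb k) * c)
          + X v * Y (yb k) * sder (yb k) c).
Proof.
move=> Cc; rewrite /ad_lower mulr_suml mulr_sumr -sumrB; apply: eq_bigr => j _.
rewrite thM thX /sder.
have -> : Y (yb j) * Gam (yb j) * (X v * c) - X v * th c * (Y (yb j) * Gam (yb j))
  = Y (yb j) * (Gam (yb j) * X v) * c - X v * (th c * Y (yb j)) * Gam (yb j) by ncring.
rewrite -XG -(Ycl _ (cl_th Cc)); ncring.
Qed.

Local Notation M := (minor X Y).

Definition refl_part (c : A) : A :=
  \sum_(s | refl s) kap s *: (Tg s * Gam (r s) * sder (r s) c).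

(** Twice the degree operator: a product of N distinct gammas of the frame is multiplied by 2N,
    since [sder] is twice the contraction. *)
Definition euler (c : A) : A := \sum_j Gam (yb j) * sder (yb j) c.

Lemma eulerL k a b : euler (k *: a + b) = k *: euler a + euler b.
Proof.
rewrite /euler scaler_sumr -big_split; apply: eq_bigr => j _ /=.
rewrite sderL; ncring.
Qed.

(** Here [F^+, c] is a sum of x_j times contractions of c. Applying F^- brings in [y_k, x_j], whose
    scalar part yields [euler] and whose reflection part yields [refl_part]. The remaining x_j y_k
    is paired with two contractions, which anticommute, so it antisymmetrises to minors. *)
Lemma proj_cl n c : cl n c -> proj c = c - 2%:R^-1 *: euler c - refl_part c
  - 4%:R^-1 *: \sum_j \sum_k M (yb j) (yb k) * sder (yb k) (sder (yb j) c).
Proof.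
move=> Cc; rewrite /proj (ad_raise_cl Cc) (lin_sum _ _ _ ad_lowerL).
rewrite (eq_bigr (fun j => Gam (yb j) * sder (yb j) c
   + \sum_(s | refl s) (2%:R * kap s) *: (Tg s * Gam (r s) * (B (r s) (yb j) *: sder (yb j) c))
   + \sum_k X (yb j) * Y (yb k) * sder (yb k) (sder (yb j) c))); last first.
  move=> j _; rewrite (ad_lower_cl _ (cl_sder _ Cc)) big_split /=; congr (_ + _).
  rewrite (eq_bigr (fun k => (B (yb k) (yb j) *: Gam (yb k)) * sder (yb j) c
    + \sum_(s | refl s) (2%:R * kap s * B (r s) (yb j)) *:
       (Tg s * (B (r s) (yb k) *: Gam (yb k)) * sder (yb j) c))) => [|k _].
    rewrite big_split /= -mulr_suml lin_frame //; congr (_ + _).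
    rewrite refl_sum_swap; apply: eq_bigr => s rs.
    rewrite -scaler_sumr -mulr_suml -mulr_sumr lin_frame' //; ncring.
  rewrite YX (mulrDl _ (\sum_(_ | _) _)) mulr_suml; congr (_ + _); first ncring.
  apply: eq_bigr => s _; ncring.
rewrite !big_split /= -/(euler c) !scalerDr !opprD !addrA; congr (_ - _ - _).
  rewrite refl_sum_swap scaler_sumr; apply: eq_bigr => s rs.
  rewrite -scaler_sumr -mulr_sumr (lin_frame' (sderLv c)) scalerA mulrA.
  by rewrite mulVf // mul1r.
set W := \sum_j _.
have E : \sum_j \sum_k X (yb k) * Y (yb j) * sder (yb k) (sder (yb j) c) = - W.
  rewrite /W exchange_big -sumrN; apply: eq_bigr => j _ /=; rewrite -sumrN.
  by apply: eq_bigr => k _; rewrite sder_anti mulrN.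
have -> : \sum_j \sum_k M (yb j) (yb k) * sder (yb k) (sder (yb j) c) = W + W.
  rewrite -{2}[W]opprK -E -sumrB; apply: eq_bigr => j _.
  rewrite -sumrB; apply: eq_bigr => k _; rewrite /minor; ncring.
have -> : 2%:R^-1 *: W = 4%:R^-1 *: (W + W); last by [].
rewrite -mulr2n -scaler_nat scalerA; congr (_ *: _).
by rewrite (natrM K 2 2) invfM -mulrA mulVf // mulr1.
Qed.

(** This trades a minor for an element of the supercentralizer, up to Clifford elements and
    reflection terms. Both halves of the argument use it to eliminate minors. *)
Lemma proj_gam2 u v :
  proj (Gam u * Gam v) = Gam v * Gam u - refl_part (Gam u * Gam v) - 2%:R *: M u v.
Proof.
have C2 : cl 2 (Gam u * Gam v) by apply/clG/cl_gam.
have sG w z : sder w (Gam z) = (2%:R * B z w) *: (1 : A).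
  by rewrite -[Gam z]mulr1 sderG sder1; ncring.
have s2 w : sder w (Gam u * Gam v) = (2%:R * B u w) *: Gam v - (2%:R * B v w) *: Gam u.
  rewrite sderG sG; ncring.
have s0 w z : sder z (sder w (Gam u * Gam v))
   = (4%:R * (B u w * B v z - B v w * B u z)) *: (1 : A).
  rewrite s2 (linD (sderL z)) linN ?(linZ (sderL z)) ?sG; [ncring | exact: sderL].
rewrite (proj_cl C2).
have -> : euler (Gam u * Gam v) = 2%:R *: (Gam u * Gam v) - 2%:R *: (Gam v * Gam u).
  rewrite /euler (eq_bigr (fun j => 2%:R *: ((B u (yb j) *: Gam (yb j)) * Gam v) -
     2%:R *: ((B v (yb j) *: Gam (yb j)) * Gam u))) => [|j _]; last by rewrite s2; ncring.
  by rewrite sumrB -!scaler_sumr -!mulr_suml !lin_frame'.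
have -> : \sum_j \sum_k M (yb j) (yb k) * sder (yb k) (sder (yb j) (Gam u * Gam v))
   = 8%:R *: M u v.
  rewrite (eq_bigr (fun j => 4%:R *: ((B u (yb j) *: X (yb j)) * Y v - (B v (yb j) *: X (yb j)) * Y u
     - (X v * (B u (yb j) *: Y (yb j)) - X u * (B v (yb j) *: Y (yb j)))))) => [|j _].
    rewrite -scaler_sumr !sumrB -!mulr_suml -!mulr_sumr !lin_frame' // /minor; ncring.
  rewrite (eq_bigr (fun k => 4%:R *: ((B u (yb j) *: X (yb j)) * (B v (yb k) *: Y (yb k))
      - (B v (yb j) *: X (yb j)) * (B u (yb k) *: Y (yb k))
     - ((B v (yb k) *: X (yb k)) * (B u (yb j) *: Y (yb j))
        - (B u (yb k) *: X (yb k)) * (B v (yb j) *: Y (yb j)))))) => [|k _].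
    by rewrite -scaler_sumr !sumrB -!mulr_suml -!mulr_sumr !lin_frame'.
  rewrite s0 /minor; ncring.
rewrite scalerBr !scalerA mulVf // (natrM K 4 2) mulrA mulVf ?pnatr_eq0 //.
ncring.
Qed.

Lemma euler_cl n c : cl n.+1 c -> cl n (euler c - (2 * n.+1)%:R *: c).
Proof.
(* For m = 0 the truncated [m.-1] is again 0 and says nothing, so the vanishing of [euler] in degree
   0 is carried along. *)
suff H m b : cl m b -> cl m.-1 (euler b - (2 * m)%:R *: b) /\ (m = 0%N -> euler b = 0).
  by move=> /H[].
have subE k := cl_sub k.
elim=> {m b} [|m|m k a b _ [IHa a0] _ [IHb b0]|m u a Ca [IH a0]|m a Ca [IH a0]].
- have -> : euler 1 = 0 by rewrite /euler big1 // => j _; rewrite sder1 mulr0.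
  by split=> //; rewrite muln0 scale0r subr0; apply: cl0.
- by rewrite (lin0 eulerL) scaler0 subr0; split=> //; apply: cl0.
- split=> [|m0]; last by rewrite eulerL a0 // b0 // scaler0 addr0.
  have -> : euler (k *: a + b) - (2 * m)%:R *: (k *: a + b)
     = k *: (euler a - (2 * m)%:R *: a) + (euler b - (2 * m)%:R *: b).
    rewrite eulerL; ncring.
  exact: clL.
- split=> //=.
  have -> : euler (Gam u * a) - (2 * m.+1)%:R *: (Gam u * a)
     = Gam u * (euler a - (2 * m)%:R *: a) - 2%:R *: sder u a.
    have -> : euler (Gam u * a) = 2%:R *: (Gam u * a) + Gam u * euler a - 2%:R *: sder u a.
      rewrite /euler (eq_bigr (fun j => 2%:R *: ((B u (yb j) *: Gam (yb j)) * a)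
         + Gam u * (Gam (yb j) * sder (yb j) a) - 2%:R *: (B u (yb j) *: sder (yb j) a))) => [|j _].
        rewrite sumrB big_split /= -!scaler_sumr -mulr_suml -mulr_sumr lin_frame' //.
        by rewrite (lin_frame' (sderLv a)).
      rewrite sderG.
      have -> : Gam (yb j) * ((2%:R * B u (yb j)) *: a - Gam u * sder (yb j) a)
         = 2%:R *: ((B u (yb j) *: Gam (yb j)) * a) + Gam u * (Gam (yb j) * sder (yb j) a)
           - (Gam u * Gam (yb j) + Gam (yb j) * Gam u) * sder (yb j) a by ncring.
      rewrite GG; ncring.
    rewrite mulnS natrD; ncring.
  apply: (subspaceB (subE _)); last first.
    exact/(subspaceZ (subE _))/(clW (leq_pred m))/cl_sder.
  case: m Ca IH a0 => [|m] Ca IH a0; last exact: clG.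
  by rewrite a0 // muln0 scale0r subr0 mulr0; apply: cl0.
- split=> //=; apply: (subspaceB (subE _)); last exact/(subspaceZ (subE _)).
  case: m Ca IH a0 => [|m] Ca IH a0; first by rewrite a0 //; apply: cl0.
  have -> : euler a = (euler a - (2 * m.+1)%:R *: a) + (2 * m.+1)%:R *: a by ncring.
  apply: (subspaceD (subE _)); first exact: clS.
  exact/(subspaceZ (subE _)).
Qed.

Lemma cl0_ind (P : A -> Prop) : subspace P -> P 1 -> forall c, cl 0 c -> P c.
Proof.
move=> sP P1 c; suff H m b : cl m b -> m = 0%N -> P b by move=> /H; apply.
elim=> {m b c} [|m|m k a b _ IHa _ IHb|//|//] m0 //; first exact: subspace0.
by case: sP => _; apply; [apply: IHa | apply: IHb].
Qed.

Lemma clS_ind (P : A -> Prop) n : subspace P -> (forall c, cl n c -> P c) ->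
  (forall v c, cl n c -> P (Gam v * c)) -> forall c, cl n.+1 c -> P c.
Proof.
move=> sP Pn PG c; suff H m b : cl m b -> m = n.+1 -> P b by move=> /H; apply.
elim=> {m b c} [|m|m k a b _ IHa _ IHb|m v a Ca _|m a Ca _] mn //.
- exact: subspace0.
- by case: sP => _; apply; [apply: IHa | apply: IHb].
- by apply: PG; case: mn => <-.
- by apply: Pn; case: mn => <-.
Qed.

(** * Pin lifts and the generated subalgebra S *)

Definition pin_word (us : seq V) : A := \prod_(u <- us) Gam u.

Definition pin_lift (i : I) (us : seq V) : Prop :=
  {in us, forall u, B u u = 1} /\
  forall v, act i v = foldr (fun u w => w - (2%:R * B u w) *: u) v us.

Context (refl_lift : forall s, refl s -> pin_lift s [:: r s]).
Context (lift_ex : forall i, exists us, pin_lift i us).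

Definition alternate n (t : n.-tuple V) : A :=
  (n`!%:R)^-1 *: \sum_(sigma : 'S_n)
     (-1) ^+ sigma *: \prod_(i < n) Gam (tnth t (sigma i)).

Inductive cent_generator : A -> Prop :=
| cent_generator_lift i us : pin_lift i us -> cent_generator (Tg i * pin_word us)
| cent_generator2 u v : cent_generator (- 2%:R^-1 *: proj (alternate [tuple u; v]))
| cent_generator3 u v w : cent_generator (- 2%:R^-1 *: proj (alternate [tuple u; v; w])).

Local Notation S := (generated_subalgebra cent_generator).

Lemma gen_sub a : cent_generator a -> S a.
Proof. by move=> Ga P _ _; apply. Qed.

Lemma gen_subspace : subspace S.
Proof.
split=> [P [P1 _] PL _|k a b Sa Sb P PM PL PG].
  by have := PL (-1) 1 1 P1 P1; rewrite scaleN1r addNr.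
exact: PL (Sa _ PM PL PG) (Sb _ PM PL PG).
Qed.

Lemma gen_one : S 1. Proof. by move=> P []. Qed.

Lemma gen_mul a b : S a -> S b -> S (a * b).
Proof.
move=> Sa Sb P PM PL PG; exact: PM.2 (Sa _ PM PL PG) (Sb _ PM PL PG).
Qed.

Lemma cl_word us : cl (size us) (pin_word us).
Proof.
rewrite /pin_word; elim: us => [|u us IH]; first by rewrite big_nil; apply: cl1.
by rewrite big_cons; apply: clG.
Qed.

Lemma pin_word_rev us : {in us, forall u, B u u = 1} ->
  pin_word us * pin_word (rev us) = 1.
Proof.
rewrite /pin_word; elim: us => [|u us IH] us1; first by rewrite big_nil mul1r.
rewrite rev_cons -cats1 big_cat big_seq1 big_cons /=.
have := IH (fun z zi => us1 z (mem_behead (s := u :: us) zi)).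
move: (\prod_(z <- us) _) (\prod_(z <- rev us) _) => a b ab.
have -> : Gam u * a * (b * Gam u) = Gam u * (a * b) * Gam u by rewrite !mulrA.
by rewrite ab mulr1 gam_sqr us1 ?mem_head // scale1r.
Qed.

(** Conjugation by a single gamma_u of unit length is minus the reflection along u. *)
Lemma pin_word_conj us : {in us, forall u, B u u = 1} -> forall v,
  pin_word us * Gam v = (-1) ^+ size us *:
    (Gam (foldr (fun u w => w - (2%:R * B u w) *: u) v us) * pin_word us).
Proof.
rewrite /pin_word; elim: us => [|u us IH] us1 v.
  by rewrite big_nil mul1r mulr1 scale1r.
rewrite big_cons -mulrA IH /= => [|z zi]; last by rewrite us1 // inE zi orbT.
move: (foldr _ _ _) (\prod_(z <- us) _) => w a.
have wE : Gam (w - (2%:R * B u w) *: u) = Gam w - (2%:R * B u w) *: Gam u.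
  by rewrite -scaleN1r scalerA addrC GL mulN1r scaleNr addrC.
have E : Gam u * Gam w = - (Gam (w - (2%:R * B u w) *: u) * Gam u).
  rewrite wE mulrBl -pres_scalerAl gam_sqr us1 ?mem_head // scale1r -GG; ncring.
rewrite -pres_scalerAr mulrA E exprS; ncring.
Qed.

Lemma th_word us : th (pin_word us) = (-1) ^+ size us *: pin_word us.
Proof.
rewrite /pin_word; elim: us => [|u us IH]; first by rewrite big_nil th1 scale1r.
rewrite big_cons thM thG IH /= exprS; ncring.
Qed.

(** In each summand of F^+ or F^- the group element moves the factor x_j or y_j, and the pin word
    moves gamma_j by the same orthogonal map up to the parity sign. The sum is preserved because the
    frame tensor is invariant. *)
Lemma cent_lift i us : pin_lift i us -> cent (Tg i * pin_word us).
Proof.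
case=> us1 actE; have Cw := cl_word us.
have H (Z : V -> A) : (forall k u v, Z (k *: u + v) = k *: Z u + Z v) ->
    (forall v, Tg i * Z v = Z (act i v) * Tg i) ->
    (forall v, Z v * pin_word us = pin_word us * Z v) ->
    (forall u v, Z u * Gam v = Gam v * Z u) ->
    Tg i * pin_word us * (\sum_j Z (yb j) * Gam (yb j))
    = (\sum_j Z (yb j) * Gam (yb j)) * th (Tg i * pin_word us).
  move=> ZL TZ Zw ZG; rewrite thM thT th_word.
  rewrite -[in RHS](act_frame i (phi := fun u v => Z u * Gam v)).
  - rewrite mulr_sumr mulr_suml; apply: eq_bigr => j _.
    have -> : Tg i * pin_word us * (Z (yb j) * Gam (yb j))
      = Tg i * (pin_word us * Z (yb j)) * Gam (yb j) by rewrite !mulrA.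
    rewrite -Zw mulrA TZ -(mulrA _ (pin_word _)) pin_word_conj // -actE.
    rewrite -!pres_scalerAr; congr (_ *: _).
    by rewrite -!mulrA; congr (_ * _); rewrite !mulrA TG.
  - by move=> w k u v; rewrite ZL; ncring.
  - by move=> w k u v; rewrite GL; ncring.
split; apply: H => // v; [exact: Xcl Cw | exact: Ycl Cw].
Qed.

Lemma cl_alternate n (t : n.-tuple V) : cl n (alternate t).
Proof.
apply: (subspaceZ (cl_sub _)); apply: (subspace_sum (cl_sub _)) => s _.
apply: (subspaceZ (cl_sub _)).
rewrite -(big_map (fun i => tnth t (s i)) xpredT Gam).
by have := cl_word (map (fun i => tnth t (s i)) (index_enum 'I_n)); rewrite size_map
  /index_enum -enumT size_enum_ord.
Qed.

Lemma gen_cent a : S a -> cent a.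
Proof.
move=> /(_ [pred b | `[< cent b >]]) Sa; apply/asboolP/Sa => [|k u v /asboolP cu /asboolP cv|b Gb].
- split=> [|u v /asboolP cu /asboolP cv]; apply/asboolP; first exact: cent1.
  exact: centM.
- by apply/asboolP; case: cent_sub => _; apply.
- apply/asboolP; case: Gb => [i us|u v|u v w]; first exact: cent_lift.
    exact/(subspaceZ cent_sub)/cent_proj/cl_alternate.
  exact/(subspaceZ cent_sub)/cent_proj/cl_alternate.
Qed.

Lemma gen_refl s : refl s -> S (Tg s * Gam (r s)).
Proof.
move=> /refl_lift/cent_generator_lift/gen_sub.
by rewrite /pin_word big_seq1.
Qed.

(** Hence T_i = (T_i c) c' lies in S times the Clifford algebra. *)
Lemma gen_group i : exists n c c', [/\ cl n c, cl n c', c * c' = 1 & S (Tg i * c)].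
Proof.
have [us [us1 actE]] := lift_ex i.
exists (size us), (pin_word us), (pin_word (rev us)); split; first exact: cl_word.
- by have := cl_word (rev us); rewrite size_rev.
- exact: pin_word_rev.
- exact/gen_sub/cent_generator_lift.
Qed.

Local Notation Sp := (fun a => S (proj a)).

(** * P maps the Clifford algebra into S *)

Lemma gen_proj_sub : subspace Sp.
Proof.
split=> [|k a b Sa Sb]; first by rewrite (lin0 projL); apply: (subspace0 gen_subspace).
by rewrite projL; apply: (gen_subspace.2).
Qed.

Lemma gen_proj_mull b a : S b -> S (proj a) -> S (proj (b * a)).
Proof. by move=> Sb Sa; rewrite projM; [apply: gen_mul | apply: gen_cent]. Qed.

(** Each summand of [refl_part a] is a generator T_s gamma_r of S times a contraction of lower
    degree, and P is left linear over S. *)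
Lemma gen_proj_refl_part m n a b : cl m a -> cl n b ->
  (forall c, cl (m.-1 + n) c -> S (proj c)) -> S (proj (refl_part a * b)).
Proof.
move=> Ca Cb SC; rewrite mulr_suml; apply: (subspace_sum gen_proj_sub) => s rs.
rewrite -pres_scalerAl -mulrA; apply: (subspaceZ gen_proj_sub); apply: gen_proj_mull.
  exact: gen_refl.
exact/SC/clM/Cb/cl_sder.
Qed.

(** In degree 1 the terms c and [euler c] / 2 cancel and second contractions vanish, so only
    reflection terms survive. *)
Lemma gen_proj_gam v : S (proj (Gam v)).
Proof.
have sG w z : sder w (Gam z) = (2%:R * B z w) *: (1 : A).
  by rewrite -[Gam z]mulr1 sderG sder1; ncring.
rewrite (proj_cl (cl_gam v)).
have -> : euler (Gam v) = 2%:R *: Gam v.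
  rewrite /euler -[in RHS](lin_frame' GL v) scaler_sumr; apply: eq_bigr => j _.
  rewrite sG; ncring.
have -> : \sum_j \sum_k M (yb j) (yb k) * sder (yb k) (sder (yb j) (Gam v)) = 0.
  rewrite big1 // => j _; rewrite big1 // => k _.
  by rewrite sG (linZ (sderL _)) sder1 scaler0 mulr0.
rewrite scaler0 subr0 scalerA mulVf // scale1r subrr sub0r.
apply/(subspaceN gen_subspace)/(subspace_sum gen_subspace) => s rs.
rewrite sG -pres_scalerAr mulr1.
by apply/(subspaceZ gen_subspace)/(subspaceZ gen_subspace)/gen_refl.
Qed.

Lemma left_mul_sub (P : A -> Prop) v : subspace P -> subspace (fun a => P (Gam v * a)).
Proof.
move=> sP; split=> [|k a b Pa Pb]; first by rewrite mulr0; apply: subspace0.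
by rewrite mulrDr -pres_scalerAr; case: sP => _; apply.
Qed.

(** Transposing two factors changes the sign of the product modulo lower degree. So the product and
    its antisymmetrisation agree modulo lower degree. *)
Lemma gen_proj_prod n (t : n.-tuple V) :
  (forall (h : 'I_n -> V) a b, a != b ->
     cl n.-1 (\prod_i Gam (h (tperm a b i)) + \prod_i Gam (h i))) ->
  (forall c, cl n.-1 c -> S (proj c)) ->
  S (proj (alternate t)) -> S (proj (\prod_i Gam (tnth t i))).
Proof.
move=> swap Slow Salt; pose f (s : 'S_n) := (-1) ^+ s *: \prod_i Gam (tnth t (s i)) : A.
have fE s : cl n.-1 (f 1%g - f s).
  have [ts -> _] := prod_tpermP s; elim: ts => [|[a b] ts IH].
    by rewrite big_nil subrr; apply: cl0.
  rewrite big_cons /=; move: (\prod_(z <- ts) _)%g IH => s' IH.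
  have [<-|nab] := eqVneq a b; first by rewrite tperm1 mul1g.
  have -> : f 1%g - f (tperm a b * s')%g = (f 1%g - f s') + (f s' - f (tperm a b * s')%g).
    ncring.
  apply: (subspaceD (cl_sub _)) => //.
  rewrite /f odd_permM odd_tperm nab addTb signrN scaleNr opprK -scalerDr.
  apply: (subspaceZ (cl_sub _)); rewrite addrC.
  have := swap (fun i => tnth t (s' i)) a b nab.
  congr (cl _ (_ + _)); apply: eq_bigr => i _.
  by rewrite permM.
have nf0 : n`!%:R != 0 :> K by rewrite pnatr_eq0 -lt0n fact_gt0.
have f1 : f 1%g = \prod_i Gam (tnth t i).
  by rewrite /f odd_perm1 scale1r; apply: eq_bigr => i _; rewrite perm1.
have -> : \prod_i Gam (tnth t i) = (n`!%:R)^-1 *: (\sum_s (f 1%g - f s)) + alternate t.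
  rewrite sumrB sumr_const card_Sn scalerBr /alternate subrK f1.
  by rewrite -scaler_nat scalerK.
apply: (subspaceD gen_proj_sub) => //; apply/(subspaceZ gen_proj_sub)/(subspace_sum gen_proj_sub) => s _.
exact/Slow/fE.
Qed.

Lemma gen_proj_cl1 c : cl 1 c -> S (proj c).
Proof.
apply: (clS_ind gen_proj_sub) => [|v]; apply: cl0_ind.
- exact: gen_proj_sub.
- by rewrite (proj_cent cent1); apply: gen_one.
- exact: (left_mul_sub v gen_proj_sub).
- by rewrite mulr1; apply: gen_proj_gam.
Qed.

Lemma gen_proj_gam2 u v : S (proj (Gam u * Gam v)).
Proof.
have E (g : 'I_2 -> A) : \prod_i g i = g ord0 * g ord_max.
  by rewrite big_ord_recl big_ord1; congr (_ * g _); apply: val_inj.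
have := @gen_proj_prod 2 [tuple u; v]; rewrite E /=; apply=> [h a b nab||].
- rewrite !E.
  have [-> ->] : tperm a b ord0 = ord_max /\ tperm a b ord_max = ord0.
    by case: a b nab => [[|[|//]] ha] [[|[|//]] hb] //= _; split; apply: val_inj;
      rewrite permE.
  rewrite GG; apply: (subspaceZ (cl_sub _)); exact/clS/cl1.
- exact: gen_proj_cl1.
- rewrite -[proj _](scalerK (a := - 2%:R^-1)) ?oppr_eq0 ?invr_eq0 //.
  exact/(subspaceZ gen_subspace)/gen_sub/cent_generator2.
Qed.

Lemma gen_proj_cl2 c : cl 2 c -> S (proj c).
Proof.
apply: (clS_ind gen_proj_sub gen_proj_cl1) => u.
apply: (clS_ind (left_mul_sub u gen_proj_sub)) => [{}c Cc|v].
  by apply: gen_proj_cl1; apply: clG.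
apply: (cl0_ind (left_mul_sub v (left_mul_sub u gen_proj_sub))).
by rewrite mulr1; apply: gen_proj_gam2.
Qed.

Lemma gen_proj_gam3 u v w : S (proj (Gam u * (Gam v * Gam w))).
Proof.
pose i1 : 'I_3 := lift ord0 ord0.
have E (g : 'I_3 -> A) : \prod_i g i = g ord0 * (g i1 * g ord_max).
  rewrite !big_ord_recl big_ord0 mulr1; congr (_ * (_ * g _)); exact: val_inj.
have := @gen_proj_prod 3 [tuple u; v; w]; rewrite E /=; apply=> [h a b nab||].
- have I3 (i : 'I_3) : [\/ i = ord0, i = i1 | i = ord_max].
    by case: i => [[|[|[|//]]] hi]; [apply: Or31 | apply: Or32 | apply: Or33]; apply: val_inj.
  have clZ (k : K) z : cl 2 (k *: Gam z) by apply/(subspaceZ (cl_sub 2))/clS/cl_gam.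
  have s01 p q t : cl 2 (Gam q * (Gam p * Gam t) + Gam p * (Gam q * Gam t)).
    by rewrite !mulrA -mulrDl GG -pres_scalerAl mul1r.
  have s12 p q t : cl 2 (Gam p * (Gam t * Gam q) + Gam p * (Gam q * Gam t)).
    by rewrite -mulrDr GG -pres_scalerAr mulr1.
  have s02 p q t : cl 2 (Gam t * (Gam q * Gam p) + Gam p * (Gam q * Gam t)).
    (* Exchanging the outer factors is a composite of three adjacent exchanges, one anticommutator
       each. *)
    have -> : Gam t * (Gam q * Gam p) + Gam p * (Gam q * Gam t)
      = Gam t * (Gam q * Gam p + Gam p * Gam q) + Gam p * (Gam q * Gam t + Gam t * Gam q)
        - (Gam t * Gam p + Gam p * Gam t) * Gam q by ncring.
    rewrite !GG -pres_scalerAl -!pres_scalerAr !mulr1 mul1r.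
    by apply: (subspaceB (cl_sub 2)) => //; apply: (subspaceD (cl_sub 2)).
  rewrite !E; move: nab; case: (I3 a) => ->; case: (I3 b) => -> //= _;
  by rewrite !permE /= ?(s01, s12, s02).
- exact: gen_proj_cl2.
- rewrite -[proj _](scalerK (a := - 2%:R^-1)) ?oppr_eq0 ?invr_eq0 //.
  exact/(subspaceZ gen_subspace)/gen_sub/cent_generator3.
Qed.
(* Applying proj to the formula [proj_cl] for [proj c] with c of degree N and      *)
(* eliminating the minors by [proj_gam2] leaves 4 N (N - 3) proj c as a combination *)
(* of elements of S and of proj of lower degree elements; here N = n + 4.           *)
Lemma gen_proj_step n : (forall c, cl n.+3 c -> S (proj c)) ->
  forall c, cl n.+4 c -> S (proj c).
Proof.
move=> IH c Cc; pose N := n.+4.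
pose W := \sum_j \sum_k M (yb j) (yb k) * sder (yb k) (sder (yb j) c).
have Cd j k : cl n.+2 (sder (yb k) (sder (yb j) c)) by apply/(cl_sder _ (n := n.+3))/(cl_sder _ (n := n.+4)).
(* The argument is c - P(c), which P kills because P(c) lies in the supercentralizer. *)
have SpE : S (proj (2%:R^-1 *: euler c + refl_part c + 4%:R^-1 *: W)).
  have -> : 2%:R^-1 *: euler c + refl_part c + 4%:R^-1 *: W = c - proj c.
    rewrite (proj_cl Cc) /W; ncring.
  rewrite addrC -scaleN1r projL (proj_cent (cent_proj Cc)) scaleN1r addNr.
  exact: (subspace0 gen_subspace).
have Spref : S (proj (refl_part c)).
  by rewrite -[refl_part c]mulr1; apply: (gen_proj_refl_part Cc cl1); rewrite addn0.
pose U := \sum_j \sum_k Gam (yb k) * Gam (yb j) * sder (yb k) (sder (yb j) c).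
(* Each minor in W is replaced by Clifford elements through [proj_gam2]; the errors are elements of
   S, or reflection terms, times elements of lower degree. *)
have SpWU : S (proj (2%:R *: W - U)).
  rewrite /W /U scaler_sumr -sumrB; apply: (subspace_sum gen_proj_sub) => j _.
  rewrite scaler_sumr -sumrB; apply: (subspace_sum gen_proj_sub) => k _.
  have -> : 2%:R *: (M (yb j) (yb k) * sder (yb k) (sder (yb j) c)) -
      Gam (yb k) * Gam (yb j) * sder (yb k) (sder (yb j) c)
    = - (proj (Gam (yb j) * Gam (yb k)) * sder (yb k) (sder (yb j) c))
      - refl_part (Gam (yb j) * Gam (yb k)) * sder (yb k) (sder (yb j) c).
    rewrite proj_gam2; ncring.
  apply: (subspaceB gen_proj_sub).
    apply: (subspaceN gen_proj_sub); apply: gen_proj_mull; first exact: gen_proj_gam2.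
    exact/IH/clS/Cd.
  apply: (gen_proj_refl_part _ (Cd j k)); first exact/clG/cl_gam.
  by rewrite add1n.
have UE : U = - \sum_k Gam (yb k) * euler (sder (yb k) c).
  rewrite /U exchange_big -sumrN; apply: eq_bigr => k _ /=.
  rewrite /euler mulr_sumr -sumrN; apply: eq_bigr => j _.
  by rewrite sder_anti mulrN mulrA.
have Speuler : S (proj (euler c - (2 * N)%:R *: c)) by apply: IH; exact: euler_cl.
(* A contraction of c has degree N - 1 = n + 3, where [euler] is 2 (N - 1) modulo lower degree. *)
have SpU : S (proj (U + (2 * n.+3)%:R *: euler c)).
  rewrite UE /euler scaler_sumr addrC -sumrB; apply: (subspace_sum gen_proj_sub) => k _.
  have -> : (2 * n.+3)%:R *: (Gam (yb k) * sder (yb k) c) - Gam (yb k) * euler (sder (yb k) c)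
    = - (Gam (yb k) * (euler (sder (yb k) c) - (2 * n.+3)%:R *: sder (yb k) c)) by ncring.
  apply/(subspaceN gen_proj_sub)/IH/clG/euler_cl; exact: (cl_sder _ (n := n.+4)).
(* The coefficients of [euler c] cancel, -4 + 2 (n + 3) - 2 (n + 1) = 0, as do those of W, U and
   [refl_part c]; c is left with 4 N (N - 3). *)
have E : (4 * N * n.+1)%:R *: c =
    - (8%:R *: (2%:R^-1 *: euler c + refl_part c + 4%:R^-1 *: W))
    + (8%:R *: refl_part c + (2%:R *: W - U) + (U + (2 * n.+3)%:R *: euler c))
    - (2 * n.+1)%:R *: (euler c - (2 * N)%:R *: c).
  rewrite /N -[n.+4]addn4 -[n.+3]addn3 -[n.+1]addn1 !(natrM, natrD).
  have e2 : 2%:R^-1 *: euler c = (4%:R * 8%:R^-1) *: euler c.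
    by congr (_ *: _); rewrite (natrM K 4 2) invfM mulrA divff ?mul1r ?pnatr_eq0.
  have e4 : 4%:R^-1 *: W = (2%:R * 8%:R^-1) *: W.
    by congr (_ *: _); rewrite (natrM K 2 4) invfM mulrA divff ?mul1r ?pnatr_eq0.
  have e8 b : 8%:R *: b = (2%:R * 2%:R * 2%:R) *: b by rewrite -!natrM.
  rewrite e2 e4 !scalerDr !scalerA ![8%:R * (_ * _)]mulrCA divff ?pnatr_eq0 // !mulr1.
  ncring.
have k0 : (4 * N * n.+1)%:R != 0 :> K by rewrite pnatr_eq0.
rewrite -[c](scalerK k0) E; apply: (subspaceZ gen_proj_sub); apply: (subspaceB gen_proj_sub); last exact: (subspaceZ gen_proj_sub).
apply: (subspaceD gen_proj_sub); first exact/(subspaceN gen_proj_sub)/(subspaceZ gen_proj_sub).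
apply: (subspaceD gen_proj_sub) => //; apply: (subspaceD gen_proj_sub) => //.
exact: (subspaceZ gen_proj_sub).
Qed.

(** Degrees up to 3 are treated apart: the factor N - 3 vanishes in degree 3, and the elimination of
    minors in [gen_proj_step] already relies on degree 2. *)
Lemma gen_proj_cl n c : cl n c -> S (proj c).
Proof.
elim: n c => [|n IHn] c; first by move/clS; apply: gen_proj_cl1.
case: n IHn => [|[|[|n]]] IHn.
- exact: gen_proj_cl1.
- exact: gen_proj_cl2.
- apply: (clS_ind gen_proj_sub IHn) => u.
  apply: (clS_ind (left_mul_sub u gen_proj_sub)) => [{}c Cc|v].
    by apply: IHn; apply: clG.
  have su := left_mul_sub v (left_mul_sub u gen_proj_sub).
  apply: (clS_ind su) => [{}c Cc|w]; first by apply: IHn; do 2!apply: clG.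
  apply: (cl0_ind (left_mul_sub w su)).
  by rewrite mulr1; apply: gen_proj_gam3.
- exact: gen_proj_step IHn _.
Qed.

(** * The centralizer of sl_2 lies in S times the Clifford algebra *)

Inductive cl_span : A -> Prop :=
| cl_spanM d n c : S d -> cl n c -> cl_span (d * c)
| cl_spanL k a b : cl_span a -> cl_span b -> cl_span (k *: a + b).

Lemma cl_span_sub : subspace cl_span.
Proof.
split; last by move=> *; apply: cl_spanL.
by rewrite -(mulr0 1); apply: (cl_spanM gen_one (cl0 0)).
Qed.

Lemma gen_proj_cl_span a : cl_span a -> S (proj a).
Proof.
elim=> {a} [b n c Sb Cc|k a b _ Sa _ Sb]; first exact/gen_proj_mull/gen_proj_cl/Cc.
exact: (gen_proj_sub.2).
Qed.

Inductive group_coef : A -> Prop :=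
| group_coefT i n c : cl n c -> group_coef (Tg i * c)
| group_coefL k a b : group_coef a -> group_coef b -> group_coef (k *: a + b).

Lemma group_coef_sub : subspace group_coef.
Proof.
split; last by move=> *; apply: group_coefL.
by have [i _] := T1; rewrite -(mulr0 (Tg i)); apply/(group_coefT _ (n := 0))/cl0.
Qed.

(** The prefix b c makes the induction close. The Clifford factor c commutes with a leading minor,
    which [proj_gam2] then resolves into a part absorbed by b in S, a part absorbed by c, and
    reflection terms absorbed by both. *)
Lemma cl_span_minor a : minor_span X Y group_coef a ->
  forall b n c, S b -> cl n c -> cl_span (b * c * a).
Proof.
elim=> {a} [a Ca|k a a' _ IHa _ IHa'|u v a _ IH] b n c Sb Cc.
- elim: Ca => {a} [i m c' Cc'|k a a' _ IHa _ IHa']; last first.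
    by rewrite mulrDr -pres_scalerAr; apply: cl_spanL.
  have [p [z [z' [Cz Cz' zz' Sz]]]] := gen_group i.
  have -> : b * c * (Tg i * c') = (b * (Tg i * z)) * (z' * (c * c')).
    have -> : b * (Tg i * z) * (z' * (c * c')) = b * (Tg i * (z * z') * c) * c' by ncring.
    by rewrite zz' mulr1 (Tcl _ Cc) !mulrA.
  by apply: cl_spanM; [apply: gen_mul | exact: clM Cz' (clM Cc Cc')].
- by rewrite mulrDr -pres_scalerAr; apply: cl_spanL; [apply: IHa Cc | apply: IHa' Cc].
- have -> : b * c * (M u v * a) = 2%:R^-1 *: (b * (2%:R *: M u v) * c * a).
    have Mc : M u v * c = c * M u v.
      apply: cl_commute Cc => w; rewrite /minor mulrBl mulrBr.
      by rewrite -(mulrA (X u)) -(mulrA (X v)) !YG !mulrA !XG.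
    have -> : b * (2%:R *: M u v) * c * a = 2%:R *: (b * (M u v * c) * a) by ncring.
    by rewrite Mc scalerA mulVf // scale1r !mulrA.
  apply: (subspaceZ cl_span_sub).
  have -> : 2%:R *: M u v = Gam v * Gam u - refl_part (Gam u * Gam v) - proj (Gam u * Gam v).
    rewrite proj_gam2; ncring.
  rewrite mulrBr mulrBl mulrBr !mulrBl; apply: (subspaceB cl_span_sub); last first.
    by apply: IH Cc; apply: gen_mul => //; apply: gen_proj_gam2.
  apply: (subspaceB cl_span_sub).
    by rewrite -(mulrA b); apply: (IH _ n.+2) => //; rewrite -mulrA; do 2!apply: clG.
  rewrite mulr_sumr !mulr_suml; apply: (subspace_sum cl_span_sub) => s rs.
  have -> : b * (kap s *: (Tg s * Gam (r s) * sder (r s) (Gam u * Gam v))) * c * a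
    = kap s *: (b * (Tg s * Gam (r s)) * (sder (r s) (Gam u * Gam v) * c) * a) by ncring.
  apply/(subspaceZ cl_span_sub)/(IH _ (1 + n)%N); first exact: gen_mul (gen_refl rs).
  by apply: clM => //; apply/(cl_sder _ (n := 2))/clG/cl_gam.
Qed.

Context (gen_ind : forall P : A -> Prop, subspace P -> P 1 ->
  (forall v a, P a -> P (X v * a)) -> (forall v a, P a -> P (Y v * a)) ->
  (forall i a, P a -> P (Tg i * a)) -> (forall v a, P a -> P (Gam v * a)) ->
  forall a, P a).

Lemma group_coef_T i a : group_coef a -> group_coef (Tg i * a).
Proof.
elim=> {a} [j n c Cc|k a b _ IHa _ IHb].
  by have [k ijk] := TT i j; rewrite mulrA ijk; apply: group_coefT Cc.
by rewrite mulrDr -pres_scalerAr; apply: group_coefL.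
Qed.

Lemma group_coef_commute z : (forall i, Tg i * z = z * Tg i) ->
  (forall v, z * Gam v = Gam v * z) -> forall a, group_coef a -> a * z = z * a.
Proof.
move=> zT zG a; elim=> {a} [i n c Cc|k a b _ IHa _ IHb].
  by rewrite -(mulrA _ c) -(cl_commute zG Cc) !mulrA zT.
by rewrite mulrDl mulrDr -pres_scalerAr -pres_scalerAl IHa IHb.
Qed.

Local Notation wfilt := (wfilt X Y group_coef).

Lemma wfiltW m n a : (m <= n)%N -> wfilt m a -> wfilt n a.
Proof.
by move=> /subnK <-; elim: (n - m)%N => // k IH /IH; rewrite addSn; apply: wfiltS.
Qed.

Lemma wfilt_gam n v a : wfilt n a -> wfilt n (Gam v * a).
Proof.
elim=> {n a} [a Ca|n|n k a b _ IHa _ IHb|n u a _ IH|n u a _ IH|n a _ IH].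
- apply: wfilt_coef; elim: Ca => {a} [i m c Cc|k a b _ IHa _ IHb].
    by rewrite mulrA -TG -mulrA; apply: group_coefT (clG v Cc).
  by rewrite mulrDr -pres_scalerAr; apply: group_coefL.
- rewrite mulr0; exact: wfilt0.
- by rewrite mulrDr -pres_scalerAr; apply: wfiltL.
- by rewrite mulrA -XG -mulrA; apply: wfiltX.
- by rewrite mulrA -YG -mulrA; apply: wfiltY.
- exact: wfiltS.
Qed.

Lemma wfilt_exhaustive a : exists n, wfilt n a.
Proof.
elim/gen_ind: a => [||v a [n Fa]|v a [n Fa]|i a [n Fa]|v a [n Fa]].
- split=> [|k a b [m Fa] [n Fb]]; first by exists 0; apply: wfilt0.
  exists (maxn m n); apply: wfiltL.
    exact: wfiltW (leq_maxl _ _) Fa.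
  exact: wfiltW (leq_maxr _ _) Fb.
- have [i <-] := T1; exists 0; apply: wfilt_coef; rewrite -[Tg i]mulr1.
  exact/(group_coefT _ (n := 0))/cl1.
- by exists n.+1; apply: wfiltX.
- by exists n.+1; apply: wfiltY.
- by exists n; apply: (wfilt_T group_coef_T TX TY).
- by exists n; apply: wfilt_gam.
Qed.

Theorem cent_generated a : cent a <-> S a.
Proof.
split=> [ca|]; last exact: gen_cent.
rewrite -(proj_cent ca); apply: gen_proj_cl_span.
rewrite -[a]mul1r -[1]mulr1; apply: cl_span_minor gen_one cl1.
have [n Fa] := wfilt_exhaustive a.
have YX' u v : exists c : I -> K, Y u * X v - X v * Y u = \sum_i c i *: Tg i.
  have [i1 Ti1] := T1.
  (* The scalar term becomes a coefficient of the index whose group element is 1. *)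
  exists (fun i => (if i == i1 then B u v else 0) +
    if refl i then 2%:R * kap i * B (r i) u * B (r i) v else 0).
  rewrite YX; under [RHS]eq_bigr do rewrite scalerDl; rewrite big_split /=; congr (_ + _).
    rewrite (bigD1 i1) //= eqxx Ti1 big1 ?addr0 // => i ni1.
    by rewrite (negPf ni1) scale0r.
  by rewrite big_mkcond; apply: eq_bigr => i _; case: ifP; rewrite ?scale0r.
apply: (sl2_invariant_span group_coef_sub group_coef_T _ _ TX TY XX YY YX'
  X_raise2 Y_raise2 lower2_X Y_lower2 Fa (cent_raise2 ca) (cent_lower2 ca)).
- exact: group_coef_commute T_raise2 raise2_gam.
- exact: group_coef_commute T_lower2 lower2_gam.
Qed.

(** * Comparison with the bilinear supercommutator *)

Definition hom_part (i : bool) (a : A) : A := 2%:R^-1 *: (a + (-1) ^+ i *: th a).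
Definition supercomm (a b : A) : A := \sum_(i : bool) \sum_(j : bool)
  (hom_part i a * hom_part j b - (-1) ^+ (i * j)%N *: (hom_part j b * hom_part i a)).

Lemma hom_partL i k a b : hom_part i (k *: a + b) = k *: hom_part i a + hom_part i b.
Proof. rewrite /hom_part thL; ncring. Qed.

Lemma hom_part_sum a : hom_part false a + hom_part true a = a.
Proof.
rewrite /hom_part -scalerDr expr0 expr1 scale1r scaleN1r addrACA subrr addr0.
by rewrite -mulr2n -scaler_nat scalerA mulVf // scale1r.
Qed.

Lemma hom_part_diff a : hom_part false a - hom_part true a = th a.
Proof.
rewrite /hom_part -scalerBr expr0 expr1 scale1r scaleN1r opprD opprK addrACA subrr add0r.
by rewrite -mulr2n -scaler_nat scalerA mulVf // scale1r.
Qed.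

Lemma hom_part_homog (i j : bool) a : th a = (-1) ^+ i *: a ->
  hom_part j a = if i == j then a else 0.
Proof.
move=> tha; rewrite /hom_part tha scalerA -signr_addb.
case: i j {tha} => [] [] /=; rewrite ?expr0 ?expr1 ?scale1r ?scaleN1r ?subrr ?scaler0 //;
by rewrite -mulr2n -scaler_nat scalerA mulVf // scale1r.
Qed.

Lemma supercommE a b :
  supercomm a b = a * b - (hom_part false b * a + hom_part true b * th a).
Proof.
rewrite /supercomm !big_bool /= -hom_part_diff.
have -> : a * b = (hom_part false a + hom_part true a) * (hom_part false b + hom_part true b).
  by rewrite !hom_part_sum.
have -> : hom_part false b * a = hom_part false b * (hom_part false a + hom_part true a).
  by rewrite hom_part_sum.
rewrite !(mul0n, muln0, mul1n); ncring.
Qed.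

Lemma supercommLr a k b c : supercomm a (k *: b + c) = k *: supercomm a b + supercomm a c.
Proof. rewrite !supercommE !hom_partL; ncring. Qed.

Lemma supercomm_odd_r a b : th b = - b -> supercomm a b = a * b - b * th a.
Proof.
move=> thb; have thb' : th b = (-1) ^+ true *: b by rewrite thb expr1 scaleN1r.
by rewrite supercommE !(hom_part_homog _ thb') /= mul0r add0r.
Qed.

Lemma supercomm_even_r a b : th b = b -> supercomm a b = a * b - b * a.
Proof.
move=> thb; have thb' : th b = (-1) ^+ false *: b by rewrite thb expr0 scale1r.
by rewrite supercommE !(hom_part_homog _ thb') /= mul0r addr0.
Qed.

Lemma supercomm_odd_l a b : th a = - a -> supercomm a b = a * b - th b * a.
Proof.
by move=> tha; rewrite supercommE tha -(hom_part_diff b); ncring.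
Qed.

Lemma proj_supercomm (t : K) a : t * t = 2%:R^-1 ->
  a - supercomm (t *: Fm) (supercomm (t *: Fp) a) = proj a.
Proof.
move=> tt; have odd F : th F = - F -> th (t *: F) = - (t *: F).
  by move=> tF; rewrite (linZ thL) tF scalerN.
rewrite !supercomm_odd_l ?odd ?th_raise ?th_lower // /proj -tt.
rewrite /ad_lower /ad_raise !(thB, thM, linZ thL, th_raise, thK); ncring.
Qed.

Lemma th_raise2 : th Ep = Ep.
Proof.
apply: (scalerI two0); rewrite -(linZ thL) -raise_sqr thM th_raise; ncring.
Qed.
Lemma th_lower2 : th Em = Em.
Proof.
apply: (scalerI two0); rewrite -(linZ thL) -lower_sqr thM th_lower; ncring.
Qed.
Lemma th_cartan2 : th cartan2 = cartan2.
Proof.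
rewrite -anticomm_FpFm (linD thL) !thM th_raise th_lower; ncring.
Qed.

Lemma cartan2_half : 2%:R^-1 *: cartan2 = \sum_j X (yb j) * Y (yb j)
  + (d%:R / 2%:R) *: (1 : A) + \sum_(s | refl s) kap s *: Tg s.
Proof.
rewrite /cartan2 !scalerDr !scalerA mulVf // !scale1r.
by rewrite [2%:R^-1 * _]mulrC.
Qed.

(** Supercommuting with F^+ and F^- suffices: E^+ and E^- come from their squares, H from their
    anticommutator. *)
Lemma supercentP (t : K) a : t != 0 ->
  (forall b, (exists k1 k2 k3 k4 k5 : K, b = k1 *: (t *: Fp) + k2 *: (t *: Fm)
       + k3 *: (2%:R^-1 *: cartan2) + k4 *: Ep + k5 *: (- Em)) -> supercomm a b = 0)
  <-> cent a.
Proof.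
move=> t0; have oddP F : th F = - F -> supercomm a (t *: F) = t *: (a * F - F * th a).
  move=> tF; rewrite supercomm_odd_r ?(linZ thL) ?tF ?scalerN //; ncring.
split=> [H|ca].
  split; apply/eqP; rewrite -subr_eq0; apply/eqP/(scalerI t0); rewrite -oddP ?scaler0.
  - by apply: H; exists 1, 0, 0, 0, 0; rewrite !scale0r !addr0 scale1r.
  - exact: th_raise.
  - by apply: H; exists 0, 1, 0, 0, 0; rewrite !scale0r !addr0 add0r scale1r.
  - exact: th_lower.
have [aP aM] := ca.
have sub0 : subspace (fun b => supercomm a b = 0).
  split=> [|k b c b0 c0]; first by rewrite (lin0 (supercommLr a)).
  by rewrite supercommLr b0 c0 scaler0 addr0.
move=> b [k1 [k2 [k3 [k4 [k5 ->]]]]].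
do 4?[apply: (subspaceD sub0)]; apply: (subspaceZ sub0).
- by rewrite oddP ?th_raise // aP subrr scaler0.
- by rewrite oddP ?th_lower // aM subrr scaler0.
- apply: (subspaceZ sub0); rewrite supercomm_even_r ?th_cartan2 //.
  apply/eqP; rewrite subr_eq0 -anticomm_FpFm mulrDr mulrDl !mulrA aP aM.
  have [taP taM] : cent (th a).
    by split; rewrite thK; [have /(congr1 th) := aP | have /(congr1 th) := aM];
      rewrite !thM ?th_raise ?th_lower thK mulrN mulNr => /oppr_inj.
  by rewrite -(mulrA Fp) -(mulrA Fm) taM taP thK !mulrA.
- by rewrite supercomm_even_r ?th_raise2 // cent_raise2 // subrr.
- apply: (subspaceN sub0).
  by rewrite supercomm_even_r ?th_lower2 // cent_lower2 // subrr.
Qed.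

End OspSupercentralizer.

(** * Presented algebras and tensor products *)

Section PresentedAlgebra.
Context (K : fieldType) (T : choiceType) (R : freeAlg K T -> Prop).
Local Notation A := (presAlg R).

Lemma pres_rel (a b : freeAlg K T) : R (a - b) -> pres_pi R a = pres_pi R b.
Proof. by move=> Rab; apply/pres_piP/ideal_rel. Qed.

Lemma pres_piB (a b : freeAlg K T) : pres_pi R (a - b) = pres_pi R a - pres_pi R b.
Proof. by rewrite pres_piD pres_piN. Qed.

Lemma pres_piC (k : K) : pres_pi R k%:MP = k *: (1 : A).
Proof. by rewrite -pres_pi1 -pres_piZ -mul_malgC mulr1. Qed.

Lemma pres_pi_sum (I : Type) (s : seq I) (P : pred I) (F : I -> freeAlg K T) :
  pres_pi R (\sum_(i <- s | P i) F i) = \sum_(i <- s | P i) pres_pi R (F i).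
Proof. by apply: (big_morph _ (pres_piD R)). Qed.

Lemma pres_word_ind (P : A -> Prop) : subspace P -> P 1 ->
  (forall t a, P a -> P (pres_gen R t * a)) -> forall a, P a.
Proof.
move=> sP P1 Pgen; elim/presAlg_ind => f.
rewrite (monalgE f) pres_pi_sum; apply: (subspace_sum sP) => m _.
have -> : mkmalgU m f@_m = f@_m *: mkmalgU m 1 :> freeAlg K T.
  by apply/malgP => m'; rewrite mcoeffZ !mcoeffU mulr_natr.
rewrite pres_piZ; apply: (subspaceZ sP); case: m => s.
elim: s => [|t s IH].
  suff -> : mkmalgU (FMonom [::]) 1 = 1 :> freeAlg K T by rewrite pres_pi1.
  by rewrite -fmoneE.
suff -> : mkmalgU (FMonom (t :: s)) 1 = fgen K t * mkmalgU (FMonom s) 1 :> freeAlg K T.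
  by rewrite pres_piM; apply: Pgen.
rewrite /fgen [RHS]fgmulUU mulr1; congr mkmalgU.
by rewrite [RHS]fmmulE fmuE.
Qed.
End PresentedAlgebra.

Section TensorAlgebra.
Context (K : fieldType) (T1 T2 : choiceType).
Context (R1 : freeAlg K T1 -> Prop) (R2 : freeAlg K T2 -> Prop).
Local Notation A := (tensorAlg R1 R2).

Lemma tensorL k a a' b :
  tensor (k *: a + a') b = k *: (tensor a b : A) + tensor a' b.
Proof.
by rewrite /tensor /pres_gen -pres_piZ -pres_piD; apply/pres_rel/tensor_linl.
Qed.

Lemma tensorR k a b b' :
  tensor a (k *: b + b') = k *: (tensor a b : A) + tensor a b'.
Proof.
by rewrite /tensor /pres_gen -pres_piZ -pres_piD; apply/pres_rel/tensor_linr.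
Qed.

Lemma tensorM a a' b b' :
  tensor a b * tensor a' b' = tensor (a * a') (b * b') :> A.
Proof. by rewrite /tensor /pres_gen -pres_piM; apply/pres_rel/tensor_mul. Qed.

Lemma tensor1 : tensor 1 1 = 1 :> A.
Proof. by rewrite -pres_pi1; apply/pres_rel/tensor_one. Qed.

Lemma tensor_split a b : tensor a b = tensor a 1 * tensor 1 b :> A.
Proof. by rewrite tensorM mulr1 mul1r. Qed.

Lemma tensor_comm a b : tensor a 1 * tensor 1 b = tensor 1 b * tensor a 1 :> A.
Proof. by rewrite !tensorM !mulr1 !mul1r. Qed.

Lemma tensorl_mul a b : tensor (a * b) 1 = tensor a 1 * tensor b 1 :> A.
Proof. by rewrite tensorM mulr1. Qed.

Lemma tensorr_mul a b : tensor 1 (a * b) = tensor 1 a * tensor 1 b :> A.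
Proof. by rewrite tensorM mulr1. Qed.

Lemma tensorl_lin k a b : tensor (k *: a + b) 1 = k *: (tensor a 1 : A) + tensor b 1.
Proof. exact: tensorL. Qed.

Lemma tensorr_lin k a b : tensor 1 (k *: a + b) = k *: (tensor 1 a : A) + tensor 1 b.
Proof. exact: tensorR. Qed.

Lemma tensorl_eq a b c e : a * b = c * e ->
  tensor a 1 * tensor b 1 = tensor c 1 * tensor e 1 :> A.
Proof. by rewrite -!tensorl_mul => ->. Qed.

Lemma tensorl_bracket (I : finType) (P : pred I) a b c e k (l : I -> K)
    (g : I -> presAlg R1) :
  a * b - c * e = k *: (1 : presAlg R1) + \sum_(i | P i) l i *: g i ->
  tensor a 1 * tensor b 1 - tensor c 1 * tensor e 1
    = k *: (1 : A) + \sum_(i | P i) l i *: tensor (g i) 1.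
Proof.
move=> E; rewrite -!tensorl_mul -(linN tensorl_lin) -(linD tensorl_lin) E.
rewrite tensorl_lin tensor1 (lin_sum _ _ _ tensorl_lin); congr (_ + _).
by apply: eq_bigr => i _; rewrite (linZ tensorl_lin).
Qed.

Lemma tensorr_anticomm a b c e k : a * b + c * e = k *: (1 : presAlg R2) ->
  tensor 1 a * tensor 1 b + tensor 1 c * tensor 1 e = k *: (1 : A).
Proof.
by move=> E; rewrite -!tensorr_mul -(linD tensorr_lin) E (linZ tensorr_lin) tensor1.
Qed.

Lemma tensor_sum (I : finType) (a : I -> presAlg R1) (b : I -> presAlg R2) :
  \sum_(i : I) tensor (a i) (b i) = \sum_(i : I) tensor (a i) 1 * tensor 1 (b i) :> A.
Proof. by apply: eq_bigr => i _; rewrite tensor_split. Qed.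

Lemma tensorl_sqr (I : finType) k (a : I -> presAlg R1) :
  tensor (k *: \sum_(i : I) a i ^+ 2) 1 = k *: \sum_(i : I) (tensor (a i) 1 * tensor (a i) 1 : A).
Proof.
rewrite (linZ tensorl_lin) (lin_sum _ _ _ tensorl_lin); congr (_ *: _).
by apply: eq_bigr => i _; rewrite expr2 tensorl_mul.
Qed.

Lemma tensorl_cartan (I J : finType) (P : pred J) (a b : I -> presAlg R1) k (l : J -> K)
    (g : J -> presAlg R1) :
  tensor (\sum_(i : I) a i * b i + k *: (1 : presAlg R1) + \sum_(j | P j) l j *: g j) 1
  = \sum_(i : I) tensor (a i) 1 * tensor (b i) 1 + k *: (1 : A)
    + \sum_(j | P j) l j *: tensor (g j) 1.
Proof.
rewrite !(linD tensorl_lin) (linZ tensorl_lin) tensor1 !(lin_sum _ _ _ tensorl_lin).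
congr (_ + _ + _); apply: eq_bigr => i _; first exact: tensorl_mul.
by rewrite (linZ tensorl_lin).
Qed.

Lemma tensor_prod (I : Type) (r : seq I) a (c : I -> presAlg R2) :
  tensor a (\prod_(i <- r) c i) = tensor a 1 * \prod_(i <- r) (tensor 1 (c i) : A).
Proof.
rewrite tensor_split; congr (_ * _).
by apply: (big_morph (fun b => tensor 1 b : A) tensorr_mul); exact: tensor1.
Qed.

Lemma tensorr_alternate n k (F : 'S_n -> K) (c : 'I_n -> presAlg R2) (g : 'I_n -> A) :
  (forall i, tensor 1 (c i) = g i) ->
  tensor 1 (k *: \sum_s F s *: \prod_(i < n) c (s i))
  = k *: \sum_s F s *: \prod_(i < n) g (s i).
Proof.
move=> cg; rewrite (linZ tensorr_lin) (lin_sum _ _ _ tensorr_lin); congr (_ *: _).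
apply: eq_bigr => s _; rewrite (linZ tensorr_lin); congr (_ *: _).
rewrite (big_morph (fun b => tensor 1 b : A) tensorr_mul tensor1).
by apply: eq_bigr => i _; apply: cg.
Qed.

(** A pure tensor factors as (h (x) 1)(1 (x) c), and h and c are combinations of words in their own
    generators. *)
Lemma tensor_word_ind (P : A -> Prop) : subspace P -> P 1 ->
  (forall t a, P a -> P (tensor (pres_gen R1 t) 1 * a)) ->
  (forall t a, P a -> P (tensor 1 (pres_gen R2 t) * a)) -> forall a, P a.
Proof.
move=> sP P1 Pl Pr; apply: pres_word_ind => // -[h c] a.
rewrite -[pres_gen _ _]/(tensor h c) tensor_split -mulrA => Pa.
have {Pa} : P (tensor 1 c * a).
  move: c a Pa; apply: (pres_word_ind (P := fun c => forall a, P a -> P (tensor 1 c * a)))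
    => [|a|t c IH a Pa].
  - split=> [a _|k b c IHb IHc a Pa].
      have -> : tensor 1 0 = 0 :> A by rewrite (lin0 (fun k => tensorR k 1)).
      by rewrite mul0r; apply: (subspace0 sP).
    by rewrite tensorR mulrDl -pres_scalerAl; apply: (sP.2); [apply: IHb | apply: IHc].
  - by rewrite tensor1 mul1r.
  - by rewrite -[in tensor _ _](mul1r 1) -tensorM -mulrA; apply/Pr/IH.
move: (_ * a) => {a c}a; move: h a.
apply: (pres_word_ind (P := fun h => forall a, P a -> P (tensor h 1 * a)))
  => [|a|t h IH a Pa].
- split=> [a _|k b c IHb IHc a Pa].
    have -> : tensor 0 1 = 0 :> A by rewrite (lin0 (fun k a b => tensorL k a b 1)).
    by rewrite mul0r; apply: (subspace0 sP).
  by rewrite tensorL mulrDl -pres_scalerAl; apply: (sP.2); [apply: IHb | apply: IHc].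
- by rewrite tensor1 mul1r.
- by rewrite -[in tensor _ _](mul1r 1) -tensorM -mulrA; apply/Pl/IH.
Qed.
End TensorAlgebra.

(** * Orthogonal geometry *)

Section OrthogonalGeometry.
Context (C : numClosedFieldType) (V : vectType C) (B : {symmetric V}).
Context (ndB : nondegenerate B).
Implicit Types (u v w : V) (g s : 'End(V)).

Lemma bformC u v : B u v = B v u.
Proof. by rewrite hermC expr0 mul1r. Qed.

Lemma bform_nondeg u : (forall v, B u v = 0) -> u = 0.
Proof.
by move=> uV; apply/eqP; rewrite -memv0 -(eqP ndB); apply/mem_orthovP => v _.
Qed.

Lemma bformR k u v w : B w (k *: u + v) = k * B w u + B w v.
Proof. by rewrite linearPr. Qed.
Lemma bformZ k u w : B (k *: u) w = k * B u w.
Proof. by rewrite linearZl_LR. Qed.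
Lemma bformZr k u w : B w (k *: u) = k * B w u.
Proof. by rewrite bformC bformZ bformC. Qed.
Lemma bform_sumr (I : finType) (F : I -> V) w : B w (\sum_i F i) = \sum_i B w (F i).
Proof.
apply: (big_morph (fun u => B w u)) => [u v|]; last exact: linear0r.
by rewrite -[u]scale1r bformR mul1r scale1r.
Qed.

Lemma orthogonal_map_ker g : orthogonal_map B g -> lker g == 0%VS.
Proof.
move=> og; rewrite -subv0; apply/subvP => u; rewrite memv_ker => /eqP gu.
rewrite memv0; apply/eqP/bform_nondeg => v.
by rewrite -og gu linear0l.
Qed.

Lemma orthogonal_mapV g u v : orthogonal_map B g -> B u (g^-1%VF v) = B (g u) v.
Proof. by move=> og; rewrite -og lker0_lfunVK // orthogonal_map_ker. Qed.

Lemma contragredient_beta g u : orthogonal_map B g ->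
  contragredient g (beta B u) = beta B (g u).
Proof.
move=> og; apply/lfunP => v.
by rewrite /contragredient comp_lfunE !betaE orthogonal_mapV.
Qed.

Section UnitRoot.
Context (s : 'End(V)) (alpha : 'Hom(V, C^o)).
Context (os : orthogonal_map B s) (rs : is_reflection s).
Context (alpha0 : alpha != 0) (s_alpha : contragredient s alpha = - alpha).
Let a := beta_inv B alpha.

Lemma reflection_root : s a = - a.
Proof.
have bi := lker0P (beta_inj ndB); apply: bi.
by rewrite -contragredient_beta // raddfN /= beta_invK.
Qed.

Lemma root_orth u : u \in fixedSpace s -> B a u = 0.
Proof.
move=> /fixedSpaceP su; have := os a u; rewrite reflection_root su linearNl.
move/eqP; rewrite eq_sym -subr_eq0 opprK -mulr2n mulrn_eq0 /=.
by move/eqP.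
Qed.

Lemma root_neq0 : a != 0.
Proof.
apply: contraNneq alpha0 => a0.
by rewrite -(beta_invK ndB alpha) -/a a0 raddf0.
Qed.

Lemma root_decomp u : exists2 v, v \in fixedSpace s & exists k, u = v + k *: a.
Proof.
have aF : a \notin fixedSpace s.
  apply/fixedSpaceP; rewrite reflection_root => /eqP.
  by rewrite eq_sym -subr_eq0 opprK -mulr2n -scaler_nat scaler_eq0 pnatr_eq0 (negPf root_neq0).
have : u \in (fixedSpace s + <[a]>)%VS.
  suff -> : (fixedSpace s + <[a]>)%VS = fullv by apply: memvf.
  apply/eqP; rewrite eqEdim subvf /= -(eqP rs).
  rewrite dimv_disjoint_sum; first by rewrite dim_vline root_neq0 addn1.
  apply/eqP; rewrite -subv0; apply/subvP => v; rewrite memv_cap => /andP[vF /vlineP[k vk]].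
  rewrite memv0; apply: contraNT aF => v0.
  have k0 : k != 0 by apply: contraNneq v0 => k0; rewrite vk k0 scale0r.
  by rewrite -[a](scalerK k0) -vk memvZ.
by case/memv_addP => v vF [w /vlineP[k ->] ->]; exists v => //; exists k.
Qed.

(** The root is orthogonal to the fixed hyperplane; if it were isotropic it would be orthogonal to
    all of V. *)
Lemma root_aniso : B a a != 0.
Proof.
apply: contraNneq root_neq0 => Baa; apply/eqP/bform_nondeg => u.
have [v vF [k ->]] := root_decomp u.
by rewrite addrC bformR Baa mulr0 add0r root_orth.
Qed.

Definition unit_root : V := (sqrtC (B a a))^-1 *: a.

Lemma unit_rootE : B unit_root unit_root = 1.
Proof.
rewrite /unit_root bformZ bformC bformZ mulrA -expr2 exprVn sqrtCK mulVf //.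
exact: root_aniso.
Qed.

Lemma reflection_unit_root v : s v = v - (2 * B unit_root v) *: unit_root.
Proof.
have [w wF [k ->]] := root_decomp v; have /fixedSpaceP sw := wF.
rewrite linearD linearZ /= sw reflection_root.
have -> : B unit_root (w + k *: a) = k * (sqrtC (B a a))^-1 * B a a.
  by rewrite /unit_root bformZ addrC bformR (root_orth wF) addr0 mulrCA mulrA.
rewrite /unit_root scalerA.
have -> : 2 * (k * (sqrtC (B a a))^-1 * B a a) * (sqrtC (B a a))^-1 = 2 * k.
  rewrite -{2}[B a a]sqrtCK; field.
  by rewrite sqrtC_eq0 root_aniso.
by rewrite -addrA -scalerBl scalerN -scaleNr; congr (_ + _ *: _); ring.
Qed.

(** The scale of [alpha] cancels, and only the square of the chosen square root enters. *)
Lemma coroot_unit_root u v :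
  alpha u * beta B v (coroot B alpha) = 2 * B unit_root u * B unit_root v.
Proof.
rewrite /coroot betaE -{1}(beta_invK ndB alpha) betaE -/a.
rewrite (bformC v) bformZ /dual_form -/a /unit_root !bformZ.
by move: (sqrtC _) (sqrtCK (B a a)) => c <-; rewrite -exprVn; ring.
Qed.
End UnitRoot.

Lemma reflection_alongE u v : B u u = 1 ->
  reflection_along B (beta B u) v = v - (2 * B u v) *: u.
Proof.
move=> uu; rewrite /reflection_along.
pose f w : V := w - (beta B u w : C) *: coroot B (beta B u).
have linf : linear f.
  move=> k w z; rewrite /f; move: (coroot _ _) => c; rewrite !betaE bformR scalerDl opprD scalerBr scalerA.
  by rewrite addrACA.
pose M := GRing.isLinear.Build _ _ _ _ f linf.
pose L : {linear V -> V} := HB.pack f M.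
have -> : linfun f v = f v by exact: (lfunE L v).
rewrite /f betaE /coroot /dual_form betaK // uu divr1 scalerA.
by rewrite mulrC.
Qed.
End OrthogonalGeometry.

(** * Orthonormal frames and their dual bases *)

Section OrthonormalFrame.
Context (C : numClosedFieldType) (V : vectType C) (B : {symmetric V}).
Context (d : nat) (dimV : \dim {:V} = d) (z : 'I_d -> V).
Context (z_on : forall i j, B (z i) (z j) = (i == j)%:R).

Lemma orthonormal_frame v : v = \sum_j B (z j) v *: z j.
Proof.
pose X := [tuple z i | i < d].
have XE (i : 'I_d) : X`_i = z i by rewrite -tnth_nth tnth_mktuple.
have coefE (k : 'I_d -> C) j : B (z j) (\sum_i k i *: z i) = k j.
  rewrite bform_sumr (bigD1 j) //= bformZr z_on eqxx big1 => [|i ij].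
    by rewrite addr0 mulr1.
  by rewrite bformZr z_on eq_sym (negPf ij) mulr0.
have Xfree : free X.
  apply/freeP => k; under eq_bigr do rewrite XE.
  by move=> k0 i; rewrite -(coefE k i) k0 linear0r.
have : v \in <<X>>%VS.
  suff /span_basis -> : basis_of fullv X by apply: memvf.
  by rewrite basisEfree Xfree subvf dimV size_tuple /=.
move/coord_span; under eq_bigr do rewrite XE.
by move=> vE; rewrite {1}vE; apply: eq_bigr => j _; rewrite [in RHS]vE coefE.
Qed.

Lemma orthonormal_dual (ndB : nondegenerate B) (x : 'I_d -> 'Hom(V, C^o)) (y : 'I_d -> V) :
  (forall i, beta_inv B (x i) = z i) ->
  (forall i j, x i (y j) = (i == j)%:R) -> forall j, x j = beta B (y j).
Proof.
move=> xz y_dual j; rewrite -(beta_invK ndB (x j)) xz; congr (beta B _).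
rewrite [RHS]orthonormal_frame (bigD1 j) //= big1 => [|i ij].
  by rewrite -xz -betaE beta_invK // y_dual eqxx scale1r addr0.
by rewrite -xz -betaE beta_invK // y_dual (negPf ij) scale0r.
Qed.
End OrthonormalFrame.

(** * The algebra A_kappa *)

Section CherednikCliffordRelations.
Context (C : numClosedFieldType) (V : vectType C) (B : {symmetric V}).
Context (ndB : nondegenerate B) (G : {fset 'End(V)}).
Context (reflG : real_reflection_group B G).
Context (kappa : 'End(V) -> C) (alpha : 'End(V) -> 'Hom(V, C^o)).
Context (alphaP : forall s : 'End(V), s \in G -> is_reflection s ->
   alpha s != 0 /\ contragredient s (alpha s) = - alpha s).
Local Notation A := (A_kappa B G kappa alpha).
Local Notation tens := (@tens C V B G kappa alpha).

(* V and its dual are identified through beta: x_u, y_u and gamma_u are all indexed *)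
(* by u in V, and an orthonormal basis is its own dual basis.                        *)
Definition posA (v : V) : A := tens (cherednik_V' B G kappa alpha (beta B v)) 1.
Definition dunklA (v : V) : A := tens (cherednik_V B G kappa alpha v) 1.
Definition gammaA (v : V) : A := tens 1 (gamma B (beta B v)).
Definition groupA (g : G) : A := tens (cherednik_G B kappa alpha g) 1.
Definition act_group (g : G) (v : V) : V := val g v.
Definition refl_group (g : G) : bool := is_reflection (val g).
Definition root_group (g : G) : V := unit_root B (alpha (val g)).

Local Notation X := posA.
Local Notation Y := dunklA.
Local Notation Gam := gammaA.
Local Notation Tg := groupA.

Let orthG (g : G) : orthogonal_map B (val g).
Proof. exact: refl_group_orthogonal reflG _ (valP g). Qed.
Let kerG (g : G) : lker (val g) == 0%VS.
Proof. exact: (orthogonal_map_ker ndB). Qed.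

Lemma tensL k a a' b : tens (k *: a + a') b = k *: tens a b + tens a' b.
Proof. exact: tensorL. Qed.
Lemma tensR k a b b' : tens a (k *: b + b') = k *: tens a b + tens a b'.
Proof. exact: tensorR. Qed.
Lemma tens1 : tens 1 1 = 1.
Proof. exact: tensor1. Qed.
Lemma tens_comm a b : tens a 1 * tens 1 b = tens 1 b * tens a 1.
Proof. exact: tensor_comm. Qed.
Lemma tensNr a b : tens a (- b) = - tens a b.
Proof. by rewrite (linN (fun k => tensR k a)). Qed.

Lemma tensl_rel a b : a = b -> tens a 1 = tens b 1. Proof. by move->. Qed.

Lemma posAL k u v : X (k *: u + v) = k *: X u + X v.
Proof.
rewrite /posA linearP -tensL; apply: tensl_rel.
by rewrite /cherednik_V' /pres_gen -pres_piZ -pres_piD; apply/pres_rel/cherednik_linV'.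
Qed.

Lemma dunklAL k u v : Y (k *: u + v) = k *: Y u + Y v.
Proof.
rewrite /dunklA -tensL; apply: tensl_rel.
by rewrite /cherednik_V /pres_gen -pres_piZ -pres_piD; apply/pres_rel/cherednik_linV.
Qed.

Lemma gammaAL k u v : Gam (k *: u + v) = k *: Gam u + Gam v.
Proof.
rewrite /gammaA linearP -tensR; congr (tens _ _).
by rewrite /gamma /pres_gen -pres_piZ -pres_piD; apply/pres_rel/clifford_lin.
Qed.

Lemma posA_comm u v : X u * X v = X v * X u.
Proof.
apply: tensorl_eq.
by rewrite /cherednik_V' /pres_gen -!pres_piM; apply/pres_rel/cherednik_commV'.
Qed.

Lemma dunklA_comm u v : Y u * Y v = Y v * Y u.
Proof.
apply: tensorl_eq.
by rewrite /cherednik_V /pres_gen -!pres_piM; apply/pres_rel/cherednik_commV.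
Qed.

Lemma dunklA_posA u v : Y u * X v - X v * Y u = B u v *: (1 : A) +
  \sum_(s | refl_group s)
    (2 * kappa (val s) * B (root_group s) u * B (root_group s) v) *: Tg s.
Proof.
apply: tensorl_bracket.
rewrite /cherednik_V /cherednik_V' /pres_gen -!pres_piM -pres_piB.
rewrite (pres_rel (cherednik_comm B G kappa alpha u (beta B v))).
rewrite pres_piD pres_piC betaE bformC pres_pi_sum; congr (_ + _).
apply: eq_bigr => s rs; rewrite pres_piZ; congr (_ *: _).
rewrite (coroot_unit_root ndB) /root_group; ring.
Qed.

Lemma gammaA_sq u v : Gam u * Gam v + Gam v * Gam u = (2 * B u v) *: (1 : A).
Proof.
apply: tensorr_anticomm.
rewrite -pres_piC /gamma /pres_gen -!pres_piM -pres_piD.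
have := clifford_sq B (beta B u) (beta B v); rewrite /dual_form !betaK //.
exact: pres_rel.
Qed.

Lemma posA_gamma u v : X u * Gam v = Gam v * X u. Proof. exact: tens_comm. Qed.
Lemma dunklA_gamma u v : Y u * Gam v = Gam v * Y u. Proof. exact: tens_comm. Qed.
Lemma groupA_gamma g v : Tg g * Gam v = Gam v * Tg g. Proof. exact: tens_comm. Qed.

Lemma groupA_posA g v : Tg g * X v = X (act_group g v) * Tg g.
Proof.
rewrite /posA /act_group -(contragredient_beta ndB _ (orthG g)); apply: tensorl_eq.
rewrite /cherednik_V' /cherednik_G /pres_gen -!pres_piM.
exact: pres_rel (cherednik_actV' _ _ _ _ _).
Qed.

Lemma groupA_dunklA g v : Tg g * Y v = Y (act_group g v) * Tg g.
Proof.
apply: tensorl_eq.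
rewrite /cherednik_V /cherednik_G /pres_gen -!pres_piM /act_group.
by apply/pres_rel/cherednik_actV.
Qed.

Lemma groupA_mul g h : exists gh, Tg g * Tg h = Tg gh.
Proof.
pose gh : G := [` refl_group_comp reflG (valP g) (valP h)]%fset.
exists gh; transitivity (tens (cherednik_G B kappa alpha g * cherednik_G B kappa alpha h) 1).
  exact/esym/tensorl_mul.
apply: tensl_rel.
by rewrite /cherednik_G /pres_gen -!pres_piM; apply/pres_rel/cherednik_mul.
Qed.

Lemma groupA_one : exists g, Tg g = 1.
Proof.
exists [` refl_group_id reflG]%fset; rewrite -tens1; apply: tensl_rel.
by apply/pres_rel/cherednik_one.
Qed.

Lemma act_group_orth g u v : B (act_group g u) (act_group g v) = B u v.
Proof. exact: orthG. Qed.
Lemma act_groupL g k u v : act_group g (k *: u + v) = k *: act_group g u + act_group g v.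
Proof. exact: linearP. Qed.
Lemma act_group_surj g u : exists v, act_group g v = u.
Proof. by exists ((val g)^-1%VF u); apply: lker0_lfunVK. Qed.

Lemma root_group_unit s : refl_group s -> B (root_group s) (root_group s) = 1.
Proof. by move=> rs; have [a0 sa] := alphaP (valP s) rs; apply: unit_rootE ndB _ _ (orthG s) rs a0 sa. Qed.

Lemma act_root_group s : refl_group s -> act_group s (root_group s) = - root_group s.
Proof.
move=> rs; have [a0 sa] := alphaP (valP s) rs.
rewrite /act_group (reflection_unit_root ndB (orthG s) rs a0 sa) -/(root_group s).
by rewrite root_group_unit // mulr1 scaler_nat mulr2n opprD addrA subrr sub0r.
Qed.

Lemma clifford_parity1 : clifford_parity 1 = 1 :> cliffordAlg B.
Proof. exact: (pres_hom1 (@clifford_parityP C V B)). Qed.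

Lemma parityL k (a b : A) : parity (k *: a + b) = k *: parity a + parity b.
Proof. by rewrite parityD parityZ. Qed.
Lemma parity1 : parity (1 : A) = 1.
Proof. by rewrite -tens1 parity_tens clifford_parity1. Qed.
Lemma parity_even (h : cherednikAlg B G kappa alpha) : parity (tens h 1) = tens h 1.
Proof. by rewrite parity_tens clifford_parity1. Qed.
Lemma parity_gamma v : parity (Gam v) = - Gam v.
Proof. by rewrite parity_tens clifford_parity_gamma tensNr. Qed.

Lemma A_ind (P : A -> Prop) : subspace P -> P 1 ->
  (forall v a, P a -> P (X v * a)) -> (forall v a, P a -> P (Y v * a)) ->
  (forall g a, P a -> P (Tg g * a)) -> (forall v a, P a -> P (Gam v * a)) ->
  forall a, P a.
Proof.
move=> sP P1 PX PY PT PG; apply: tensor_word_ind => // [[[v|u]|g] a Pa|u a Pa].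
- exact: PY.
- by rewrite -(beta_invK ndB u); apply: PX.
- exact: PT.
- by rewrite -(beta_invK ndB u); apply: PG.
Qed.

Lemma parityK (a : A) : parity (parity a) = a.
Proof.
move: a; apply: A_ind => [||v a|v a|g a|v a].
- exact: fixed_sqr_sub parityL.
- exact: fixed_sqr_even parity1.
- exact: fixed_sqrM (@parityM _ _ _ _ _ _) (fixed_sqr_even (parity_even _)).
- exact: fixed_sqrM (@parityM _ _ _ _ _ _) (fixed_sqr_even (parity_even _)).
- exact: fixed_sqrM (@parityM _ _ _ _ _ _) (fixed_sqr_even (parity_even _)).
- exact: fixed_sqrM (@parityM _ _ _ _ _ _) (fixed_sqr_odd parityL (parity_gamma v)).
Qed.

Lemma refl_pin_lift s : refl_group s -> pin_lift B act_group s [:: root_group s].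
Proof.
move=> rs; have [a0 sa] := alphaP (valP s) rs.
split=> [u|v]; first by rewrite inE => /eqP ->; apply: root_group_unit.
exact: (reflection_unit_root ndB (orthG s) rs a0 sa).
Qed.

(** A factorisation of g into reflections of G gives a lift by the corresponding unit roots. *)
Lemma group_pin_lift g : exists us, pin_lift B act_group g us.
Proof.
have [ss ssP gE] := refl_group_generated reflG (valP g).
exists [seq unit_root B (alpha s) | s <- ss]; split.
  move=> _ /mapP[s /ssP[sG rs] ->]; have [a0 sa] := alphaP sG rs.
  exact: unit_rootE ndB _ _ (refl_group_orthogonal reflG sG) rs a0 sa.
move=> v; rewrite /act_group gE; elim: ss ssP {gE} => [|s ss IH] ssP /=.
  by rewrite id_lfunE.
rewrite comp_lfunE IH => [|z zs]; last by apply: ssP; rewrite inE zs orbT.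
have [sG rs] := ssP s (mem_head _ _); have [a0 sa] := alphaP sG rs.
exact: (reflection_unit_root ndB (refl_group_orthogonal reflG sG) rs a0 sa).
Qed.

(** * Identification of the generators and of the supercentralizer in A_kappa *)

Context (d : nat) (dimV : \dim {:V} = d) (y : 'I_d -> V).
Context (y_on : forall i j, B (y i) (y j) = (i == j)%:R).
Local Notation xb := (fun j => beta B (y j)).

Let kap (g : G) := kappa (val g).
Local Notation cent := (cent X Y Gam (@parity C V B G kappa alpha) y).
Local Notation gen := (cent_generator B X Y Gam Tg act_group (@parity C V B G kappa alpha) y).
Local Notation proj := (proj X Y Gam (@parity C V B G kappa alpha) y).

Lemma cent_A_generated a : cent a <-> generated_subalgebra gen a.
Proof.
exact: (cent_generated (bformC B) (orthonormal_frame dimV y_on) y_on posAL dunklAL gammaAL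
  posA_comm dunklA_comm dunklA_posA gammaA_sq posA_gamma dunklA_gamma groupA_gamma
  groupA_posA groupA_dunklA groupA_mul groupA_one act_group_orth act_groupL act_group_surj
  root_group_unit act_root_group parityL (@parityM _ _ _ _ _ _) parity1
  (fun v => parity_even _) (fun v => parity_even _) (fun g => parity_even _) parity_gamma
  parityK refl_pin_lift group_pin_lift A_ind).
Qed.

Lemma FplusE : Fplus B G kappa alpha xb = (sqrtC 2)^-1 *: raise X Gam y.
Proof. by congr (_ *: _); apply: tensor_sum. Qed.

Lemma FminusE : Fminus B G kappa alpha xb y = (sqrtC 2)^-1 *: lower Y Gam y.
Proof. by congr (_ *: _); apply: tensor_sum. Qed.

Lemma EplusE : Eplus B G kappa alpha xb = raise2 X y.
Proof. exact: tensorl_sqr. Qed.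

Lemma EminusE : Eminus B G kappa alpha y = - lower2 Y y.
Proof. by rewrite /lower2 -scaleNr; apply: tensorl_sqr. Qed.

Lemma HcartanE : Hcartan B G kappa alpha xb y =
  2%:R^-1 *: cartan2 X Y Tg refl_group kap y.
Proof. by rewrite cartan2_half; apply: tensorl_cartan. Qed.

Lemma sqrtC2_inv : (sqrtC 2)^-1 * (sqrtC 2)^-1 = 2^-1 :> C.
Proof. by rewrite -invfM -expr2 sqrtCK. Qed.

Lemma supercentralizer_cent a : supercentralizer (osp12 B kappa alpha xb y) a <-> cent a.
Proof.
have t0 : (sqrtC 2)^-1 != 0 :> C by rewrite invr_eq0 sqrtC_eq0 pnatr_eq0.
have H := supercentP (bformC B) (orthonormal_frame dimV y_on) y_on dunklAL gammaAL
  posA_comm dunklA_comm dunklA_posA gammaA_sq posA_gamma dunklA_gamma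
  root_group_unit parityL (@parityM _ _ _ _ _ _)
  (fun v => parity_even _) (fun v => parity_even _) parity_gamma parityK a t0.
apply: iff_trans H.
by rewrite /supercentralizer /osp12 /= FplusE FminusE EplusE EminusE HcartanE.
Qed.

Lemma OsymE n (t : n.-tuple V) :
  Osym B kappa alpha xb y (map_tuple (beta B) t) = - 2%:R^-1 *: proj (alternate Gam t).
Proof.
have altE : tens 1 (antisym B (map_tuple (beta B) t)) = alternate Gam t.
  apply: (tensorr_alternate _ _ (c := fun i => gamma B (tnth (map_tuple (beta B) t) i))
    (g := fun i => Gam (tnth t i))) => i.
  by rewrite tnth_map.
rewrite /Osym /Pplus altE FplusE FminusE; congr (_ *: _).
exact: (proj_supercomm y parityL (@parityM _ _ _ _ _ _)
  (fun v => parity_even _) (fun v => parity_even _) parity_gamma parityK _ sqrtC2_inv).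
Qed.

Lemma rho_pin_lift a : rho_Gtilde B kappa alpha a <->
  exists g us, pin_lift B act_group g us /\ a = Tg g * pin_word Gam us.
Proof.
have tensE (g : G) us : tens (cherednik_G B kappa alpha g) (\prod_(u <- us) gamma B (beta B u))
    = Tg g * pin_word Gam us by apply: tensor_prod.
split=> [[c [g [[us [us1 -> gE]] ->]]]|[g [us [[us1 gE] ->]]]].
  exists g, (map (beta_inv B) us); rewrite -tensE; split; last first.
    congr (tens _ _); rewrite big_map; apply: eq_bigr => u _; by rewrite beta_invK.
  split=> [_ /mapP[u /us1 uu ->]|v] //.
  rewrite /act_group gE; elim: us us1 {gE} => [|u us IH] us1 /=; first by rewrite id_lfunE.
  have uu : B (beta_inv B u) (beta_inv B u) = 1 by apply: us1; rewrite mem_head.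
  rewrite comp_lfunE IH => [|z zs]; last by apply: us1; rewrite inE zs orbT.
  by rewrite -{1}(beta_invK ndB u) reflection_alongE.
exists (\prod_(u <- us) gamma B (beta B u)), g; split; last by rewrite tensE.
exists (map (beta B) us); split.
- by move=> _ /mapP[u /us1 uu ->]; rewrite /dual_form betaK.
- by rewrite big_map.
- apply/lfunP => v; apply: etrans (gE v) _.
  elim: us us1 {gE} => [|u us IH] us1 /=; first by rewrite id_lfunE.
  rewrite comp_lfunE -IH => [|z zs]; last by apply: us1; rewrite inE zs orbT.
  by rewrite reflection_alongE // us1 ?mem_head.
Qed.

Lemma generator_iff a :
  (rho_Gtilde B kappa alpha `|`
   [set a | exists u v, a = Osym B kappa alpha xb y [tuple u; v]] `|`
   [set a | exists u v w, a = Osym B kappa alpha xb y [tuple u; v; w]]) a <-> gen a.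
Proof.
have E2 u v : Osym B kappa alpha xb y [tuple beta B u; beta B v]
    = - 2%:R^-1 *: proj (alternate Gam [tuple u; v]).
  by rewrite -OsymE; congr Osym; apply: val_inj.
have E3 u v w : Osym B kappa alpha xb y [tuple beta B u; beta B v; beta B w]
    = - 2%:R^-1 *: proj (alternate Gam [tuple u; v; w]).
  by rewrite -OsymE; congr Osym; apply: val_inj.
split=> [[[/rho_pin_lift[g [us [gus ->]]]|[u [v ->]]]|[u [v [w ->]]]]|].
- exact: cent_generator_lift.
- by rewrite -(beta_invK ndB u) -(beta_invK ndB v) E2; apply: cent_generator2.
- rewrite -(beta_invK ndB u) -(beta_invK ndB v) -(beta_invK ndB w) E3.
  exact: cent_generator3.
case=> [g us gus|u v|u v w].
- by left; left; apply/rho_pin_lift; exists g, us.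
- by left; right; exists (beta B u), (beta B v); rewrite E2.
- by right; exists (beta B u), (beta B v), (beta B w); rewrite E3.
Qed.

Lemma supercentralizer_generated :
  supercentralizer (osp12 B (G := G) kappa alpha xb y) =
  generated_subalgebra
    (rho_Gtilde B kappa alpha `|`
     [set a | exists u v, a = Osym B kappa alpha xb y [tuple u; v]] `|`
     [set a | exists u v w, a = Osym B kappa alpha xb y [tuple u; v; w]]).
Proof.
rewrite (_ : _ `|` _ = gen); last by apply/predeqP => a; apply: generator_iff.
apply/predeqP => a; exact: iff_trans (supercentralizer_cent a) (cent_A_generated a).
Qed.

End CherednikCliffordRelations.

Theorem proposition4p9 (R : realType) (V : vectType R[i]) (d : nat)
    (d_gt0 : (0 < d)%N) (dimV : \dim {:V} = d)
    (B : {symmetric V}) (ndB : nondegenerate B)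
    (G : {fset 'End(V)}) (reflG : real_reflection_group B G)
    (kappa : 'End(V) -> R[i])
    (kappaJ : forall s g : 'End(V), s \in G -> is_reflection s -> g \in G ->
       kappa (g \o s \o g^-1)%VF = kappa s)
    (alpha : 'End(V) -> 'Hom(V, R[i]^o))
    (alphaP : forall s : 'End(V), s \in G -> is_reflection s ->
       alpha s != 0 /\ contragredient s (alpha s) = - alpha s)
    (x : 'I_d -> 'Hom(V, R[i]^o)) (y : 'I_d -> V)
    (x_orthonormal : forall i j, dual_form B (x i) (x j) = (i == j)%:R)
    (y_dual : forall i j, x i (y j) = (i == j)%:R) :
  supercentralizer (osp12 B (G := G) kappa alpha x y) =
  generated_subalgebra
    (rho_Gtilde B kappa alpha `|`
     [set a | exists u v, a = Osym B kappa alpha x y [tuple u; v]] `|`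
     [set a | exists u v w, a = Osym B kappa alpha x y [tuple u; v; w]]).
Proof.
have xE := orthonormal_dual dimV x_orthonormal ndB (fun i => erefl _) y_dual.
(* Under [beta] the two dual bases become one orthonormal basis y of V. *)
have -> : x = fun j => beta B (y j) by apply/funext.
apply: supercentralizer_generated => // i j.
by rewrite -betaE -xE y_dual.
Qed.
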